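(* There exist a continuous function $u:\mathbb{R}^2\to\mathbb{R}$, a bounded Borel function $\mathfrak{g}:\mathbb{R}^2\to\mathbb{R}$ with $|\mathfrak{g}|\le 1$ such that $$\partial_t u+\partial_x(u^2)=\mathfrak{g}\quad\text{in }\mathcal{D}'(\mathbb{R}^2),$$ and a compact set $K\subset\mathbb{R}^2$ with $\mathcal{L}^2(K)>0$ such that the intersection of $K$ with every characteristic curve of $u$ is $\mathcal{H}^1$-negligible. In particular, for such $u$: no Lagrangian parameterization associated with $u$ is absolutely continuous; for every Lagrangian parameterization $\chi$ the measure $\partial_y\chi$ has a nonzero Cantor part; and for every Lagrangian parameterization $\chi$ there is a Lagrangian source associated with $u$ and $\chi$ that is not an Eulerian source.
   Context: $\mathcal{L}^2$ is Lebesgue measure on $\mathbb{R}^2$ and $\mathcal{H}^1$ is 1-dimensional Hausdorff measure. Here the flux is $f(z)=z^2$. A characteristic of $u$ is a $C^1$ function $\gamma:I\to\mathbb{R}$ ($I$ an interval) with $\dot\gamma(t)=f'(u(t,\gamma(t)))$; the corresponding characteristic curve is $i_\gamma(t)=(t,\gamma(t))$ (identified with its image). A Lagrangian parameterization associated with $u$ is a continuous function $\chi:\mathbb{R}^2\to\mathbb{R}$, $(t,y)\mapsto\chi(t,y)$, such that: for each $y$, $t\mapsto\chi(t,y)$ is a characteristic; for each $t$, $y\mapsto\chi(t,y)$ is nondecreasing; the map $i_\chi(t,y)=(t,\chi(t,y))$ is onto $\mathbb{R}^2$. It is called absolutely continuous if $\mathcal{L}^2(i_\chi^{-1}(S))>0$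 for every Borel set $S\subset\mathbb{R}^2$ with $\mathcal{L}^2(S)>0$. Since $\chi$ is continuous and nondecreasing in $y$, its distributional derivative $\partial_y\chi$ is a nonnegative Radon measure on $\mathbb{R}^2$; its Cantor part is the part of its $\mathcal{L}^2$-singular part that vanishes on sets which are $\sigma$-finite with respect to $\mathcal{H}^1$. A Lagrangian source associated with $u$ and $\chi$ is a bounded Borel function $\mathfrak{g}$ with $\frac{d}{dt}u(t,\chi(t,y))=\mathfrak{g}(t,\chi(t,y))$ in $\mathcal{D}'(\mathbb{R})$ for every $y\in\mathbb{R}$. An Eulerian source is a bounded Borel function $\mathfrak{g}$ with $\partial_t u+\partial_x(f(u))=\mathfrak{g}$ in $\mathcal{D}'(\mathbb{R}^2)$. *)

(* Defs.v *)
From HB Require Import structures.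
From mathcomp Require Import all_boot all_order all_algebra.
From mathcomp Require Import all_classical all_reals all_analysis.
Set Implicit Arguments.
Unset Strict Implicit.
Unset Printing Implicit Defensive.
Import Order.TTheory GRing.Theory Num.Theory.
Import numFieldNormedType.Exports.
Local Open Scope classical_set_scope.
Local Open Scope ring_scope.

(** Points of the plane [R * R] are written [(t, x)] (or [(t, y)] for the
    domain of a Lagrangian parameterization): the first coordinate is time.
    [plane R] is convertible to [R * R] and carries the product of the Borel
    sigma-algebra of [R] with itself, i.e. the Borel sets of the plane;
    [lebesgue_measure] lives on [measurableTypeR R] rather than on [R]. *)
Notation plane R := (measurableTypeR R * measurableTypeR R)%type.

Definition borel2 {R : realType} (A : set (R * R)) : Prop :=
  measurable (A : set (plane R)).

Definition leb2 {R : realType} : {measure set (plane R) -> \bar R} :=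
  (@lebesgue_measure R \x @lebesgue_measure R)%E.

(** [R * R] carries the sup norm in the library, whereas the Hausdorff measure
    of the plane refers to the Euclidean distance. *)
Definition dist2 {R : realType} (p q : R * R) : R :=
  Num.sqrt ((p.1 - q.1) ^+ 2 + (p.2 - q.2) ^+ 2).

(** The point [0] is added so that the empty set has diameter [0], the supremum
    of the empty set in [\bar R] being [-oo]. *)
Definition diam {R : realType} (A : set (R * R)) : \bar R :=
  ereal_sup (0%E |` [set (dist2 p q)%:E | p in A & q in A]).

Definition hausdorff1_pre {R : realType} (delta : R) (A : set (R * R)) :
    \bar R :=
  ereal_inf [set (\sum_(i <oo) diam (E i))%E | E in
    [set E : (set (R * R))^nat |
      A `<=` \bigcup_i E i /\ forall i, (diam (E i) <= delta%:E)%E]].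

Definition hausdorff1 {R : realType} (A : set (R * R)) : \bar R :=
  ereal_sup [set hausdorff1_pre delta A | delta in [set delta : R | 0 < delta]].

Definition hausdorff1_sigma_finite {R : realType} (A : set (R * R)) : Prop :=
  exists F : (set (R * R))^nat,
    A = \bigcup_i F i /\ forall i, (hausdorff1 (F i) < +oo)%E.

(** On a finite-dimensional space this is the usual class [C^k]. *)
Fixpoint Ck {R : realType} {V : normedModType R} (k : nat) (f : V -> R) :
    Prop :=
  if k is k'.+1 then
    continuous f /\
    forall v : V, (forall x, derivable f x v) /\ Ck k' ('D_v f)
  else continuous f.

Definition test_function {R : realType} {V : normedModType R} (phi : V -> R) :
    Prop :=
  (forall k, Ck k phi) /\ compact (closure [set x | phi x != 0]).

Definition bounded_borel {R : realType} (g : R * R -> R) : Prop :=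
  measurable_fun setT (g : plane R -> R) /\ exists M : R, forall p, `|g p| <= M.

Definition flux {R : realType} (z : R) : R := z ^+ 2.

(** [d/dt u + d/dx (flux u) = g] in the sense of distributions on the plane. *)
Definition balance_law {R : realType} (u g : R * R -> R) : Prop :=
  forall phi : R * R -> R, test_function phi ->
    (\int[leb2]_p (u p * 'D_(1, 0) phi p + flux (u p) * 'D_(0, 1) phi p
                   + g p * phi p)%:E = 0)%E.

Definition eulerian_source {R : realType} (u g : R * R -> R) : Prop :=
  bounded_borel g /\ balance_law u g.

(** [dgamma] is the derivative of [gamma] on the interval [I], one-sided at the
    endpoints belonging to [I], and it is continuous on [I]. *)
Definition C1_on {R : realType} (I : set R) (gamma dgamma : R -> R) : Prop :=
  (forall t, I t ->
     (fun s => (gamma s - gamma t) / (s - t)) @ within I t^' --> dgamma t) /\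
  {within I, continuous dgamma}.

(** Values of [gamma] outside [I] are irrelevant. *)
Definition characteristic {R : realType} (u : R * R -> R) (I : set R)
    (gamma : R -> R) : Prop :=
  is_interval I /\ C1_on I gamma (fun t => derive1 flux (u (t, gamma t))).

Definition curve {R : realType} (I : set R) (gamma : R -> R) : set (R * R) :=
  [set (t, gamma t) | t in I].

Definition itime {R : realType} (chi : R * R -> R) (q : R * R) : R * R :=
  (q.1, chi q).

Definition lagrangian_parameterization {R : realType} (u chi : R * R -> R) :
    Prop :=
  [/\ continuous chi,
      forall y, characteristic u setT (fun t => chi (t, y)),
      forall t y1 y2, y1 <= y2 -> chi (t, y1) <= chi (t, y2) &
      range (itime chi) = setT].

Definition abs_continuous_param {R : realType} (chi : R * R -> R) : Prop :=
  forall S : set (R * R), borel2 S ->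
    (0 < leb2 S)%E -> (0 < leb2 (itime chi @^-1` S))%E.

Definition lagrangian_source {R : realType} (u chi g : R * R -> R) : Prop :=
  bounded_borel g /\
  forall (y : R) (phi : R -> R), test_function (phi : R^o -> R) ->
    (\int[lebesgue_measure]_t (u (t, chi (t, y)) * derive1 phi t
                               + g (t, chi (t, y)) * phi t)%:E = 0)%E.

(** [mu] is a Radon measure representing the distributional derivative of [chi]
    with respect to the second variable (on the plane, a Borel measure that is
    finite on compact sets is Radon). *)
Definition is_dy {R : realType} (chi : R * R -> R)
    (mu : {measure set (plane R) -> \bar R}) : Prop :=
  (forall C : set (R * R), compact C -> (mu C < +oo)%E) /\
  forall phi : R * R -> R, test_function phi ->
    (\int[mu]_p (phi p)%:E
     = - \int[leb2]_p (chi p * 'D_(0, 1) phi p)%:E)%E.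

Definition is_singular_part {R : realType}
    (mu mus : {measure set (plane R) -> \bar R}) : Prop :=
  exists mua : {measure set (plane R) -> \bar R},
    [/\ forall A, borel2 A -> mu A = (mua A + mus A)%E,
        mua `<< leb2 &
        exists N, [/\ borel2 N, leb2 N = 0%E & mus (~` N) = 0%E]].

(** The singular part splits uniquely as [muc + muj], where [muc] vanishes on
    the sets that are sigma-finite for [hausdorff1] and [muj] is concentrated
    on one such set; [muc] is the Cantor part. *)
Definition is_cantor_part {R : realType}
    (mu muc : {measure set (plane R) -> \bar R}) : Prop :=
  exists mus muj : {measure set (plane R) -> \bar R},
    [/\ is_singular_part mu mus,
        forall A, borel2 A -> mus A = (muc A + muj A)%E,
        forall A, borel2 A -> hausdorff1_sigma_finite A -> muc A = 0%E &
        exists J, [/\ borel2 J, hausdorff1_sigma_finite J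
                    & muj (~` J) = 0%E]].

Definition counterexample {R : realType} (u g : R * R -> R) (K : set (R * R)) :
    Prop :=
  [/\ continuous u,
      measurable_fun setT (g : plane R -> R) /\ (forall p, `|g p| <= 1),
      balance_law u g,
      compact K /\ (0 < leb2 K)%E &
      forall (I : set R) (gamma : R -> R), characteristic u I gamma ->
        hausdorff1 (K `&` curve I gamma) = 0%E].

(* Main.v *)
Require Import Defs.
From HB Require Import structures.
From mathcomp Require Import all_boot all_order all_algebra.
From mathcomp Require Import all_classical all_reals all_analysis.
From mathcomp Require Import measurable_realfun.
From mathcomp Require Import ring lra.
Set Implicit Arguments.
Unset Strict Implicit.
Unset Printing Implicit Defensive.
Import Order.TTheory GRing.Theory Num.Theory.
Import numFieldNormedType.Exports.
Local Open Scope classical_set_scope.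
Local Open Scope ring_scope.

(** Existence. The solution is a uniform limit of smooth ones [u_n], each with a
    function [Y_n] increasing in space and transported by the characteristics,
    [d_t Y_n + 2 u_n d_x Y_n = 0]. Given a rational time [r], replace [Y_n] by
    [Y_(n+1) = L(t, Y_n)], where [L(t, .)] is close to the identity and squeezes
    the phase [N Y_n] of a very high frequency [N]: most phases are moved near
    [pi] before time [r] and near [0] after it. The velocity that transports
    [Y_(n+1)] differs from [u_n] by [O(1/N)], and so does its source, because
    [L - id] and [d_t L] are [O(1/N)] while [d_z L] stays bounded below. Later
    maps [L] are the identity on the phases crossed in between, namely where
    [cos(2 N Y_(n+1)) <= 0]; hence a smooth step of [cos(N Y_(n+1))] is constant
    along every characteristic of the limit, and no characteristic can lie near
    phase [pi] before [r] and near phase [0] after [r]. The points lying in all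
    the prescribed phases form a compact set of positive measure which every
    characteristic meets at most once.

    Consequences. The slices of the preimage of [K] in a Lagrangian
    parameterization are null, hence so is the preimage, whereas
    [d_y chi (i_chi^-1 K) = leb2 K > 0]; as [d_y chi] gives a square of side [d]
    mass at most [d * omega(d)], with [omega] a modulus of continuity of [chi],
    it does not charge sets of sigma-finite length. Finally [u] is Lipschitz
    along characteristics (Dafermos), so that its derivative along them is a
    Lagrangian source [h], and so is [h + 1_K]: both cannot be Eulerian. *)

(** * Smooth functions and test functions *)

(** The limit velocity is only continuous, so its characteristics need not be unique and nothing can
    be proved by following one chosen flow. Whatever is claimed must hold for every solution of the
    differential equation. Perturbing [Y] and not [u] keeps the source under control. [Y] is
    constant along the old flow, so the phase derivative of [L_t / L_z], which is bounded but not
    small, enters the source only multiplied by [L_t / L_z], which is [O(1/N)]. The squeezing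
    profile starts from [phi + 2 atan (cot (phi / 2)) = pi] modulo [2 pi], a map that is constant
    and thus not invertible. Lowering 2 to [7/4] and smoothing the cotangent gives slope at least
    [1/8], while most phases still land within [pi / 4] of [pi]. Step [n] may change velocity and
    source, and lose measure, by at most [2^-(n+2)]. The total is [1/2]: the source stays below 1
    and at least half of the unit square survives. *)

Section Ck_closure.
Context {R : realType} {V : normedModType R}.
Implicit Types (f g : V -> R).

Lemma CkS k f : Ck k.+1 f -> Ck k f.
Proof.
elim: k f => [|k IH] f; first by case.
case=> cf df; split=> // v; have [dv /IH ?] := df v; split=> //.
Qed.

Lemma Ck_continuous k f : Ck k f -> continuous f.
Proof. by case: k => [//|k []]. Qed.

Lemma Ck_cst k (c : R) : Ck k (fun _ : V => c).
Proof.
elim: k c => [|k IH] c; first exact: cst_continuous.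
split; first exact: cst_continuous.
move=> v; split; first by move=> x; exact: derivable_cst.
rewrite (_ : 'D_v _ = fun _ => 0) //; apply/funext => x; exact: derive_cst.
Qed.

Lemma CkD k f g : Ck k f -> Ck k g -> Ck k (fun x => f x + g x).
Proof.
elim: k f g => [|k IH] f g; first by move=> cf cg x; apply: continuousD; [exact: cf|exact: cg].
move=> [cf df] [cg dg]; split; first by move=> x; apply: continuousD; [exact: cf|exact: cg].
move=> v; have [dfv Cf] := df v; have [dgv Cg] := dg v; split.
  by move=> x; exact: derivableD.
rewrite (_ : 'D_v _ = fun x => 'D_v f x + 'D_v g x); first exact: IH.
by apply/funext => x; exact: deriveD.
Qed.

Lemma CkN k f : Ck k f -> Ck k (fun x => - f x).
Proof.
elim: k f => [|k IH] f; first by move=> cf x; apply: continuousN; exact: cf.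
move=> [cf df]; split; first by move=> x; apply: continuousN; exact: cf.
move=> v; have [dfv Cf] := df v; split; first by move=> x; exact: derivableN.
rewrite (_ : 'D_v _ = fun x => - 'D_v f x); first exact: IH.
by apply/funext => x; exact: deriveN.
Qed.

Lemma CkM k f g : Ck k f -> Ck k g -> Ck k (fun x => f x * g x).
Proof.
elim: k f g => [|k IH] f g; first by move=> cf cg x; apply: continuousM; [exact: cf|exact: cg].
move=> Cf0 Cg0; have := CkS Cf0; have := CkS Cg0; move: Cf0 Cg0.
move=> [cf df] [cg dg] Ckg Ckf; split; first by move=> x; apply: continuousM; [exact: cf|exact: cg].
move=> v; have [dfv Cf] := df v; have [dgv Cg] := dg v; split.
  by move=> x; exact: derivableM.
rewrite (_ : 'D_v _ = fun x => f x * 'D_v g x + g x * 'D_v f x).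
  by apply: CkD; apply: IH.
by apply/funext => x; rewrite (deriveM (dfv x) (dgv x)).
Qed.

(** Only a directional derivative of [f] is given. On the line [t *: v + x] it becomes a derivative
    in one variable, to which the ordinary chain rule applies. *)
Lemma is_derive_comp1 (h : R -> R) f (x v : V) (a b : R) :
  is_derive (f x) 1 h a -> is_derive x v f b ->
  is_derive x v (fun y => h (f y)) (a * b).
Proof.
move=> dh df.
pose F (t : R) := f (t *: v + x).
have F0 : F 0 = f x by rewrite /F scale0r add0r.
have E (g : V -> R) (t : R) : t^-1 *: ((fun s : R => g (s *: v + x)) (t *: 1 + 0) -
    (fun s : R => g (s *: v + x)) 0) = t^-1 *: (g (t *: v + x) - g x).
  by rewrite /= addr0 scale0r add0r [t%:A]mulr1.
have dF : is_derive (0:R) 1 F b.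
  have [+ <-] := df => dd.
  split; first by move: dd; rewrite derivable1P.
  by rewrite /derive; under eq_fun do rewrite E.
have dH : is_derive (0:R) 1 (h \o F) (a * b).
  by rewrite -F0 in dh; exact: (@is_derive1_comp _ h F 0 a b dh dF).
have [ddH <-] := dH.
split; first by rewrite derivable1P.
by rewrite /derive; under [in RHS]eq_fun do rewrite (E (h \o f)).
Qed.

Lemma Ck_comp k (h : R^o -> R) f : Ck k h -> Ck k f -> Ck k (fun x => h (f x)).
Proof.
elim: k h f => [|k IH] h f.
  by move=> ch cf x; apply: continuous_comp; [exact: cf|exact: ch].
move=> Ch0 Cf0; have := CkS Cf0; move: Ch0 Cf0.
move=> [ch dh] [cf df] Ckf; split.
  by move=> x; apply: continuous_comp; [exact: cf|exact: ch].
move=> v; have [dfv Cf] := df v; have [dhv Ch] := dh 1.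
have D x : is_derive x v (fun y => h (f y)) ('D_1 h (f x) * 'D_v f x).
  by apply: is_derive_comp1; apply: derivableP.
split; first by move=> x; have [] := D x.
rewrite (_ : 'D_v _ = fun x => 'D_1 h (f x) * 'D_v f x).
  by apply: CkM => //; apply: (IH ('D_1 h) f).
by apply/funext => x; have [] := D x.
Qed.
End Ck_closure.

Section Ck_real.
Context {R : realType}.

Lemma is_deriveZ_dir (f : R -> R) (x v a : R) :
  is_derive x (1 : R) f a -> is_derive (x : R^o) (v : R^o) (f : R^o -> R) (v * a).
Proof.
move=> df.
have df' : is_derive (x : R^o) (v : R^o) (f \o id) (a * v).
  by apply: (@is_derive_comp1 R R^o f id x v a v).
by rewrite mulrC.
Qed.

Lemma Ck_real k (f f' : R -> R) : (forall x : R, is_derive x (1 : R) f (f' x)) ->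
  Ck k (f' : R^o -> R) -> Ck k.+1 (f : R^o -> R).
Proof.
move=> df Cf'; split.
  move=> x; apply: differentiable_continuous; apply/derivable1_diffP.
  by have [] := df x.
move=> v; have D x := is_deriveZ_dir v (df x).
split; first by move=> x; have [] := D x.
rewrite (_ : 'D_v _ = fun x : R^o => v * f' x); last first.
  by apply/funext => x; have [] := D x.
by apply: CkM => //; exact: Ck_cst.
Qed.

Lemma Ck_id k : Ck k (fun x : R^o => x : R).
Proof.
case: k => [x|k]; first exact: cvg_id.
by apply: (@Ck_real _ _ (fun _ => 1)); exact: Ck_cst.
Qed.

Lemma Ck_fst k : Ck k (fun p : R * R => p.1).
Proof.
case: k => [x|k]; first exact: cvg_fst.
have D (x v : R * R) : is_derive x v (fun p : R * R => p.1) v.1.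
  have E (h : R) : h != 0 -> h^-1 *: ((h *: v + x).1 - x.1) = v.1.
    by move=> h0 /=; rewrite addrK /GRing.scale/= mulKf.
  have C : (fun h : R => h^-1 *: ((h *: v + x).1 - x.1)) @ 0^' --> v.1.
    apply: cvg_near_cst; near=> h; apply: E; near: h; exact: nbhs_dnbhs_neq.
  split; first by apply/cvg_ex; exists v.1.
  exact: cvg_lim C.
split; first by move=> x; exact: cvg_fst.
move=> v; split; first by move=> x; have [] := D x v.
rewrite (_ : 'D_v _ = fun _ => v.1); first exact: Ck_cst.
by apply/funext => x; have [] := D x v.
Unshelve. all: by end_near.
Qed.

Lemma Ck_snd k : Ck k (fun p : R * R => p.2).
Proof.
case: k => [x|k]; first exact: cvg_snd.
have D (x v : R * R) : is_derive x v (fun p : R * R => p.2) v.2.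
  have E (h : R) : h != 0 -> h^-1 *: ((h *: v + x).2 - x.2) = v.2.
    by move=> h0 /=; rewrite addrK /GRing.scale/= mulKf.
  have C : (fun h : R => h^-1 *: ((h *: v + x).2 - x.2)) @ 0^' --> v.2.
    apply: cvg_near_cst; near=> h; apply: E; near: h; exact: nbhs_dnbhs_neq.
  split; first by apply/cvg_ex; exists v.2.
  exact: cvg_lim C.
split; first by move=> x; exact: cvg_snd.
move=> v; split; first by move=> x; have [] := D x v.
rewrite (_ : 'D_v _ = fun _ => v.2); first exact: Ck_cst.
by apply/funext => x; have [] := D x v.
Unshelve. all: by end_near.
Qed.

End Ck_real.

Section is_derive_lambda.
Context {R : realType} {V : normedModType R}.
Implicit Types (f g : V -> R) (x v : V) (a b : R).

Lemma is_deriveMf f g x v a b : is_derive x v f a -> is_derive x v g b ->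
  is_derive x v (fun y => f y * g y) (f x * b + g x * a).
Proof. exact: is_deriveM. Qed.

Lemma is_deriveDf f g x v a b : is_derive x v f a -> is_derive x v g b ->
  is_derive x v (fun y => f y + g y) (a + b).
Proof. exact: is_deriveD. Qed.

Lemma is_deriveBf f g x v a b : is_derive x v f a -> is_derive x v g b ->
  is_derive x v (fun y => f y - g y) (a - b).
Proof. exact: is_deriveB. Qed.

Lemma is_deriveNf f x v a : is_derive x v f a ->
  is_derive x v (fun y => - f y) (- a).
Proof. exact: is_deriveN. Qed.

Lemma is_deriveVf f x v a : f x != 0 -> is_derive x v f a ->
  is_derive x v (fun y => (f y)^-1) (- a / f x ^+ 2).
Proof.
move=> f0 [df <-]; split; first exact: derivableV.
by rewrite deriveV// /GRing.scale/= mulrC mulrN mulNr.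
Qed.

Lemma is_derive_cstf x v (c : R) : is_derive x v (fun _ => c) 0.
Proof. exact: is_derive_cst. Qed.

End is_derive_lambda.

(** * A smooth transition from 0 to 1 *)

Section smooth_step.
Context {R : realType}.

(** The functions [x^-n exp(-1/x)] extended by 0. Differentiation stays inside the family, so
    smoothness of all members follows from a single induction on the order. *)
Definition expinv (n : nat) (x : R) : R :=
  if 0 < x then x ^- n * expR (- x^-1) else 0.

Lemma expinv_ge0 n x : 0 <= expinv n x.
Proof.
rewrite /expinv; case: ifP => // x0; rewrite mulr_ge0 ?expR_ge0// invr_ge0 exprn_ge0//.
exact: ltW.
Qed.

Lemma expinv0_gt0 x : 0 < x -> 0 < expinv 0 x.
Proof. by move=> x0; rewrite /expinv x0 expr0 invr1 mul1r expR_gt0. Qed.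

Lemma expinv_le0 n x : x <= 0 -> expinv n x = 0.
Proof. by rewrite /expinv leNgt => /negbTE ->. Qed.

(** With [y = 1/x], one term of the exponential series gives [y^(n+2) / (n+2)! <= exp y], two powers
    more than [y^n] requires. The spare factor [x^2] makes the derivative at 0 vanish. *)
Lemma expinv_bound n x : `|expinv n x| <= (n.+2)`!%:R * x ^+ 2.
Proof.
rewrite ger0_norm ?expinv_ge0// /expinv; case: ifP => [x0|_]; last first.
  by rewrite mulr_ge0// sqr_ge0.
have y0 : 0 < x^-1 by rewrite invr_gt0.
have := expR_ge1Dxn n.+1 (ltW y0).
set E := expR _ => hE.
have E0 : 0 < E by exact: expR_gt0.
have h2 : x^-1 ^+ n.+2 / n.+2`!%:R <= E by apply: le_trans hE; rewrite lerDr.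
rewrite expRN -/E -exprVn.
rewrite ler_pdivrMr// [leLHS](_ : _ = (x^-1 ^+ n.+2 / n.+2`!%:R) * (n.+2`!%:R * x ^+ 2)).
  by rewrite mulrC ler_wpM2l// mulr_ge0// sqr_ge0.
have F0 : (n.+2`!%:R : R) != 0 by rewrite pnatr_eq0 -lt0n fact_gt0.
have xn0 : x != 0 by rewrite gt_eqF.
rewrite !(exprS x^-1) expr2; move: (x^-1 ^+ n) => a.
by field; rewrite xn0 F0.
Qed.

Lemma is_derive_expinv n (x : R) :
  is_derive x (1 : R) (expinv n) (- (n%:R * expinv n.+1 x) + expinv n.+2 x).
Proof.
have [x0|x0|->] := ltgtP x 0.
- rewrite !(expinv_le0 _ (ltW x0)) mulr0 oppr0 addr0.
  apply: (@near_eq_is_derive R R R (cst 0) (expinv n) x 1).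
  + near=> y; rewrite expinv_le0//; apply: ltW; near: y; exact: lt_nbhsl.
- apply: (@near_eq_is_derive R R R (fun y : R => y ^- n * expR (- y^-1)) (expinv n) x 1).
  + near=> y; rewrite /expinv; suff -> : 0 < y by [].
    near: y; exact: lt_nbhsr.
  + have xn : x != 0 by rewrite gt_eqF.
    have dV : is_derive x (1:R) (fun y : R => y^-1) (- x ^- 2 *: 1).
      exact: is_deriveV.
    have dX : is_derive x (1:R) (fun y : R => (y ^+ n)^-1) (- (x ^+ n) ^- 2 *: ((n%:R * x ^+ n.-1) *: 1)).
      apply: is_deriveV; rewrite ?expf_neq0//; apply: DeriveDef; first exact: exprn_derivable.
      by rewrite exp_derive.
    have dE : is_derive x (1:R) (fun y : R => expR (- y^-1)) (expR (- x^-1) * - (- x ^- 2 *: 1)).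
      exact: (@is_derive1_comp _ expR (fun y => - y^-1)).
    apply: (is_derive_eq (is_deriveMf dX dE)).
    rewrite /expinv x0 /GRing.scale/=.
    case: n dX => [|n] _; rewrite ?exprS /=; field; rewrite ?expf_neq0//.
- rewrite !expinv_le0// mulr0 oppr0 addr0.
  have C : (fun h : R => h^-1 *: (expinv n (h *: 1 + 0) - expinv n 0)) @ 0^' --> (0 : R).
    apply/cvgrPdist_le => e e0; near=> h.
    have hn : h != 0 by near: h; exact: nbhs_dnbhs_neq.
    rewrite sub0r normrN (expinv_le0 _ (lexx 0)) subr0 addr0 [h%:A]mulr1 normrM normfV.
    rewrite mulrC ler_pdivrMr ?normr_gt0//.
    apply: (le_trans (expinv_bound n h)).
    rewrite -(ger0_norm (sqr_ge0 h)) normrX expr2 mulrA ler_wpM2r//.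
    rewrite -ler_pdivlMl ?ltr0n ?fact_gt0//.
    near: h; apply: dnbhs0_le; rewrite mulr_gt0// invr_gt0 ltr0n fact_gt0//.
  split; first by apply/cvg_ex; exists 0.
  exact: cvg_lim C.
Unshelve. all: by end_near.
Qed.

Lemma Ck_expinv k n : Ck k (expinv n : R^o -> R).
Proof.
elim: k n => [|k IH] n.
  move=> x; apply: differentiable_continuous; apply/derivable1_diffP.
  by have [] := is_derive_expinv n x.
apply: (@Ck_real _ _ _ (fun x => - n%:R * expinv n.+1 x + expinv n.+2 x)).
  by move=> x; rewrite mulNr; exact: is_derive_expinv.
by apply: CkD => //; apply: CkM => //; exact: Ck_cst.
Qed.

Lemma Ck_inv k (f : R^o -> R) : (forall x, f x != 0) -> Ck k f ->
  Ck k (fun x => (f x)^-1).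
Proof.
move=> f0; elim: k => [|k IH] Ckf.
  by move=> x; apply: continuousV => //; exact: Ckf.
have Ckf' := CkS Ckf; case: Ckf => cf df.
have [d1 C1] := df 1.
apply: (@Ck_real _ _ _ (fun x => - ((f x)^-1 * (f x)^-1) * 'D_1 f x)).
  move=> x; apply: is_derive_eq.
    by apply: is_deriveV => //; apply: derivableP; exact: d1.
  by rewrite /GRing.scale/= expr2 invfM.
apply: CkM => //.
by apply: CkN; apply: CkM; exact: IH.
Qed.

Definition step (x : R) : R := expinv 0 x / (expinv 0 x + expinv 0 (1 - x)).

Lemma step_den_gt0 x : 0 < expinv 0 x + expinv 0 (1 - x).
Proof.
have [x0|x0] := ltP 0 x.
  by rewrite ltr_pwDl ?expinv0_gt0 ?expinv_ge0.
rewrite ltr_wpDl ?expinv_ge0 ?expinv0_gt0//; lra.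
Qed.

Lemma Ck_step k : Ck k (step : R^o -> R).
Proof.
apply: CkM; first exact: Ck_expinv.
apply: Ck_inv; first by move=> x; rewrite gt_eqF// step_den_gt0.
apply: CkD; first exact: Ck_expinv.
apply: (@Ck_comp _ _ k (expinv 0) (fun x : R^o => 1 - x)); first exact: Ck_expinv.
apply: CkD; first exact: Ck_cst.
by apply: CkN; exact: Ck_id.
Qed.

Lemma step_le0 x : x <= 0 -> step x = 0.
Proof. by move=> x0; rewrite /step expinv_le0// mul0r. Qed.

Lemma step_ge1 x : 1 <= x -> step x = 1.
Proof.
move=> x1; rewrite /step (@expinv_le0 _ (1 - x)); last by lra.
by rewrite addr0 divff// gt_eqF// expinv0_gt0//; lra.
Qed.

Lemma step_ge0 x : 0 <= step x.
Proof. by rewrite divr_ge0 ?expinv_ge0// ltW// step_den_gt0. Qed.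

Lemma step_le1 x : step x <= 1.
Proof. by rewrite ler_pdivrMr ?step_den_gt0// mul1r lerDl expinv_ge0. Qed.

(** The quotient rule after cancellation: all remaining terms are nonnegative, which makes [step]
    monotone. *)
Definition dstep (x : R) : R :=
  (expinv 2 x * expinv 0 (1 - x) + expinv 0 x * expinv 2 (1 - x)) /
  (expinv 0 x + expinv 0 (1 - x)) ^+ 2.

Lemma is_derive_step (x : R) : is_derive x (1 : R) step (dstep x).
Proof.
have d0 (y : R) : is_derive y (1 : R) (expinv 0) (expinv 2 y).
  by apply: (is_derive_eq (is_derive_expinv 0 y)); rewrite mul0r oppr0 add0r.
have d1 : is_derive x (1 : R) (fun y => 1 - y) (- 1).
  by apply: (is_derive_eq (is_deriveBf (is_derive_cstf x 1 1) (is_derive_id x 1))); rewrite sub0r.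
have d2 : is_derive x (1 : R) (fun y => expinv 0 (1 - y)) (expinv 2 (1 - x) * -1).
  exact: (@is_derive1_comp _ (expinv 0) (fun y => 1 - y) x _ _ (d0 _) d1).
have D0 := step_den_gt0 x.
have d3 := @is_deriveVf R R (fun y => expinv 0 y + expinv 0 (1 - y)) x 1 _ (lt0r_neq0 D0) (is_deriveDf (d0 x) d2).
apply: (is_derive_eq (is_deriveMf (d0 x) d3)).
rewrite /dstep; field; exact: lt0r_neq0.
Qed.

Lemma dstepE : dstep = 'D_1 (step : R^o -> R).
Proof. by apply/funext => x; have [_ ->] := is_derive_step x. Qed.

Lemma Ck_dstep k : Ck k (dstep : R^o -> R).
Proof. by rewrite dstepE; have [_ /(_ 1)[]] := @Ck_step k.+1. Qed.

Lemma dstep_ge0 x : 0 <= dstep x.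
Proof. by rewrite divr_ge0 ?sqr_ge0// addr_ge0// mulr_ge0// expinv_ge0. Qed.

Lemma dstep_le0 x : x <= 0 -> dstep x = 0.
Proof. by move=> x0; rewrite /dstep !(expinv_le0 _ x0) !mul0r addr0 mul0r. Qed.

Lemma dstep_ge1 x : 1 <= x -> dstep x = 0.
Proof.
move=> x1; have x0 : 1 - x <= 0 by lra.
by rewrite /dstep !(expinv_le0 _ x0) !mulr0 addr0 mul0r.
Qed.

Lemma step_nondecreasing x y : x <= y -> step x <= step y.
Proof.
move=> xy; have [->//|xney] := eqVneq x y.
have xy' : x < y by rewrite lt_neqAle xney.
have cs : {within `[x, y], continuous step}.
  by apply: continuous_subspaceT; exact: (Ck_continuous (@Ck_step 0)).
have [c _ e] := MVT xy' (fun z _ => is_derive_step z) cs.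
by rewrite -subr_ge0 e mulr_ge0 ?dstep_ge0// subr_ge0.
Qed.

End smooth_step.

(** * Borel sets and integrable functions of the plane *)

Section plane_measure.
Context {R : realType}.
Implicit Types (A : set (R * R)) (f : R * R -> R).

(** [borel2] refers to the product sigma-algebra and not to the topology, so an open set is
    exhibited as a countable union of open squares with rational centres and radii. *)
Lemma open_borel2 A : open A -> borel2 A.
Proof.
move=> oA.
pose I (q : rat * rat * rat) : set (R * R) :=
  [set p | `|p.1 - ratr q.1.1| < ratr q.2 /\ `|p.2 - ratr q.1.2| < ratr q.2].
pose D : set (rat * rat * rat) := [set q | I q `<=` A].
have -> : A = \bigcup_(q in D) I q.
  apply/seteqP; split; last by move=> p [q Dq Iq]; exact: Dq.
  move=> p Ap.
  have /nbhs_ballP[e /= e0 eA] : nbhs p A by exact: open_nbhs_nbhs.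
  have e20 : 0 < e / 2 by rewrite divr_gt0.
  have [r /itvP r0e] := rat_in_itvoo e20.
  have r0 : 0 < ratr r :> R by rewrite r0e.
  have re : ratr r < e / 2 by rewrite r0e.
  have h (x : R) : exists q : rat, `|x - ratr q| < ratr r.
    have : x - ratr r < x + ratr r by lra.
    move=> /rat_in_itvoo[q /itvP qx]; exists q.
    have h1 : ratr q < x + ratr r :> R by rewrite qx.
    have h2 : x - ratr r < ratr q :> R by rewrite qx.
    by rewrite ltr_norml; apply/andP; split; lra.
  have [q1 hq1] := h p.1; have [q2 hq2] := h p.2.
  exists (q1, q2, r) => //= z [/= z1 z2]; apply: eA; split => /=; rewrite /ball/=.
  - rewrite (_ : p.1 - z.1 = (p.1 - ratr q1) - (z.1 - ratr q1)); last by ring.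
    by apply: (le_lt_trans (ler_normB _ _)); lra.
  - rewrite (_ : p.2 - z.2 = (p.2 - ratr q2) - (z.2 - ratr q2)); last by ring.
    by apply: (le_lt_trans (ler_normB _ _)); lra.
rewrite /borel2 bigcup_mkcond; apply: countable_bigcupT_measurable => [|q]; first exact: countableP.
case: ifPn => // _.
have -> : I q = [set x : R | `|x - ratr q.1.1| < ratr q.2] `*` [set x : R | `|x - ratr q.1.2| < ratr q.2].
  by apply/seteqP; split=> p /=.
have M (c d : R) : measurable ([set x : R | `|x - c| < d] : set (measurableTypeR R)).
  rewrite (_ : [set x : R | _] = `]c - d, c + d[%classic); first exact: measurable_itv.
  apply/seteqP; split=> x /=; rewrite in_itv/= ltr_distl//.
by apply: measurableX; exact: M.
Qed.

Lemma closed_borel2 A : closed A -> borel2 A.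
Proof.
move=> /closed_openC/open_borel2 h; rewrite /borel2 -(setCK A).
exact: measurableC.
Qed.

Lemma compact_borel2 A : compact A -> borel2 A.
Proof.
move=> cA; have hd : hausdorff_space (R * R)%type by move=> x y; exact: norm_hausdorff.
by apply: closed_borel2; exact: compact_closed.
Qed.

Lemma continuous_borel2 f : continuous f -> measurable_fun setT (f : plane R -> R).
Proof.
move=> /continuousP cf; apply: (measurability _ (measurable_realfun.RGenOpens.measurableE R)).
move=> _ [_ [a [b ->] <-]]; rewrite setTI; apply: open_borel2.
by apply: cf; exact: interval_open.
Qed.

Lemma leb2_box (a b c d : R) : a <= b -> c <= d ->
  leb2 (`[a, b]%classic `*` `[c, d]%classic : set (plane R)) = ((b - a) * (d - c))%:E.
Proof.
move=> ab cd.
transitivity (lebesgue_measure (`[a, b]%classic : set R) * lebesgue_measure (`[c, d]%classic : set R))%E.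
  by apply: product_measure1E; exact: measurable_itv.
rewrite !lebesgue_measure_itv/= !lte_fin -!EFinB.
have -> : (if a < b then (b - a)%:E else 0%E) = (b - a)%:E.
  by case: ltP => // ba; congr EFin; lra.
have -> : (if c < d then (d - c)%:E else 0%E) = (d - c)%:E.
  by case: ltP => // ba; congr EFin; lra.
by [].
Qed.

Lemma integrable2_bounded (f : plane R -> R) (B M : R) : measurable_fun setT f ->
  (forall p, `|f p| <= M) -> (forall p, B < `|p.1| \/ B < `|p.2| -> f p = 0) ->
  leb2.-integrable setT (fun p => (f p)%:E).
Proof.
move=> mf fM f0.
have [B0|B0] := ltP B 0.
  rewrite (_ : (fun p => _) = cst 0%E); first exact: integrable0.
  apply/funext=> p; rewrite f0//; left; exact: lt_le_trans (normr_ge0 _).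
pose D : set (plane R) := `[- B, B]%classic `*` `[- B, B]%classic.
have mD : measurable D by apply: measurableX; exact: measurable_itv.
have : leb2.-integrable D (EFin \o f).
  apply: measurable_bounded_integrable => //.
  - by rewrite /D leb2_box ?ltry//; lra.
  - exact: measurable_funS mf.
  - exists M; split; first exact: num_real.
    by move=> x Mx p _; apply: (le_trans (fM p)); exact: ltW.
rewrite (_ : D = setT `&` D); last by rewrite setTI.
move/(integrable_restrict _ mD measurableT).
rewrite (_ : _ \_ _ = fun p => (f p)%:E)//.
apply/funext=> p; rewrite /patch; case: ifPn => // /negP pD.
rewrite f0//; apply: contrapT => /not_orP[h1 h2]; apply: pD.
rewrite inE /D/=; split; rewrite /= in_itv/= -ler_norml.
  by rewrite leNgt; exact/negP.
by rewrite leNgt; exact/negP.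
Qed.

Lemma integrable1_bounded (f : R -> R) (B M : R) : measurable_fun setT f ->
  (forall x, `|f x| <= M) -> (forall x, B < `|x| -> f x = 0) ->
  lebesgue_measure.-integrable setT (fun x => (f x)%:E).
Proof.
move=> mf fM f0.
pose D : set (measurableTypeR R) := `[- B, B]%classic.
have mD : measurable D by exact: measurable_itv.
have : lebesgue_measure.-integrable D (EFin \o f).
  apply: measurable_bounded_integrable => //.
  - have : (lebesgue_measure (`[(- B)%R, B]%classic : set R) < +oo)%E.
      by rewrite lebesgue_measure_itv/=; case: ifP => _; rewrite ?ltry.
    exact.
  - exact: measurable_funS mf.
  - exists M; split; first exact: num_real.
    by move=> x Mx p _; apply: (le_trans (fM p)); exact: ltW.
rewrite (_ : D = setT `&` D); last by rewrite setTI.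
move/(integrable_restrict _ mD measurableT).
rewrite (_ : _ \_ _ = fun p => (f p)%:E)//.
apply/funext=> p; rewrite /patch; case: ifPn => // /negP pD.
rewrite f0//; rewrite ltNge; apply/negP => h; apply: pD.
by rewrite inE /D/= in_itv/= -ler_norml.
Qed.

End plane_measure.

Section test_functions.
Context {R : realType}.

(** The vanishing is stated on a neighbourhood of [p], which is possible because the support is a
    closure; the derivatives of [phi] then vanish at [p] as well. *)
Lemma test_function_support {V : normedModType R} (phi : V -> R) : test_function phi ->
  exists2 B : R, 0 <= B & forall p, B < `|p| -> \near p, phi p = 0.
Proof.
case=> _ cK.
have /compact_bounded[M [_ hM]] := cK.
exists (`|M| + 1) => [|p Bp]; first by rewrite addr_ge0.
have np : ~ closure [set x | phi x != 0] p.
  have M1 : M < `|M| + 1 by rewrite ltr_pwDr// ler_norm.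
  by move=> /(hM _ M1) /=; rewrite leNgt Bp.
have oC : open (~` closure [set x | phi x != 0]).
  by apply: closed_openC; exact: closed_closure.
have : nbhs p (~` closure [set x | phi x != 0]) by apply: open_nbhs_nbhs.
apply: filterS => q /= nq; apply/eqP; apply: contrapT => /negP q0.
by apply: nq; exact: subset_closure.
Qed.

Lemma test_function_intro {V : normedModType R} (phi : V -> R) (B : R) :
  compact [set x : V | `|x| <= B] -> (forall k, Ck k phi) ->
  (forall x, B < `|x| -> phi x = 0) -> test_function phi.
Proof.
move=> cB Cphi phi0; split => //.
apply: subclosed_compact cB _; first exact: closed_closure.
rewrite closureE => x; apply; split.
  rewrite (_ : [set x | _] = (fun x : V => `|x|) @^-1` [set y | y <= B])//.
  by apply: closed_comp; [move=> y _; exact: norm_continuous|exact: closed_le].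
by move=> y /=; apply: contraR; rewrite -ltNge => /phi0 ->.
Qed.

Lemma near0_derive {V : normedModType R} (phi : V -> R) (p v : V) :
  (\near p, phi p = 0) -> 'D_v phi p = 0.
Proof.
move=> h; rewrite (@near_eq_derive _ _ _ _ (cst 0))//; first exact: derive_cst.
Qed.

Lemma test_function_derive {V : normedModType R} (phi : V -> R) (v : V) :
  test_function phi ->
  continuous phi /\ continuous ('D_v phi) /\ forall p, derivable phi p v.
Proof.
by case=> /(_ 1)[cf h] _; have [d1 c1] := h v.
Qed.

Lemma continuous_supp_bounded {V : normedModType R} (f : V -> R) (B : R) :
  compact [set x : V | `|x| <= B] -> continuous f ->
  (forall p, B < `|p| -> f p = 0) -> exists2 M, 0 <= M & forall p, `|f p| <= M.
Proof.
move=> cB cf f0.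
have cI : compact (f @` [set x : V | `|x| <= B]).
  by apply: continuous_compact => //; exact: continuous_subspaceT.
have /compact_bounded[M [_ hM]] := cI.
exists (`|M| + 1) => [|p]; first by rewrite addr_ge0.
have [pB|pB] := leP `|p| B.
  by apply: (hM (`|M| + 1)); [rewrite ltr_pwDr// ler_norm|exists p].
by rewrite f0// normr0 addr_ge0.
Qed.

Lemma compact_ball2 (B : R) : compact [set x : R * R | `|x| <= B].
Proof.
rewrite (_ : [set x | _] = `[- B, B]%classic `*` `[- B, B]%classic).
  by apply: compact_setX; exact: segment_compact.
by apply/seteqP; split=> p /=; rewrite !in_itv/= -!ler_norml prod_normE ge_max => /andP.
Qed.

Lemma compact_ball1 (B : R) : compact [set x : R^o | `|x| <= B].
Proof.
rewrite (_ : [set x | _] = `[- B, B]%classic); first exact: segment_compact.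
by apply/seteqP; split=> p /=; rewrite in_itv/= -ler_norml.
Qed.

End test_functions.

(** * Uniform continuity and integration on lines *)

Section calculus.
Context {R : realType}.

(** Heine-Cantor where only [x] is confined to the compact set and [y] may leave it. Compactness is
    used as a covering property with the radius [d] tending to [0+] as the parameter. *)
Lemma compact_unif_cont (V : normedModType R) (f : V -> R) (A : set V) (e : R) :
  compact A -> continuous f -> 0 < e ->
  exists2 d, 0 < d & forall x y, A x -> `|x - y| < d -> `|f x - f y| <= e.
Proof.
move=> /compact_near_coveringP cA cf e0.
pose P (d : R) (x : V) := forall y, `|x - y| < d -> `|f x - f y| <= e.
have : \forall d \near (0:R)^'+, A `<=` P d.
  apply: cA => x Ax.
  have /cvgrPdist_lt/(_ (e / 2)) := cf x.
  rewrite divr_gt0// => /(_ isT) /nbhs_ballP[r /= r0 hr].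
  have r20 : 0 < r / 2 by rewrite divr_gt0.
  exists (ball x (r / 2), [set d | d < r / 2]) => /=.
    split; first exact: nbhsx_ballx.
    exact: nbhs_right_lt.
  move=> [x' d] [/= xx' dr] y x'y.
  have h1 : `|f x - f x'| < e / 2.
    apply: hr; move: xx'; rewrite -ball_normE/= => h; apply: lt_trans h _; lra.
  have h2 : `|f x - f y| < e / 2.
    apply: hr; move: xx'; rewrite -ball_normE/= => h.
    rewrite (_ : x - y = (x - x') + (x' - y)); last by rewrite addrA subrK.
    by apply: (le_lt_trans (ler_normD _ _)); lra.
  rewrite (_ : f x' - f y = - (f x - f x') + (f x - f y)); last by ring.
  by apply: (le_trans (ler_normD _ _)); rewrite normrN; lra.
move=> h.
have : \forall d \near (0:R)^'+, 0 < d /\ A `<=` P d.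
  by near=> d; split; [near: d; exact: nbhs_right_gt|near: d].
move=> /filter_ex[d [d0 hd]].
by exists d => // x y /hd; exact.
Unshelve. all: by end_near.
Qed.

Lemma continuousDf (T : topologicalType) (f g : T -> R) : continuous f ->
  continuous g -> continuous (fun x => f x + g x).
Proof. by move=> cf cg x; exact: (continuousD (cf x) (cg x)). Qed.

Lemma continuousBf (T : topologicalType) (f g : T -> R) : continuous f ->
  continuous g -> continuous (fun x => f x - g x).
Proof. by move=> cf cg x; exact: (continuousB (cf x) (cg x)). Qed.

Lemma continuousMf (T : topologicalType) (f g : T -> R) : continuous f ->
  continuous g -> continuous (fun x => f x * g x).
Proof. by move=> cf cg x; exact: (continuousM (cf x) (cg x)). Qed.

Lemma continuous_compf (T : topologicalType) (f : T -> R) (h : R -> R) :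
  continuous f -> continuous h -> continuous (fun x => h (f x)).
Proof. by move=> cf ch x; apply: continuous_comp; [exact: cf|exact: ch]. Qed.

Lemma is_derive_continuous (F f : R -> R) :
  (forall x : R, is_derive x (1 : R) F (f x)) -> continuous F.
Proof.
move=> h x; apply: differentiable_continuous; apply/derivable1_diffP.
by have [] := h x.
Qed.

Lemma is_derive_slice2 (f : R * R -> R) (t y : R) : derivable f (t, y) (0, 1) ->
  is_derive y (1 : R) (fun z => f (t, z)) ('D_(0, 1) f (t, y)).
Proof.
move=> df.
have E (h : R) : h^-1 *: (((fun z => f (t, z)) \o shift y) (h *: 1) - f (t, y)) =
    h^-1 *: ((f \o shift (t, y)) (h *: ((0, 1) : R * R)) - f (t, y)).
  by congr (_ *: (f _ - _)); congr pair; rewrite /= ?scaler0 ?add0r.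
split; first by rewrite /derivable; under eq_fun do rewrite E.
by rewrite /derive; under eq_fun do rewrite E.
Qed.

Lemma is_derive_slice1 (f : R * R -> R) (t y : R) : derivable f (t, y) (1, 0) ->
  is_derive t (1 : R) (fun s => f (s, y)) ('D_(1, 0) f (t, y)).
Proof.
move=> df.
have E (h : R) : h^-1 *: (((fun s => f (s, y)) \o shift t) (h *: 1) - f (t, y)) =
    h^-1 *: ((f \o shift (t, y)) (h *: ((1, 0) : R * R)) - f (t, y)).
  by congr (_ *: (f _ - _)); congr pair; rewrite /= ?scaler0 ?add0r.
split; first by rewrite /derivable; under eq_fun do rewrite E.
by rewrite /derive; under eq_fun do rewrite E.
Qed.

Lemma FTC_cc (F f : R -> R) (a b : R) : a <= b ->
  (forall x : R, is_derive x (1 : R) F (f x)) -> continuous f ->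
  (\int[lebesgue_measure]_(x in `[a, b]) (f x)%:E = (F b - F a)%:E)%E.
Proof.
move=> ab dF cf.
have cF := is_derive_continuous dF.
move: ab; rewrite le_eqVlt => /predU1P[<-|ab].
  by rewrite set_itv1 integral_set1 subrr.
rewrite (continuous_FTC2 ab (F := F)) ?EFinB//.
- exact: continuous_subspaceT.
- split; first by move=> x _; have [] := dF x.
  + by apply: cvg_at_right_filter; exact: cF.
  + by apply: cvg_at_left_filter; exact: cF.
- by move=> x _; rewrite derive1E; have [] := dF x.
Qed.

Lemma integral_cond d (T : measurableType d) (mu : {measure set T -> \bar R})
    (A : set T) (f g : T -> R) :
  (forall x, A x -> g x = f x) -> (forall x, ~ A x -> g x = 0) ->
  (\int[mu]_x (g x)%:E = \int[mu]_(x in A) (f x)%:E)%E.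
Proof.
move=> h1 h2; rewrite [RHS]integral_mkcond; apply: eq_integral => x _.
rewrite /patch; case: ifPn => [/set_mem Ax|/negP nA]; first by rewrite h1.
by rewrite h2//; move=> Ax; apply: nA; rewrite inE.
Qed.

Lemma FTC_supp (F f : R -> R) (B : R) :
  (forall x : R, is_derive x (1 : R) F (f x)) -> continuous f ->
  (forall x, B < `|x| -> F x = 0 /\ f x = 0) ->
  (\int[lebesgue_measure]_x (f x)%:E = 0)%E.
Proof.
move=> dF cf h0; pose M := `|B| + 1.
have MB : B < M by rewrite /M ltr_pwDr// ler_norm.
have M0 : 0 <= M by rewrite addr_ge0.
rewrite (@integral_cond _ _ _ (`[- M, M]%classic : set (measurableTypeR R)) f f)//; last first.
  move=> x /=; rewrite in_itv/= -ler_norml => /negP; rewrite -ltNge => Mx.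
  by have [] := h0 x (lt_trans MB Mx).
rewrite (FTC_cc _ dF)//; last by lra.
have [FM _] : F M = 0 /\ f M = 0 by apply: h0; rewrite ger0_norm.
have [FNM _] : F (- M) = 0 /\ f (- M) = 0 by apply: h0; rewrite normrN ger0_norm.
by rewrite FM FNM subrr.
Qed.

Lemma leb2_le_slices (A : set (plane R)) (a b w : R) : a <= b -> 0 <= w ->
  measurable A -> (forall p, A p -> a <= p.1 <= b) ->
  (forall t, (lebesgue_measure (xsection A t) <= w%:E)%E) ->
  (leb2 A <= (w * (b - a))%:E)%E.
Proof.
move=> ab w0 mA Aab Aw.
have -> : leb2 A = (\int[lebesgue_measure]_x lebesgue_measure (xsection A x))%E by [].
have mf : measurable_fun setT (fun x => lebesgue_measure (xsection A x)).
  exact: measurable_fun_xsection.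
pose D : set (measurableTypeR R) := `[a, b]%classic.
have mD : measurable D by exact: measurable_itv.
apply: (@le_trans _ _ (\int[lebesgue_measure]_(x in D) (cst w%:E x))%E).
  rewrite [leRHS]integral_mkcond; apply: ge0_le_integral => //.
    by apply/(measurable_restrictT _ mD); exact: measurable_cst.
  move=> t _; rewrite /patch; case: ifPn => [//|/negP nD].
  rewrite (_ : xsection A t = set0) ?measure0//.
  apply/seteqP; split=> // x; rewrite /xsection/= inE => /Aab h; apply: nD.
  by rewrite inE /D/= in_itv.
rewrite integral_cst//.
apply: (@le_trans _ _ (w%:E * lebesgue_measure (`[a, b]%classic : set R))%E); first exact: lexx.
rewrite lebesgue_measure_itv/= lte_fin -EFinB.
case: ltP => ba; first by rewrite EFinM.
by rewrite mule0 lee_fin mulr_ge0// subr_ge0.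
Qed.

End calculus.

Lemma continuous_pair {R : realType} (T : topologicalType) (f g : T -> R) :
  continuous f -> continuous g -> continuous (fun x => (f x, g x)).
Proof. by move=> cf cg x; apply: (cvg_pair (cf x) (cg x)). Qed.

Lemma continuous_pairl {R : realType} (y : R) : continuous (fun t : R => (t, y)).
Proof.
have c1 : continuous (fun t : R => t) by move=> ?; exact: cvg_id.
have c2 : continuous (fun _ : R => y) by move=> ?; exact: cvg_cst.
exact: (continuous_pair c1 c2).
Qed.

Lemma continuous_pairr {R : realType} (t : R) : continuous (fun y : R => (t, y)).
Proof.
have c1 : continuous (fun _ : R => t) by move=> ?; exact: cvg_cst.
have c2 : continuous (fun y : R => y) by move=> ?; exact: cvg_id.
exact: (continuous_pair c1 c2).
Qed.

(** * Hausdorff measure and absolute continuity *)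

Section hausdorff.
Context {R : realType}.
Implicit Types (A E : set (R * R)).

Lemma diam_ge0 A : (0 <= diam A)%E.
Proof. by apply: ereal_sup_ubound; left. Qed.

Lemma le_diam A p q : A p -> A q -> ((dist2 p q)%:E <= diam A)%E.
Proof. by move=> Ap Aq; apply: ereal_sup_ubound; right; exists p => //; exists q. Qed.

Lemma le_dist2 (p q : R * R) : `|p.1 - q.1| <= dist2 p q /\ `|p.2 - q.2| <= dist2 p q.
Proof.
rewrite /dist2 -!sqrtr_sqr; split; apply: ler_wsqrtr.
  by rewrite lerDl sqr_ge0.
by rewrite lerDr sqr_ge0.
Qed.

Lemma diam_box A p (delta : R) : A p -> (diam A <= delta%:E)%E ->
  forall q, A q -> `|q.1 - p.1| <= fine (diam A) /\ `|q.2 - p.2| <= fine (diam A).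
Proof.
move=> Ap Ad q Aq; have [h1 h2] := le_dist2 q p.
have : ((dist2 q p)%:E <= diam A)%E by exact: le_diam.
move: (diam_ge0 A) Ad; case: (diam A) => //= d _ _.
by rewrite lee_fin => qd; split; [exact: le_trans h1 qd|exact: le_trans h2 qd].
Qed.

Lemma diam_fin A (delta : R) : (diam A <= delta%:E)%E -> diam A \is a fin_num.
Proof. by move=> h; rewrite ge0_fin_numE ?diam_ge0//; exact: le_lt_trans h (ltry _). Qed.

Lemma hausdorff1_cover A (delta e : R) : 0 < delta -> (hausdorff1 A < e%:E)%E ->
  exists E : (set (R * R))^nat, [/\ A `<=` \bigcup_i E i,
    forall i, (diam (E i) <= delta%:E)%E &
    (\sum_(i <oo) diam (E i) < e%:E)%E].
Proof.
move=> d0 Ae.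
have : (hausdorff1_pre delta A < e%:E)%E.
  by apply: le_lt_trans Ae; apply: ereal_sup_ubound; exists delta.
by move=> /ereal_inf_lt[_ [E [AE Ed] <-] Ee]; exists E.
Qed.

(** The projection on time does not increase distances: a set of the cover projects into an interval
    centred at one of its points, of length twice the diameter. Hence covers of total diameter below
    [e / 2]. This turns negligible intersections with characteristic curves into null sets of
    times. *)
Lemma hausdorff1_null_proj A (T : set R) : measurable T ->
  (forall t, T t -> exists x, A (t, x)) -> hausdorff1 A = 0%E ->
  lebesgue_measure T = 0%E.
Proof.
move=> mT TA A0; apply/eqP; rewrite eq_le measure_ge0 andbT.
apply/lee_addgt0Pr => e e0; rewrite add0e.
have e20 : 0 < e / 2 by rewrite divr_gt0.
have /(hausdorff1_cover ltr01)[E [AE Ed Ee]] : (hausdorff1 A < (e / 2)%:E)%E.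
  by rewrite A0 lte_fin.
have cI i : exists I : set R, [/\ measurable I, fst @` (E i) `<=` I &
    (lebesgue_measure I <= diam (E i) + diam (E i))%E].
  have [[p Ep]|nE] := pselect (exists p, E i p); last first.
    exists set0; split => //; last by rewrite measure0 adde_ge0 ?diam_ge0.
    by move=> x [q Eq _]; exfalso; apply: nE; exists q.
  have fd := diam_fin (Ed i); set d := fine (diam (E i)).
  have d0 : 0 <= d by rewrite fine_ge0 ?diam_ge0.
  exists `[p.1 - d, p.1 + d]%classic; split; first exact: measurable_itv.
    move=> _ [q Eq <-] /=; rewrite in_itv/= -ler_distl.
    by have [] := diam_box Ep (Ed i) Eq.
  rewrite lebesgue_measure_itv/= lte_fin.
  have -> : diam (E i) = d%:E by rewrite fineK.
  case: ifP => _; rewrite -EFinD lee_fin; last by rewrite addr_ge0.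
  by rewrite (_ : _ - _ = d + d)//; ring.
move: cI => /choice[I hI].
apply: (@le_trans _ _ (\sum_(i <oo) lebesgue_measure (I i))%E).
  apply: measure_sigma_subadditive => //; first by move=> i; have [] := hI i.
  move=> t /TA[x /AE[i _ Eix]]; exists i => //.
  by have [_ h _] := hI i; apply: h; exists (t, x).
apply: (@le_trans _ _ (\sum_(i <oo) (diam (E i) + diam (E i)))%E).
  by apply: lee_nneseries => [i _ _|i _]; [exact: measure_ge0|have [] := hI i].
rewrite nneseriesD; [|by move=> *; exact: diam_ge0|by move=> *; exact: diam_ge0].
by rewrite [e]splitr EFinD; apply: leeD; exact: ltW.
Qed.

Lemma hausdorff1_single A : (forall p q, A p -> A q -> p = q) -> hausdorff1 A = 0%E.
Proof.
move=> A1; have dA : diam A = 0%E.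
  apply/eqP; rewrite eq_le diam_ge0 andbT; apply: ge_ereal_sup => _ [->//|[p Ap [q Aq <-]]].
  by rewrite (A1 p q)// /dist2 !subrr expr0n/= addr0 sqrtr0.
have d0 : diam (set0 : set (R * R)) = 0%E.
  by apply/eqP; rewrite eq_le diam_ge0 andbT; apply: ge_ereal_sup => _ [->//|[p []]].
apply/eqP; rewrite eq_le; apply/andP; split.
  apply: ge_ereal_sup => _ [delta d_gt0 <-].
  (* [A] covers itself; the empty sets that complete the sequence have diameter 0 thanks to the
     point 0 added in [diam]. *)
  pose E (i : nat) := if i is 0%N then A else set0.
  have dE i : diam (E i) = 0%E by case: i.
  apply: ereal_inf_lbound; exists E.
    split; first by move=> p Ap; exists 0%N.
    by move=> i; rewrite dE lee_fin ltW.
  by apply: eseries0 => i _ _; exact: dE.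
apply: (@le_trans _ _ (hausdorff1_pre 1 A)); last first.
  by apply: ereal_sup_ubound; exists 1 => //=.
apply: le_ereal_inf_tmp => _ [E _ <-]; apply: nneseries_ge0 => i _ _; exact: diam_ge0.
Qed.

End hausdorff.

Section slices.
Context {R : realType}.

(** [leb2] is by definition the integral of the sections at fixed time. The sections known to be
    null are those at fixed [y], along characteristics, so the order is exchanged through uniqueness
    of the product measure. *)
Lemma leb2_ysection (A : set (plane R)) : measurable A ->
  leb2 A = (\int[lebesgue_measure]_y lebesgue_measure (ysection A y))%E.
Proof.
move=> mA.
transitivity ((@lebesgue_measure R \x^ @lebesgue_measure R)%E A); last by [].
apply: product_measure_unique => // B C mB mC.
exact: product_measure2E.
Qed.

Lemma leb2_null_ysection (A : set (plane R)) : measurable A ->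
  (forall y, lebesgue_measure (ysection A y) = 0%E) -> leb2 A = 0%E.
Proof. by move=> mA h; rewrite leb2_ysection// integral0_eq. Qed.

End slices.

Section lagrangian_null.
Context {R : realType}.
Variables (u g : R * R -> R) (K : set (R * R)) (chi : R * R -> R).
Hypothesis uK : counterexample u g K.
Hypothesis chiL : lagrangian_parameterization u chi.

Lemma continuous_itime : continuous (itime chi).
Proof.
have [cchi _ _ _] := chiL.
by apply: (@continuous_pair R) => [p|//]; exact: cvg_fst.
Qed.

Lemma closed_itimeK : closed (itime chi @^-1` K).
Proof.
have [_ _ _ [cK _] _] := uK.
apply: closed_comp; first by move=> p _; exact: continuous_itime.
by apply: compact_closed => //; exact: (@norm_hausdorff R (R * R)%type).
Qed.

Lemma continuous_slice y : continuous (fun t => chi (t, y)).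
Proof.
have [cchi _ _ _] := chiL.
move=> t; apply: (@continuous_comp _ _ _ (fun t => (t, y)) chi); last exact: cchi.
exact: continuous_pairl.
Qed.

Lemma lagrangian_slice_null y :
  measurable ([set t | K (t, chi (t, y))] : set (measurableTypeR R)) /\
  lebesgue_measure [set t | K (t, chi (t, y))] = 0%E.
Proof.
have [_ _ _ [cK _] nK] := uK; have [cchi char _ _] := chiL.
have mT : measurable ([set t | K (t, chi (t, y))] : set (measurableTypeR R)).
  apply: closed_measurable.
  apply: (@closed_comp _ _ (fun t => (t, y)) (itime chi @^-1` K)); last exact: closed_itimeK.
  by move=> t _; exact: continuous_pairl.
split=> //.
have := nK _ _ (char y); apply: hausdorff1_null_proj => // t /= Kt.
by exists (chi (t, y)); split => //; exists t.
Qed.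

Lemma lagrangian_preimage_null : leb2 (itime chi @^-1` K) = 0%E.
Proof.
have mN : borel2 (itime chi @^-1` K) by apply: closed_borel2; exact: closed_itimeK.
apply: leb2_null_ysection => // y.
have [_ <-] := lagrangian_slice_null y; congr lebesgue_measure.
by apply/seteqP; split=> t; rewrite /ysection/= inE.
Qed.

Lemma not_abs_continuous : ~ abs_continuous_param chi.
Proof.
have [_ _ _ [cK K0] _] := uK.
move=> /(_ K (compact_borel2 cK) K0); by rewrite lagrangian_preimage_null ltxx.
Qed.

End lagrangian_null.

(** * The Cantor part *)

Section lebesgue_decomposition.
Context d (T : measurableType d) (R : realType).
Variables (mu nu : {measure set T -> \bar R}).

(** Exhaustion: [N] is the union of a sequence of [nu]-null sets whose [mu]-masses in [D] approach
    their supremum. A [nu]-null set charging [D] outside [N] would, joined to [N], exceed the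
    supremum, which is finite because [D] has finite mass. *)
Lemma maximal_null_finite (D : set T) : measurable D -> (mu D < +oo)%E ->
  exists N, [/\ measurable N, nu N = 0%E &
    forall A, measurable A -> nu A = 0%E -> mu ((A `\` N) `&` D) = 0%E].
Proof.
move=> mD Dfin.
pose S := [set mu (B `&` D) | B in [set B | measurable B /\ nu B = 0%E]].
have SD x : S x -> (x <= mu D)%E.
  by move=> [B [mB _] <-]; apply: le_measure; rewrite ?inE//; exact: measurableI.
have S0 : S (mu (set0 `&` D)) by exists set0.
have sfin : ereal_sup S \is a fin_num.
  rewrite ge0_fin_numE.
    by apply: le_lt_trans Dfin; apply: ge_ereal_sup => x /SD.
  apply: le_trans (ereal_sup_ubound S0); exact: measure_ge0.
have cB (k : nat) : exists B, [/\ measurable B, nu B = 0%E &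
    (ereal_sup S - (k.+1%:R^-1)%:E < mu (B `&` D))%E].
  have k0 : 0 < k.+1%:R^-1 :> R by [].
  by have [_ [B [mB B0] <-] hB] := ub_ereal_sup_adherent k0 sfin; exists B.
have /choice[B hB] := cB.
have mB k : measurable (B k) by have [] := hB k.
pose N := \bigcup_k B k.
have mN : measurable N by exact: bigcup_measurable.
have N0 : nu N = 0%E.
  apply/(negligibleP _ mN); apply: negligible_bigcup => k.
  by have [mk k0 _] := hB k; exact/negligibleP.
have NS : (ereal_sup S <= mu (N `&` D))%E.
  apply/lee_addgt0Pr => e e0.
  have [k ke] : exists k : nat, k.+1%:R^-1 < e.
    have [k _ hk] := near_infty_natSinv_lt (PosNum e0).
    by exists k; exact: (hk k (leqnn k)).
  have [_ _ hk] := hB k.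
  rewrite -leeBlDr//; apply: (@le_trans _ _ (mu (B k `&` D))).
    apply: le_trans (ltW hk); apply: leeB => //; rewrite lee_fin; exact: ltW.
  apply: le_measure; rewrite ?inE; [exact: measurableI|exact: measurableI|].
  by apply: setSI; exact: bigcup_sup.
exists N; split=> // A mA A0.
have mAN : measurable ((A `\` N) `&` D) by apply: measurableI => //; exact: measurableD.
have SA : S (mu ((A `|` N) `&` D)).
  exists (A `|` N) => //; split; first exact: measurableU.
  have mAU : measurable (A `|` N) by exact: measurableU.
  by apply/(negligibleP _ mAU); apply: negligibleU; exact/negligibleP.
have := le_trans (ereal_sup_ubound SA) NS.
rewrite (_ : (A `|` N) `&` D = ((A `\` N) `&` D) `|` (N `&` D)); last first.
  apply/seteqP; split=> x /=.
    by move=> [[Ax|Nx] Dx]; have [Nx'|nNx] := pselect (N x); tauto.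
  by tauto.
rewrite measureU//; last 2 first.
- exact: measurableI.
- by apply/seteqP; split=> x //= [[[_ nN] _] [Nx _]].
have fN : mu (N `&` D) \is a fin_num.
  rewrite ge0_fin_numE ?measure_ge0//; apply: le_lt_trans Dfin.
  by apply: le_measure; rewrite ?inE//; exact: measurableI.
rewrite -leeBrDr// subee// => h; apply/eqP; rewrite eq_le h; exact: measure_ge0.
Qed.

(** This is the Lebesgue decomposition of [mu] with respect to [nu] in terms of sets: the
    restriction of [mu] to [N] is singular and the restriction to the complement is absolutely
    continuous. *)
Lemma maximal_null (D : (set T)^nat) : (forall n, measurable (D n)) ->
  (forall n, (mu (D n) < +oo)%E) -> \bigcup_n D n = setT ->
  exists N, [/\ measurable N, nu N = 0%E &
    forall A, measurable A -> nu A = 0%E -> mu (A `\` N) = 0%E].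
Proof.
move=> mD Dfin DT.
have /choice[F hF] n := maximal_null_finite (mD n) (Dfin n).
have mF n : measurable (F n) by have [] := hF n.
have mN : measurable (\bigcup_n F n) by exact: bigcup_measurable.
exists (\bigcup_n F n); split => //.
  apply/(negligibleP _ mN); apply: negligible_bigcup => k.
  by have [mk k0 _] := hF k; exact/negligibleP.
move=> A mA A0.
have mAN : measurable (A `\` \bigcup_n F n) by exact: measurableD.
apply/(negligibleP _ mAN).
apply: (@negligibleS _ _ _ _ (\bigcup_n ((A `\` F n) `&` D n))).
  move=> x [Ax nF]; have : setT x by []. rewrite -DT => -[n _ Dx].
  by exists n => //; split=> //; split=> // Fx; apply: nF; exists n.
apply: negligible_bigcup => n; apply/negligibleP.
  by apply: measurableI => //; exact: measurableD.
by have [_ _ h] := hF n; exact: h.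
Qed.

End lebesgue_decomposition.

(** * The derivative of [chi] in [y] as a push-forward *)

Section inverse.
Context {R : realType}.
Variable chi : R * R -> R.
Hypotheses (cchi : continuous chi)
  (mono : forall t y1 y2, y1 <= y2 -> chi (t, y1) <= chi (t, y2))
  (onto : forall t x, exists y, chi (t, y) = x).

(** [Y (t, x)] is the infimum of the [y] with [x <= chi (t, y)]; continuity of [chi] makes it a
    minimum. The Galois form of the statement gives measurability, the section property and all
    later computations without returning to infima. *)
Lemma inverse_exists : exists Y : R * R -> R,
  forall t x z, (Y (t, x) <= z) = (x <= chi (t, z)).
Proof.
suff h (p : R * R) : exists y, forall z, (y <= z) = (p.2 <= chi (p.1, z)).
  have /choice[Y hY] := h; exists Y => t x z; exact: (hY (t, x)).
case: p => t x /=.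
pose S := [set y | x <= chi (t, y)].
have [y1 hy1] := onto t x; have [y0 hy0] := onto t (x - 1).
have S1 : S y1 by rewrite /S/= hy1.
have lS : lbound S y0.
  move=> y Sy; rewrite leNgt; apply/negP => /ltW/(mono t); rewrite hy0 => h.
  by have := le_trans Sy h; rewrite lerBrDr gerDl ler10.
have hS : has_inf S by split; [exists y1|exists y0].
exists (inf S) => z; apply/idP/idP => [iz|xz]; last by apply: ge_inf => //; exists y0.
rewrite leNgt; apply/negP => zx.
have cz : continuous (fun y => chi (t, y)).
  move=> y; apply: (@continuous_comp _ _ _ (fun y => (t, y)) chi); last exact: cchi.
  exact: continuous_pairr.
have /cvgrPdist_lt/(_ (x - chi (t, z))) := cz z.
rewrite subr_gt0 => /(_ zx) /nbhs_ballP[e /= e0 he].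
have [s Ss sz] := inf_adherent e0 hS.
have [sz'|zs] := leP s z.
  by have := le_lt_trans (mono t sz') zx; rewrite ltNge Ss.
have := he s; rewrite /ball/= => /(_ _)/wrap[].
  by rewrite distrC gtr0_norm ?subr_gt0//; lra.
move=> h; have := ler_norm (- (chi (t, z) - chi (t, s))); rewrite normrN => h2.
by move: Ss; rewrite /S/= leNgt => /negP; apply; lra.
Qed.

Variable Y : R * R -> R.
Hypothesis YE : forall t x z, (Y (t, x) <= z) = (x <= chi (t, z)).

Lemma chi_Y t x : chi (t, Y (t, x)) = x.
Proof.
apply/eqP; rewrite eq_le -YE lexx andbT.
by have [y <-] := onto t x; apply: mono; rewrite YE.
Qed.

(** By the Galois relation [Y (t, x) > z] means [x > chi (t, z)], an open condition. *)
Lemma measurable_Y : measurable_fun setT (Y : plane R -> R).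
Proof.
apply: (measurability _ (RGenOInfty.measurableE R)).
move=> _ [_ [z ->] <-]; rewrite setTI; apply: open_borel2.
rewrite (_ : Y @^-1` _ = (fun p : R * R => p.2 - chi (p.1, z)) @^-1` [set x | 0 < x]); last first.
  by apply/seteqP; split=> -[t x] /=; rewrite in_itv/= andbT subr_gt0 !ltNge YE.
apply: open_comp; last exact: open_gt.
move=> p _; apply: continuousB; first exact: cvg_snd.
apply: (@continuous_comp _ _ _ (fun p : R * R => (p.1, z)) chi); last exact: cchi.
apply: (@continuous_pair R (R * R)%type) => [q|q]; [exact: cvg_fst|exact: cvg_cst].
Qed.

Definition ymap (p : plane R) : plane R := (p.1, Y p).

Lemma measurable_ymap : measurable_fun setT ymap.
Proof. by apply: measurable_fun_pair; [exact: measurable_fst|exact: measurable_Y]. Qed.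

(** At fixed [t], the condition [c < Y (t, x) <= d] selects the interval []chi (t, c), chi (t, d)]].
    The push-forward of Lebesgue measure by [ymap] is thus the Stieltjes measure of [chi (t, .)],
    integrated in [t]. *)
Definition dychi : {measure set (plane R) -> \bar R} :=
  measure_function_pushforward__canonical__measure_function_Measure leb2 measurable_ymap.

Lemma dychiE A : dychi A = leb2 (ymap @^-1` A).
Proof. by []. Qed.

Lemma dychi_box (a b c d w : R) : a <= b -> c <= d -> 0 <= w ->
  (forall t, a <= t <= b -> chi (t, d) - chi (t, c) <= w) ->
  (dychi (`[a, b]%classic `*` `[c, d]%classic) <= (w * (b - a))%:E)%E.
Proof.
move=> ab cd w0 hw; rewrite dychiE.
set B := `[a, b]%classic `*` `[c, d]%classic.
have mB : measurable (ymap @^-1` B).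
  rewrite -[X in measurable X]setTI; apply: measurable_ymap => //.
  by apply: measurableX; exact: measurable_itv.
apply: leb2_le_slices => //.
  by move=> p [/=]; rewrite in_itv.
move=> t; have [tab|ntab] := boolP (a <= t <= b); last first.
  rewrite (_ : xsection _ t = set0) ?measure0//.
  apply/seteqP; split=> // x; rewrite /xsection/= inE => -[/=]; rewrite in_itv/= => tab.
  by rewrite tab in ntab.
apply: (@le_trans _ _ (lebesgue_measure (`[chi (t, c), chi (t, d)]%classic : set R))).
  apply: le_measure; rewrite ?inE.
  - exact: measurable_xsection.
  - exact: measurable_itv.
  - move=> x; rewrite /xsection/= inE => -[_ /=]; rewrite !in_itv/= => /andP[cY Yd].
    by rewrite -YE Yd andbT -[leRHS](chi_Y t x) mono.
rewrite lebesgue_measure_itv/=; case: ifP => _; rewrite ?lee_fin//.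
exact: hw.
Qed.

Lemma dychi_compact (C : set (R * R)) : compact C -> (dychi C < +oo)%E.
Proof.
move=> cC.
have /compact_bounded[M [_ hM]] := cC.
pose M' := `|M| + 1.
have CM p : C p -> `|p| <= M'.
  by move=> Cp; apply: (hM M') => //; rewrite /M' ltr_pwDr// ler_norm.
have M'0 : 0 <= M' by rewrite addr_ge0.
have cI : compact (chi @` [set x : R * R | `|x| <= M']).
  by apply: continuous_compact; [exact: continuous_subspaceT|exact: compact_ball2].
have /compact_bounded[c [_ hc]] := cI.
pose c' := `|c| + 1.
have Cc p : `|p| <= M' -> `|chi p| <= c'.
  by move=> Cp; apply: (hc c'); [rewrite /c' ltr_pwDr// ler_norm|exists p].
have h : (dychi (`[(- M')%R, M']%classic `*` `[(- M')%R, M']%classic) <=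
    ((c' + c') * (M' - - M'))%:E)%E.
  apply: dychi_box; [lra|lra|by rewrite !addr_ge0|].
  move=> t tM; have tM' : `|t| <= M' by rewrite ler_norml.
  have nM : `|M'| <= M' by rewrite ger0_norm.
  have h1 : `|chi (t, M')| <= c' by apply: Cc; rewrite prod_normE ge_max tM'.
  have h2 : `|chi (t, - M')| <= c' by apply: Cc; rewrite prod_normE ge_max tM' normrN.
  by move: h1 h2; rewrite !ler_norml => /andP[_ ?] /andP[? _]; lra.
apply: le_lt_trans (le_lt_trans h (ltry _)).
apply: le_measure; rewrite ?inE.
- exact: compact_borel2.
- by apply: measurableX; exact: measurable_itv.
- by move=> p /CM; rewrite prod_normE ge_max !ler_norml => /andP[? ?]; split; rewrite /= in_itv.
Qed.

Lemma dychi_H1_finite (F : set (R * R)) (M : R) : 0 <= M -> (hausdorff1 F < +oo)%E ->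
  dychi.-negligible (F `&` [set p | `|p| <= M]).
Proof.
move=> M0 Ffin.
have F0 : (0 <= hausdorff1 F)%E.
  apply: (@le_trans _ _ (hausdorff1_pre 1 F)); last first.
    by apply: ereal_sup_ubound; exists 1 => //=.
  by apply: le_ereal_inf_tmp => _ [E _ <-]; apply: nneseries_ge0 => i _ _; exact: diam_ge0.
pose H := fine (hausdorff1 F) + 1.
have H0 : 0 < H by rewrite ltr_pwDr// fine_ge0.
have FH : (hausdorff1 F < H%:E)%E.
  rewrite /H EFinD fineK; last by rewrite ge0_fin_numE.
  by rewrite lteDl// ge0_fin_numE.
(* The total diameter of the covers stays below [H], whatever their mesh. The mass is then at most
   [2 * H] times the increment [e] of [chi] across a box, and [e] can be made arbitrarily small. *)
have step e : 0 < e -> exists C : set (plane R), [/\ measurable C, F `&` [set p | `|p| <= M] `<=` C &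
    (dychi C <= (e * (H + H))%:E)%E].
  move=> e0.
  have [d d0 hd] := compact_unif_cont (@compact_ball2 R (M + 1)) cchi e0.
  (* The boxes have height at most [2 * d / 3 < d], so [chi] varies by at most [e] across them; the
     bound 1 keeps them in the ball of radius [M + 1], where [d] is valid. *)
  pose dl := Num.min (d / 3) 1.
  have dl0 : 0 < dl by rewrite lt_min divr_gt0//=.
  have dl1 : dl <= 1 by rewrite ge_min lexx orbT.
  have dld : dl <= d / 3 by rewrite ge_min lexx.
  have [E [FE Ed Es]] := hausdorff1_cover dl0 FH.
  have cC i : exists C : set (plane R), [/\ measurable C, E i `&` [set p | `|p| <= M] `<=` C &
      (dychi C <= e%:E * (diam (E i) + diam (E i)))%E].
    have [[p [Ep /= pM]]|nE] := pselect (exists p, (E i `&` [set p | `|p| <= M]) p); last first.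
      exists set0; split => //.
        by move=> q Eq; apply: nE; exists q.
      by rewrite measure0 mule_ge0// ?adde_ge0 ?diam_ge0// lee_fin ltW.
    have fd := diam_fin (Ed i); set r := fine (diam (E i)).
    have r0 : 0 <= r by rewrite fine_ge0 ?diam_ge0.
    have rdl : r <= dl by move: (Ed i); rewrite -[diam _]fineK.
    exists (`[p.1 - r, p.1 + r]%classic `*` `[p.2 - r, p.2 + r]%classic); split.
    - by apply: measurableX; exact: measurable_itv.
    - move=> q [Eq _]; have [h1 h2] := diam_box Ep (Ed i) Eq.
      by split; rewrite /= in_itv/= -ler_distl.
    - have -> : (e%:E * (diam (E i) + diam (E i)) = (e * ((p.1 + r) - (p.1 - r)))%:E)%E.
        by rewrite -[diam _]fineK// -EFinD -EFinM; congr EFin; rewrite -/r; ring.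
      apply: dychi_box; [lra|lra|exact: ltW|].
      move=> t tp; apply: (le_trans (ler_norm _)); apply: hd.
        move: pM; rewrite /= !prod_normE !ge_max !ler_norml => /andP[/andP[? ?] /andP[? ?]].
        by apply/andP; split; apply/andP; split => /=; lra.
      rewrite prod_normE /= subrr normr0 gt_max d0/=.
      rewrite (_ : p.2 + r - (p.2 - r) = r + r); last by ring.
      by rewrite ger0_norm; lra.
  have /choice[C hC] := cC.
  have mC i : measurable (C i) by have [] := hC i.
  exists (\bigcup_i C i); split.
  - exact: bigcup_measurable.
  - move=> p [/FE[i _ Ep] pM]; exists i => //.
    by have [_ h _] := hC i; apply: h.
  - apply: (@le_trans _ _ (\sum_(i <oo) dychi (C i))%E).
      by apply: measure_sigma_subadditive => //; exact: bigcup_measurable.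
    apply: (@le_trans _ _ (\sum_(i <oo) e%:E * (diam (E i) + diam (E i)))%E).
      by apply: lee_nneseries => [i _ _|i _]; [exact: measure_ge0|have [] := hC i].
    rewrite nneseriesZl; last by move=> *; rewrite adde_ge0 ?diam_ge0.
    rewrite nneseriesD; [|by move=> *; exact: diam_ge0|by move=> *; exact: diam_ge0].
    rewrite EFinM; apply: lee_wpmul2l; first by rewrite lee_fin ltW.
    by rewrite EFinD; apply: leeD; exact: ltW.
have st (n : nat) : exists C : set (plane R), [/\ measurable C, F `&` [set p | `|p| <= M] `<=` C &
    (dychi C <= (n.+1%:R^-1 * (H + H))%:E)%E] by apply: step.
have /choice[C hC] := st.
have mC i : measurable (C i) by have [] := hC i.
have mI : measurable (\bigcap_i C i) by exact: bigcap_measurable.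
exists (\bigcap_i C i); split => //; last first.
  by move=> p Fp i _; have [_ h _] := hC i; exact: h.
apply/eqP; rewrite eq_le measure_ge0 andbT.
apply/lee_addgt0Pr => e e0; rewrite add0e.
have eH : 0 < e / (H + H) by rewrite divr_gt0// addr_gt0.
have [k ke] : exists k : nat, k.+1%:R^-1 < e / (H + H).
  have [k _ hk] := near_infty_natSinv_lt (PosNum eH).
  by exists k; exact: (hk k (leqnn k)).
have [_ _ hk] := hC k.
apply: (@le_trans _ _ (dychi (C k))).
  by apply: le_measure; rewrite ?inE//; exact: bigcap_inf.
apply: (le_trans hk); rewrite lee_fin.
have HH : 0 < H + H by rewrite addr_gt0.
by move/ltW: ke; rewrite ler_pdivlMr.
Qed.

Lemma dychi_H1_sigma_finite (A : set (R * R)) : borel2 A -> hausdorff1_sigma_finite A ->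
  dychi A = 0%E.
Proof.
move=> mA [F [AF Ffin]]; apply/(negligibleP _ mA).
suff : dychi.-negligible (\bigcup_n \bigcup_i (F n `&` [set p : R * R | `|p| <= i%:R]) : set (plane R)).
  apply: negligibleS; rewrite AF => p [n _ Fp]; exists n => //.
  exists (Num.truncn `|p|).+1 => //; split => //=; apply: ltW; exact: truncnS_gt.
by apply: negligible_bigcup => n; apply: negligible_bigcup => i; exact: dychi_H1_finite.
Qed.

End inverse.

(** * The push-forward is the distributional derivative *)

Section dy_weak.
Context {R : realType}.
Variable chi : R * R -> R.
Hypotheses (cchi : continuous chi)
  (mono : forall t y1 y2, y1 <= y2 -> chi (t, y1) <= chi (t, y2))
  (onto : forall t x, exists y, chi (t, y) = x).
Variable Y : R * R -> R.
Hypothesis YE : forall t x z, (Y (t, x) <= z) = (x <= chi (t, z)).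

(** Fubini for the function [h] below. Integrated in [y] it gives [psi (Y (t, x))]; integrated in
    [x] it gives [- psi' y * (chi (t, y) + c)], where the constant [c] disappears because [psi'] has
    integral 0. *)
Lemma dy_slice (psi psi' : R -> R) (t B : R) : 0 <= B ->
  (forall y : R, is_derive y (1 : R) psi (psi' y)) -> continuous psi' ->
  (forall y, B <= `|y| -> psi y = 0 /\ psi' y = 0) ->
  (\int[lebesgue_measure]_x (psi (Y (t, x)))%:E =
   - \int[lebesgue_measure]_y (chi (t, y) * psi' y)%:E)%E.
Proof.
move=> B0 dpsi cpsi' supp.
have ct : continuous (fun y => chi (t, y)).
  move=> y; apply: (@continuous_comp _ _ _ (fun y => (t, y)) chi); last exact: cchi.
  exact: continuous_pairr.
(* By monotonicity [|chi (t, y)| <= c] whenever [|y| <= B]. Cutting [x] to [[- c, c]] makes [h]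
   integrable and loses nothing: for other [x] the point [Y (t, x)] lies outside the support of
   [psi]. *)
pose c := `|chi (t, - B)| + `|chi (t, B)| + 1.
have c0 : 0 <= c by rewrite !addr_ge0.
have chic y : - B <= y -> y <= B -> - c <= chi (t, y) <= c.
  move=> y1 y2; have h1 := mono t y1; have h2 := mono t y2.
  have h3 := ler_norm (chi (t, B)); have h4 := ler_norm (- chi (t, - B)).
  have h5 := normr_ge0 (chi (t, B)); have h6 := normr_ge0 (chi (t, - B)).
  rewrite normrN in h4; rewrite /c; apply/andP; split; lra.
have [K K0 hK] : exists2 K, 0 <= K & forall y, `|psi' y| <= K.
  apply: (@continuous_supp_bounded R R^o psi' B) => //; first exact: compact_ball1.
  by move=> p Bp; have [] := supp p (ltW Bp).
(* the indicator of [x <= chi (t, y)], i.e. of [Y (t, x) <= y], times [- psi' y] *)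
pose h (p : R * R) : R :=
  if (- c <= p.1 <= c) && (p.1 <= chi (t, p.2)) then - psi' p.2 else 0.
have mh : measurable_fun setT (h : plane R -> R).
  apply: measurable_fun_ifT; last exact: measurable_cst.
    pose S : set (R * R) := [set p | - c <= p.1 /\ p.1 <= c /\ p.1 <= chi (t, p.2)].
    have cS : closed S.
      have -> : S = (fun p : R * R => p.1 + c) @^-1` [set x | 0 <= x] `&`
        ((fun p : R * R => c - p.1) @^-1` [set x | 0 <= x] `&`
         (fun p : R * R => chi (t, p.2) - p.1) @^-1` [set x | 0 <= x]).
        by apply/seteqP; split=> p /=; rewrite !subr_ge0 -[in 0 <= p.1 + c](opprK c) subr_ge0.
      have cf : continuous (fun p : R * R => p.1) by move=> p; exact: cvg_fst.
      have cs : continuous (fun p : R * R => chi (t, p.2)).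
        move=> p; apply: (@continuous_comp _ _ _ snd (fun y => chi (t, y))); last exact: ct.
        exact: cvg_snd.
      have cc : continuous (fun _ : R * R => c) by move=> p; exact: cvg_cst.
      apply: closedI; [|apply: closedI]; (apply: closed_comp; last exact: closed_ge).
      - by move=> p _; exact: continuousDf.
      - by move=> p _; exact: continuousBf.
      - by move=> p _; exact: continuousBf.
    apply: (measurable_fun_bool true); rewrite setTI.
    rewrite (_ : _ @^-1` _ = S); first exact: closed_borel2.
    apply/seteqP; split=> p /=.
      by move=> /andP[/andP[? ?] ?].
    by move=> [h1 [h2 h3]]; rewrite h1 h2 h3.
  apply: continuous_borel2 => p; apply: continuousN.
  by apply: (@continuous_comp _ _ _ snd psi'); [exact: cvg_snd|exact: cpsi'].
have ih : leb2.-integrable setT (fun p => (h p)%:E).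
  apply: (@integrable2_bounded _ _ (Num.max B c) K) => //.
    by move=> p; rewrite /h; case: ifP => _; rewrite ?normr0 ?normrN.
  move=> p; rewrite !gt_max => -[/andP[_ cp]|/andP[Bp _]]; rewrite /h.
    by case: ifP => // /andP[]; rewrite -ler_norml leNgt cp.
  by case: ifP => // _; have [_ ->] := supp p.2 (ltW Bp); rewrite oppr0.
have FTCB a b : a <= b -> (\int[lebesgue_measure]_(y in `[a, b]) (- psi' y)%:E =
    (psi a - psi b)%:E)%E.
  move=> ab; rewrite (FTC_cc ab (F := fun y => - psi y)); first by congr EFin; ring.
    by move=> y; apply: continuousN; exact: cpsi'.
have suppB : psi B = 0 by have [] := supp B; rewrite ?ger0_norm.
have suppNB : psi (- B) = 0 by have [] := supp (- B); rewrite ?normrN ?ger0_norm.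
have supp0 y : ~ (- B <= y <= B) -> psi y = 0 /\ psi' y = 0.
  by rewrite -ler_norml => /negP; rewrite -ltNge => /ltW/supp.
have E1 x : (\int[lebesgue_measure]_y (h (x, y))%:E = (psi (Y (t, x)))%:E)%E.
  have [xc|/negP xc] := boolP (- c <= x <= c); last first.
    rewrite integral0_eq; last by move=> y _; rewrite /h/= ifF//; apply/negP => /andP[].
    congr EFin; apply/esym.
    have [] := supp0 (Y (t, x)) => //; move=> /andP[h1 h2]; apply: xc.
    by have := chic _ h1 h2; rewrite (chi_Y mono onto YE).
  have [YB|BY] := leP (Y (t, x)) B; last first.
    rewrite integral0_eq; last first.
      move=> y _; rewrite /h/= xc/= -YE; case: ifP => // Yy.
      have [|_ ->] := supp y; last by rewrite oppr0.
      apply: le_trans (ler_norm y); apply: ltW; exact: lt_le_trans Yy.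
    congr EFin; apply/esym.
    by have [] := supp (Y (t, x)); rewrite ?(le_trans (ltW BY) (ler_norm _)).
  have [NBY|YNB] := leP (- B) (Y (t, x)).
    rewrite (@integral_cond _ _ _ _ (`[Y (t, x), B]%classic : set (measurableTypeR R)) (fun y => - psi' y)).
    - by rewrite FTCB// suppB subr0.
    - by move=> y /=; rewrite in_itv/= /h/= xc/= -YE => /andP[->].
    - move=> y /= /negP; rewrite in_itv/= /h/= xc/= -YE; case: ifP => //= _.
      by rewrite -ltNge => By; have [_ ->] := supp y (le_trans (ltW By) (ler_norm y)); rewrite oppr0.
  rewrite (@integral_cond _ _ _ _ (`[- B, B]%classic : set (measurableTypeR R)) (fun y => - psi' y)).
  - rewrite FTCB; last by lra.
    rewrite suppB suppNB subrr; congr EFin; apply/esym.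
    by have [] := supp0 (Y (t, x)); rewrite ?leNgt ?YNB.
  - move=> y /=; rewrite in_itv/= /h/= xc/= -YE => /andP[By _].
    by rewrite (le_trans (ltW YNB) By).
  - move=> y /=; rewrite in_itv/= => /supp0[_ p0]; by rewrite /h/= p0 oppr0; case: ifP.
have E2 y : (\int[lebesgue_measure]_x (h (x, y))%:E =
    ((- 1) * (chi (t, y) * psi' y) + - c * psi' y)%:E)%E.
  have [yB|/negP yB] := boolP (- B <= y <= B); last first.
    have [_ p0] := supp0 _ yB; rewrite p0 !mulr0 addr0 integral0_eq// => x _.
    by rewrite /h/= p0 oppr0; case: ifP.
  have /andP[h1 h2] : - c <= chi (t, y) <= c by case/andP: yB => *; exact: chic.
  rewrite (@integral_cond _ _ _ _ (`[- c, chi (t, y)]%classic : set (measurableTypeR R)) (cst (- psi' y))).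
  - have dF (x : R) : is_derive x (1 : R) (fun x => - psi' y * x) (cst (- psi' y) x).
      apply: (is_derive_eq (is_deriveMf (is_derive_cstf x 1 (- psi' y)) (is_derive_id x 1))).
      by rewrite mulr1 mulr0 addr0.
    rewrite (FTC_cc h1 dF); first by congr EFin; ring.
    by move=> x; exact: cvg_cst.
  - by move=> x /=; rewrite in_itv/= /h/= => /andP[-> xy]; rewrite xy (le_trans xy h2).
  - move=> x /= /negP; rewrite in_itv/= negb_and /h/= => /orP[/negbTE ->//|/negbTE ->].
    by rewrite andbF.
have := Fubini ih.
under eq_integral => x _ do rewrite E1.
under [in RHS]eq_integral => x _ do rewrite E2.
have i1 : lebesgue_measure.-integrable setT (fun y => (chi (t, y) * psi' y)%:E).
  have [K2 K20 hK2] : exists2 K2, 0 <= K2 & forall y, `|chi (t, y) * psi' y| <= K2.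
    apply: (@continuous_supp_bounded R R^o (fun y => chi (t, y) * psi' y) B).
    - exact: compact_ball1.
    - by move=> y; apply: continuousM; [exact: ct|exact: cpsi'].
    - by move=> y By; have [_ ->] := supp y (ltW By); rewrite mulr0.
  apply: (@integrable1_bounded _ _ B K2) => //.
    by apply: continuous_measurable_fun => y; apply: continuousM; [exact: ct|exact: cpsi'].
  by move=> y By; have [_ ->] := supp y (ltW By); rewrite mulr0.
have i2 : lebesgue_measure.-integrable setT (fun y => (- c * psi' y)%:E).
  apply: (@integrable1_bounded _ _ B (c * K)).
  - by apply: continuous_measurable_fun; apply: continuousMf => // y; exact: cvg_cst.
  - by move=> y; rewrite normrM normrN (ger0_norm c0); exact: ler_wpM2l.
  - by move=> y By; have [_ ->] := supp y (ltW By); rewrite mulr0.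
under [in RHS]eq_integral => y _ do rewrite EFinD EFinM.
rewrite integralD//; last by exact: integrableZl.
have -> : (\int[lebesgue_measure]_y (- c * psi' y)%:E = 0)%E.
  apply: (@FTC_supp _ (fun y => - c * psi y) _ B).
  - by apply: continuousMf => // y; exact: cvg_cst.
  - by move=> y By; have [-> ->] := supp y (ltW By); rewrite mulr0.
by rewrite adde0 integralZl// EFinN mulN1e.
Qed.

Lemma dy_weak (phi : R * R -> R) : test_function phi ->
  (\int[dychi cchi YE]_p (phi p)%:E = - \int[leb2]_p (chi p * 'D_(0, 1) phi p)%:E)%E.
Proof.
move=> tphi; have [B0 B00 hB0] := test_function_support tphi.
have [cphi [cdphi dphi]] := @test_function_derive R (R * R)%type phi (0, 1) tphi.
pose B := B0 + 1.
have B_ge0 : 0 <= B by rewrite addr_ge0.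
have supp p : B <= `|p| -> phi p = 0 /\ 'D_(0, 1) phi p = 0.
  move=> Bp; have nz : \near p, phi p = 0.
    by apply: hB0; apply: lt_le_trans Bp; rewrite ltrDl.
  by split; [exact: (nbhs_singleton nz)|exact: near0_derive].
have suppB p : B < `|p| -> phi p = 0 by move/ltW/supp => [].
have [K K0 hK] := continuous_supp_bounded (@compact_ball2 R B) cphi suppB.
have bnd (p : R * R) : B < `|p.1| \/ B < `|p.2| -> B <= `|p|.
  by rewrite prod_normE le_max => -[/ltW ->|/ltW ->]; rewrite ?orbT.
have mY := measurable_ymap cchi YE.
have mphi := continuous_borel2 cphi.
(* Since [x = chi (t, Y (t, x))], a large [x] forces [ymap Y (t, x)] out of the ball of radius [B]:
   this is why [phi] composed with [ymap Y] has bounded support. *)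
have [c0 c00 hc0] : exists2 c0, 0 <= c0 & forall p, `|p| <= B -> `|chi p| <= c0.
  have cI : compact (chi @` [set x : R * R | `|x| <= B]).
    by apply: continuous_compact; [exact: continuous_subspaceT|exact: compact_ball2].
  have /compact_bounded[c [_ hc]] := cI.
  exists (`|c| + 1) => [|p pB]; first by rewrite addr_ge0.
  by apply: (hc (`|c| + 1)); [rewrite ltr_pwDr// ler_norm|exists p].
have iphi : leb2.-integrable setT (fun p => (phi (ymap Y p))%:E).
  apply: (@integrable2_bounded _ _ (Num.max B c0) K) => [|p|p].
  - by apply: measurableT_comp.
  - exact: hK.
  - case: p => t x /= h.
    have [hp|/ltW/supp[]//] := leP `|(ymap Y (t, x) : R * R)| B.
    have /= := hp; rewrite prod_normE ge_max /= => /andP[h1 h2].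
    move: h; rewrite !gt_max => -[|] /andP[h3 h4]; first by rewrite leNgt h3 in h1.
    have := hc0 _ hp; rewrite /ymap/= (chi_Y mono onto YE) leNgt.
    by rewrite h4.
have cchiD : continuous (fun p => chi p * 'D_(0, 1) phi p) by exact: continuousMf.
have ichi : leb2.-integrable setT (fun p => (chi p * 'D_(0, 1) phi p)%:E).
  have sD p : B < `|p| -> chi p * 'D_(0, 1) phi p = 0.
    by move/ltW/supp => [_ ->]; rewrite mulr0.
  have [K2 K20 hK2] := continuous_supp_bounded (@compact_ball2 R B) cchiD sD.
  apply: (@integrable2_bounded _ _ B K2) => //; first exact: continuous_borel2.
  by move=> p /bnd/supp[_ ->]; rewrite mulr0.
rewrite (@integral_pushforward _ _ _ _ _ _ mY leb2 setT (fun p => (phi p)%:E))//; last first.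
  exact/measurable_EFinP.
rewrite preimage_setT -(integral12_prod_meas1 iphi) -(integral12_prod_meas1 ichi).
have E t : (\int[lebesgue_measure]_x (phi (ymap Y (t, x)))%:E =
    - \int[lebesgue_measure]_y (chi (t, y) * 'D_(0, 1) phi (t, y))%:E)%E.
  apply: (@dy_slice (fun y => phi (t, y)) (fun y => 'D_(0, 1) phi (t, y)) t B) => //.
  - by move=> y; exact: is_derive_slice2.
  - move=> y; apply: (@continuous_comp _ _ _ (fun y => (t, y)) ('D_(0, 1) phi)); last exact: cdphi.
    exact: continuous_pairr.
  - by move=> y yB; apply: supp; rewrite prod_normE/= le_max yB orbT.
transitivity (\int[lebesgue_measure]_t ((-1)%:E *
    fubini_F lebesgue_measure (fun p : plane R => (chi p * 'D_(0, 1) phi p)%:E) t))%E.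
  by apply: eq_integral => t _; rewrite EFinN mulN1e; exact: E.
by rewrite integralZl ?EFinN ?mulN1e//; exact: integrable_fubini_F.
Qed.

End dy_weak.

Section cantor_part.
Context {R : realType}.
Variables (u g : R * R -> R) (K : set (R * R)) (chi : R * R -> R).
Hypothesis uK : counterexample u g K.
Hypothesis chiL : lagrangian_parameterization u chi.

Lemma lagrangian_onto t x : exists y, chi (t, y) = x.
Proof.
have [_ _ _ ontoK] := chiL.
have : range (itime chi) (t, x) by rewrite ontoK.
by move=> [[s y] _ [-> <-]]; exists y.
Qed.

Definition restr_measure (mu : {measure set (plane R) -> \bar R}) (D : set (plane R))
    (mD : measurable D) : {measure set (plane R) -> \bar R} :=
  measure_function_mrestr__canonical__measure_function_Measure mu mD.

Lemma restr_measureE mu (D : set (plane R)) (mD : measurable D) A :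
  restr_measure mu mD A = mu (A `&` D).
Proof. by []. Qed.

Lemma cantor_part_nonzero : exists mu muc : {measure set (plane R) -> \bar R},
  [/\ is_dy chi mu, is_cantor_part mu muc & exists A, borel2 A /\ muc A <> 0%E].
Proof.
have [cchi _ mono _] := chiL; have onto := lagrangian_onto.
have [Y YE] := inverse_exists cchi mono onto.
pose mu := dychi cchi YE.
pose D n : set (plane R) := [set p : R * R | `|p| <= n%:R].
have mD n : measurable (D n) by apply: compact_borel2; exact: compact_ball2.
have Dfin n : (mu (D n) < +oo)%E.
  by apply: (dychi_compact cchi mono onto YE); exact: compact_ball2.
have DT : \bigcup_n D n = setT.
  apply/seteqP; split=> // p _; exists (Num.truncn `|p : R * R|).+1 => //.
  by apply: ltW; exact: truncnS_gt.
have [N [mN N0 hN]] := @maximal_null _ _ _ mu leb2 D mD Dfin DT.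
have mNC := measurableC mN.
exists mu, (restr_measure mu mN); split.
- split; first by move=> C; exact: (dychi_compact cchi mono onto YE).
  by move=> phi; exact: dy_weak.
(* The whole singular part is the Cantor part: [mu] does not charge any set of sigma-finite length,
   so the remaining part is 0, carried by the empty set. *)
- exists (restr_measure mu mN), mzero; split.
  + exists (restr_measure mu mNC); split.
    * move=> A mA; rewrite !restr_measureE -setDE.
      exact: (@measureDI _ _ _ mu A N mA mN).
    * apply/null_content_dominatesP => A mA A0.
      by rewrite restr_measureE -setDE; exact: hN.
    * by exists N; split=> //; rewrite restr_measureE setICl measure0.
  + by move=> A mA; rewrite /mzero/= adde0.
  + move=> A mA Asf; rewrite restr_measureE.
    have A0 := dychi_H1_sigma_finite cchi mono onto YE mA Asf.
    have mAN : measurable (A `&` N : set (plane R)) by exact: measurableI.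
    apply/(negligibleP _ mAN); apply: (@negligibleS _ _ _ _ (A : set (plane R))).
      exact: subIsetl.
    exact/negligibleP.
  + exists set0; split=> //; first exact: measurable0.
    exists (fun=> set0); split; first by rewrite bigcup0.
    by move=> i; rewrite hausdorff1_single ?ltry.
- pose N0' : set (plane R) := itime chi @^-1` K.
  have mN0 : measurable N0' by apply: closed_borel2; exact: closed_itimeK uK chiL.
  have N00 : leb2 N0' = 0%E by exact: lagrangian_preimage_null uK chiL.
  exists N0'; split => //.
  rewrite restr_measureE.
  have : mu N0' = leb2 K.
    (* [ymap Y] is a right inverse of [itime chi], so pulling [K] back by one and then by the other
       returns [K]. *)
    have S : ymap Y @^-1` N0' = K.
      by apply/seteqP; split=> -[t x]; rewrite /N0'/= /itime/= (chi_Y mono onto YE).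
    by rewrite /mu dychiE S.
  have e : (mu N0' = mu (N0' `\` N) + mu (N0' `&` N))%E.
    exact: (@measureDI _ _ _ mu N0' N mN0 mN).
  rewrite e (hN _ mN0 N00) add0e => muN.
  have [_ _ _ [_ K0] _] := uK.
  by move=> h; move: K0; rewrite -muN h ltxx.
Qed.

End cantor_part.

(** * Lagrangian sources *)

Section rademacher_monotone.
Context {R : realType}.
Variables (F : R -> R) (L : R).
Hypotheses (L0 : 0 <= L) (ndF : {homo F : x y / x <= y})
  (lipF : forall a b, a <= b -> F b - F a <= L * (b - a)).

Lemma monotone_lipschitz_continuous : continuous F.
Proof.
move=> x; apply/cvgrPdist_le => e e0.
have d0 : 0 < e / (L + 1) by rewrite divr_gt0// ltr_wpDl.
apply/nbhs_ballP; exists (e / (L + 1)) => //= y; rewrite /ball/= => xy.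
have h : `|F x - F y| <= L * `|x - y|.
  have [xley|/ltW yx] := leP x y.
    rewrite ler0_norm ?subr_le0 ?ndF// opprB distrC (@ger0_norm _ (y - x)) ?subr_ge0//.
    exact: lipF.
  by rewrite ger0_norm ?subr_ge0 ?ndF// (@ger0_norm _ (x - y)) ?subr_ge0//; exact: lipF.
apply: (le_trans h); apply: (@le_trans _ _ ((L + 1) * (e / (L + 1)))).
  by apply: ler_pM => //; [rewrite lerDl|exact: ltW].
by rewrite mulrC divfK// gt_eqF// ltr_wpDl.
Qed.

Let rcF : right_continuous F.
Proof. exact: right_continuousW monotone_lipschitz_continuous. Qed.

HB.instance Definition _ := isCumulative.Build R _ R F ndF rcF.

Let nu : {measure set (measurableTypeR R) -> \bar R} := lebesgue_stieltjes_measure F.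

Let nuE a b : a <= b -> nu `]a, b]%classic = (F b - F a)%:E.
Proof.
move=> ab.
transitivity (wlength F `]a, b]%classic); last exact: wlength_itv_bnd.
rewrite /nu/= /lebesgue_stieltjes_measure/= /measure_extension/=.
by rewrite measurable_mu_extE//; exact: is_ocitv.
Qed.

(** The mass of a half-open interval is at most [L] times its length, and a null set has covers by
    such intervals of arbitrarily small total length. The constant [L + 1] is used because it is
    positive. *)
Let nu_null A : lebesgue_measure A = 0%E -> nu A = 0%E.
Proof.
move=> A0; apply/eqP; rewrite eq_le measure_ge0 andbT.
apply/lee_addgt0Pr => e e0; rewrite add0e.
have L1 : 0 < L + 1 by rewrite ltr_wpDl.
have : (lebesgue_measure A < (e / (L + 1))%:E)%E by rewrite A0 lte_fin divr_gt0.
move=> /ereal_inf_lt[_ [B [mB AB] <-] hB].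
apply: (@le_trans _ _ (\sum_(k <oo) wlength F (B k))%E).
  by apply: ereal_inf_lbound; exists B.
apply: (@le_trans _ _ (\sum_(k <oo) (L + 1)%:E * wlength idfun (B k))%E).
  apply: lee_nneseries => k _ => [_|]; first exact: wlength_ge0.
  have /ocitvP[->|[[a b] /= ab ->]] := mB k; first by rewrite !wlength0 mule0.
  rewrite (wlength_itv_bnd F false false (ltW ab)) (wlength_itv_bnd idfun false false (ltW ab)).
  rewrite -EFinM lee_fin.
  by apply: (le_trans (lipF (ltW ab))); rewrite ler_wpM2r ?lerDl// subr_ge0 ltW.
rewrite nneseriesZl; last by move=> *; exact: wlength_ge0.
rewrite -lee_pdivlMl// -EFinM mulrC; exact: ltW hB.
Qed.

(** The Stieltjes measure of [F] is absolutely continuous, so [F] is an indefinite integral of a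
    Radon-Nikodym density, and Lebesgue differentiation applies. Bounded intervals []-n, n]] are
    treated one by one to have finite measures. *)
Lemma monotone_lipschitz_ae_derivable :
  {ae lebesgue_measure, forall x : R, derivable F x 1}.
Proof.
suff h (n : nat) : {ae lebesgue_measure, forall x : R, `|x| < n%:R -> derivable F x 1}.
  have := ae_foralln h; apply: filterS => x hx.
  by apply: (hx (Num.truncn `|x|).+1); exact: truncnS_gt.
pose I : set (measurableTypeR R) := `]- n%:R, n%:R]%classic.
have mI : measurable I by exact: measurable_itv.
have NN : - n%:R <= n%:R :> R by rewrite ge0_cp.
have nuI : (nu I < +oo)%E by rewrite /I nuE// ltry.
pose nuf : {charge set (measurableTypeR R) -> \bar R} := charge_of_finite_measure (mfrestr mI nuI).
have dom : nuf `<< lebesgue_measure.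
  apply/null_content_dominatesP => A mA A0.
  rewrite /nuf/= /charge_of_finite_measure /mfrestr /mrestr.
  have mAI : measurable (A `&` I) by exact: measurableI.
  apply/(negligibleP _ mAI); apply: (@negligibleS _ _ _ _ A); first exact: subIsetl.
  by apply/(negligibleP _ mA); exact: nu_null.
have [f ff] : exists f : R -> R, Radon_Nikodym nuf lebesgue_measure = EFin \o f.
  exists (fine \o Radon_Nikodym nuf lebesgue_measure); apply/funext => x /=.
  by rewrite fineK//; exact: Radon_Nikodym_fin_num.
have fi : lebesgue_measure.-integrable setT (EFin \o f).
  by rewrite -ff; exact: Radon_Nikodym_integrable.
have intf y : lebesgue_measure.-integrable [set` Interval (BRight (- n%:R)) (BRight y)] (EFin \o f).
  by apply: integrableS fi => //; exact: measurable_itv.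
have locf : locally_integrable setT f by exact: open_integrable_locally openT fi.
have := FTC1 intf locf.
apply: (@filterS _ _ (ae_filter_ringOfSetsType lebesgue_measure)) => x hx xn.
have /andP[nx xn'] : - n%:R < x < n%:R by rewrite -ltr_norml.
have [dG _] := hx nx.
have FE y : - n%:R <= y <= n%:R ->
    F y = \int[lebesgue_measure]_(t in `]- n%:R, y]) f t + F (- n%:R).
  move=> /andP[ny yn].
  rewrite /Rintegral -(eq_integral _ _ (fun z _ => congr1 (fun h => h z) ff)).
  have RN := @Radon_Nikodym_integral _ _ _ nuf lebesgue_measure (`]- n%:R, y]%classic) dom (measurable_itv _).
  rewrite -RN.
  rewrite /nuf/= /charge_of_finite_measure /mfrestr /mrestr.
  rewrite (_ : _ `&` I = `]- n%:R, y]%classic); last first.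
    apply/seteqP; split=> z /=; rewrite /I/= !in_itv/=; first by case.
    by move=> /andP[-> zy]; rewrite zy (le_trans zy yn).
  by rewrite nuE//= subrK.
have dG' : derivable (fun y : R => \int[lebesgue_measure]_(t in `]- n%:R, y]) f t + F (- n%:R)) x 1.
  exact: (derivableD dG (@derivable_cst _ _ _ _ _ _)).
apply: near_eq_derivable dG'.
near=> y; rewrite -FE//; apply/andP; split; apply: ltW; near: y.
- exact: lt_nbhsr.
- exact: lt_nbhsl.
Unshelve. all: by end_near.
Qed.

End rademacher_monotone.

Section rademacher.
Context {R : realType}.
Implicit Types (F w phi : R -> R).

Lemma primitive_compact F B : continuous F -> (forall x, B < `|x| -> F x = 0) ->
  exists A, forall x : R, is_derive x (1 : R) A (F x).
Proof.
move=> cF F0.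
have [M M0 hM] := continuous_supp_bounded (@compact_ball1 R B) cF F0.
have iF : lebesgue_measure.-integrable setT (EFin \o F).
  by apply: (@integrable1_bounded _ F B M) => //; exact: continuous_measurable_fun.
have iF' u : lebesgue_measure.-integrable [set` Interval -oo%O (BRight u)] (EFin \o F).
  by apply: integrableS iF => //; exact: measurable_itv.
exists (fun x => \int[lebesgue_measure]_(s in [set` Interval -oo%O (BRight x)]) F s) => x.
have xx : x < x + 1 by rewrite ltrDl.
have [d1 d2] := @continuous_FTC1 R F -oo%O x (x + 1) xx (iF' _) (ltNyr x) (cF x).
by split; [exact: d1|rewrite -derive1E].
Qed.

Definition lipschitz_on_line (L : R) F := forall s t, `|F s - F t| <= L * `|s - t|.

(** Adding [L * x] makes [F] nondecreasing, with Lipschitz constant [L + L]. *)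
Lemma lipschitz_ae_derivable L F : 0 <= L -> lipschitz_on_line L F ->
  {ae lebesgue_measure, forall x : R, derivable F x 1}.
Proof.
move=> L0 hF.
have h a b : a <= b -> `|F b - F a| <= L * (b - a).
  by move=> ab; rewrite -[X in _ * X]ger0_norm ?subr_ge0//; exact: hF.
have nd : {homo (fun x => F x + L * x) : x y / x <= y}.
  by move=> x y xy; have := h _ _ xy; rewrite ler_norml => /andP[? _]; lra.
have lip a b : a <= b -> (F b + L * b) - (F a + L * a) <= (L + L) * (b - a).
  by move=> xy; have := h _ _ xy; rewrite ler_norml => /andP[_ ?]; lra.
have L20 : 0 <= L + L by rewrite addr_ge0.
have := monotone_lipschitz_ae_derivable L20 nd lip.
apply: (@filterS _ _ (ae_filter_ringOfSetsType lebesgue_measure)) => x dx.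
rewrite (_ : F = fun x => (F x + L * x) - L * x); last by apply/funext => y; rewrite addrK.
by apply: derivableB => //; apply: derivableM.
Qed.

(** Only the steps [1 / (n+1)] are used: for a sequence of quotients, an upper limit is
    measurable. *)
Definition dquot F (n : nat) (t : R) : R := n.+1%:R * (F (t + n.+1%:R^-1) - F t).

Lemma dquot_seq_cvg F (t : R) (e : R^nat) : derivable F t 1 ->
  (forall n, e n != 0) -> e @ \oo --> (0 : R) ->
  (fun n => (e n)^-1 * (F (t + e n) - F t)) @ \oo --> 'D_1 F t.
Proof.
move=> dF e0 ce.
have /cvgr_dnbhsP/(_ e (conj e0 ce)) := dF : _ @ (0:R)^' --> 'D_1 F t.
apply: cvg_trans; apply: near_eq_cvg; near=> n.
by rewrite /= [_%:A]mulr1 (addrC t).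
Unshelve. all: by end_near.
Qed.

Lemma dquot_cvg F t : derivable F t 1 -> dquot F ^~ t @ \oo --> 'D_1 F t.
Proof.
move=> dF; have := dquot_seq_cvg dF _ cvg_harmonic.
move=> /(_ (fun n => _))/wrap[] => [n|]; first by rewrite /= invr_neq0// pnatr_eq0.
apply: cvg_trans; apply: near_eq_cvg; near=> n.
by rewrite /dquot/= invrK.
Unshelve. all: by end_near.
Qed.

Lemma dquot_bound L F n t : 0 <= L -> lipschitz_on_line L F -> `|dquot F n t| <= L.
Proof.
move=> L0 hF; rewrite /dquot normrM ger0_norm//.
rewrite -ler_pdivlMl//; apply: (le_trans (hF _ _)).
by rewrite addrAC subrr add0r ger0_norm// mulrC.
Qed.

(** [|w|] is Lipschitz too and has a minimum at each zero of [w]; wherever it is differentiable at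
    such a zero its derivative is 0, and the quotients of [w] have the same absolute values. Applied
    to a difference, this compares the derivatives of [u] along two characteristics at their common
    points. *)
Lemma lipschitz_zero_ae L w : 0 <= L -> lipschitz_on_line L w ->
  {ae lebesgue_measure, forall t : R, w t = 0 -> dquot w ^~ t @ \oo --> (0 : R)}.
Proof.
move=> L0 hw.
have hw' : lipschitz_on_line L (fun t => `|w t|).
  by move=> s t; apply: le_trans (hw s t); exact: ler_dist_dist.
have := lipschitz_ae_derivable L0 hw'.
apply: (@filterS _ _ (ae_filter_ringOfSetsType lebesgue_measure)) => t dt wt.
pose W t := `|w t|; have Wt : W t = 0 by rewrite /W wt normr0.
have nz (n : nat) : n.+1%:R != 0 :> R by rewrite pnatr_eq0.
have c1 := dquot_cvg dt.
have c2 : (fun n : nat => (- n.+1%:R^-1)^-1 * (W (t + - n.+1%:R^-1) - W t)) @ \oo --> 'D_1 W t.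
  apply: (@dquot_seq_cvg W t (fun n : nat => - n.+1%:R^-1)) => //.
  by rewrite -oppr0; apply: cvgN; exact: cvg_harmonic.
have d0 : 'D_1 W t = 0.
  apply/eqP; rewrite eq_le; apply/andP; split.
  - rewrite -(cvg_lim (@Rhausdorff R) c2); apply: limr_le; first exact: cvgP c2.
    near=> n; rewrite Wt subr0 invrN mulNr oppr_le0; apply: mulr_ge0; last exact: normr_ge0.
    by rewrite !invr_ge0.
  - rewrite -(cvg_lim (@Rhausdorff R) c1); apply: limr_ge; first exact: cvgP c1.
    near=> n; rewrite /dquot wt normr0 subr0; apply: mulr_ge0 => //; exact: normr_ge0.
apply/norm_cvg0P; rewrite -d0; apply: cvg_trans c1; apply: near_eq_cvg; near=> n.
by rewrite /dquot /= wt normr0 !subr0 normrM ger0_norm.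
Unshelve. all: by end_near.
Qed.

Lemma lipschitz_continuous L F : 0 <= L -> lipschitz_on_line L F -> continuous F.
Proof.
move=> L0 hF x; apply/cvgrPdist_le => e e0.
have L1 : 0 < L + 1 by rewrite ltr_wpDl.
apply/nbhs_ballP; exists (e / (L + 1)) => /=; first by rewrite divr_gt0.
move=> y; rewrite /ball/= => xy; apply: (le_trans (hF _ _)).
apply: (@le_trans _ _ ((L + 1) * (e / (L + 1)))).
  by apply: ler_pM => //; [rewrite lerDl|exact: ltW].
by rewrite mulrC divfK// gt_eqF.
Qed.

End rademacher.

Section lipschitz_ibp.
Context {R : realType}.

(* [n A(t + 1/n) - n A(t)], with [A] a primitive of [F], is a C1 function whose
   derivative is the difference quotient of [F] and which tends to [F]. *)
Lemma lipschitz_ibp L F (dF phi : R -> R) : 0 <= L -> lipschitz_on_line L F ->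
  measurable_fun setT dF -> (forall t, `|dF t| <= L) ->
  {ae lebesgue_measure, forall t : R, dquot F ^~ t @ \oo --> dF t} ->
  test_function (phi : R^o -> R) ->
  (\int[lebesgue_measure]_t (F t * derive1 phi t + dF t * phi t)%:E = 0)%E.
Proof.
move=> L0 hF mdF bdF cdF tphi.
have cF := lipschitz_continuous L0 hF.
have [B0 B00 hB0] := test_function_support tphi.
have [cphi [cdphi dphi]] := @test_function_derive R R^o phi 1 tphi.
pose B := B0 + 1.
have supp t : B < `|t| -> phi t = 0 /\ 'D_1 (phi : R^o -> R) t = 0.
  move=> Bp; have nz : \forall t \near (t : R^o), phi t = 0.
    by apply: hB0; apply: lt_trans Bp; rewrite ltrDl.
  by split; [exact: (nbhs_singleton nz)|exact: near0_derive].
(* A cutoff equal to 1 on [|t| <= B + 2], so that [F1] has compact support and a primitive; the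
   margin beyond [B] leaves room for the shift by [1 / (n+1)] in the quotients. *)
pose k t := step (t + (B + 3)) * step ((B + 3) - t).
pose F1 t := F t * k t.
have cstep : continuous (@step R) by exact: (Ck_continuous (@Ck_step R 0)).
have ck : continuous k.
  have cid : continuous (fun t : R => t) by move=> ?; exact: cvg_id.
  have cc (c : R) : continuous (fun t : R => c) by move=> ?; exact: cvg_cst.
  by apply: continuousMf; apply: continuous_compf => //; [exact: continuousDf|exact: continuousBf].
have cF1 : continuous F1 by exact: continuousMf.
have F10 t : B + 3 < `|t| -> F1 t = 0.
  rewrite ltr_normr /F1 /k => /orP[h|h].
    by rewrite (@step_le0 _ (B + 3 - t)) ?mulr0//; lra.
  by rewrite (@step_le0 _ (t + (B + 3))) ?mul0r ?mulr0//; lra.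
have F1E t : `|t| <= B + 2 -> F1 t = F t.
  by rewrite ler_norml /F1 /k => /andP[h1 h2]; rewrite !step_ge1 ?mulr1//; lra.
have [A dA] := primitive_compact cF1 F10.
have [M M0 hM] := continuous_supp_bounded (@compact_ball1 R (B + 3)) cF1 F10.
have [K K0 hK] : exists2 K, 0 <= K & forall t, `|phi t| <= K.
  by apply: (continuous_supp_bounded (@compact_ball1 R B)) => // t /supp[].
have [K' K'0 hK'] : exists2 K, 0 <= K & forall t, `|'D_1 (phi : R^o -> R) t| <= K.
  by apply: (continuous_supp_bounded (@compact_ball1 R B)) => // t /supp[].
pose G n t := dquot A n t * 'D_1 (phi : R^o -> R) t + dquot F1 n t * phi t.
have dqA n t : is_derive t (1 : R) (dquot A n) (dquot F1 n t).
  have h1 : is_derive t (1 : R) (fun t => A (t + n.+1%:R^-1)) (F1 (t + n.+1%:R^-1)).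
    have h : is_derive t (1 : R) (fun t => t + n.+1%:R^-1) 1.
      by apply: (is_derive_eq (is_deriveDf (is_derive_id t 1) (is_derive_cstf t 1 n.+1%:R^-1))); rewrite addr0.
    have := @is_derive1_comp _ A _ t _ _ (dA _) h; rewrite mulr1; exact.
  apply: (is_derive_eq (is_deriveMf (is_derive_cstf t 1 n.+1%:R) (is_deriveBf h1 (dA t)))).
  by rewrite mulr0 addr0.
have cA : continuous A by exact: (is_derive_continuous dA).
have cdq (H : R -> R) n : continuous H -> continuous (dquot H n).
  move=> cH; apply: continuousMf; first by move=> ?; exact: cvg_cst.
  apply: continuousBf => //; apply: (@continuous_compf _ _ (fun t : R => t + n.+1%:R^-1)) => //.
  by apply: continuousDf => [?|?]; [exact: cvg_id|exact: cvg_cst].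
have cG n : continuous (G n).
  by apply: continuousDf; apply: continuousMf => //; exact: cdq.
have G0 n : (\int[lebesgue_measure]_t (G n t)%:E = 0)%E.
  apply: (@FTC_supp _ (fun t => dquot A n t * phi t) (G n) B); last 1 first.
  - by move=> t /supp[p0 d0]; rewrite /G p0 d0 !mulr0 addr0.
  - move=> t; have dp : is_derive t (1 : R) phi ('D_1 (phi : R^o -> R) t).
      by split; [exact: dphi|].
    by apply: (is_derive_eq (is_deriveMf (dqA n t) dp)); rewrite /G; ring.
  - exact: cG.
have bA n t : `|dquot A n t| <= M.
  rewrite /dquot normrM ger0_norm// -ler_pdivlMl//.
  have tt : t < t + n.+1%:R^-1 by rewrite ltrDl.
  have [c _ ->] := @MVT R A F1 t (t + n.+1%:R^-1) tt (fun x _ => dA x) (continuous_subspaceT cA).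
  by rewrite (addrC t) addrK normrM (@ger0_norm _ n.+1%:R^-1)// mulrC ler_wpM2l.
have bF n t : `|t| <= B -> dquot F1 n t = dquot F n t.
  move=> tB; rewrite /dquot !F1E//; first by lra.
  have n1 : n.+1%:R^-1 <= 1 :> R by rewrite invf_le1// ler1n.
  apply: (le_trans (ler_normD _ _)); apply: lerD => //.
  by rewrite ger0_norm// (le_trans n1)// ler1n.
pose Gl t := F t * derive1 phi t + dF t * phi t.
have mGl : measurable_fun setT Gl.
  apply: measurable_funD; apply: measurable_funM => //.
  - exact: continuous_measurable_fun.
  - have -> : derive1 phi = 'D_1 (phi : R^o -> R) by apply/funext => t; rewrite derive1E.
    exact: continuous_measurable_fun.
  - exact: continuous_measurable_fun.
pose dom t := (M * K' + L * K) * \1_(`[- B, B]%classic) t.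
have domE t : `|t| <= B -> dom t = M * K' + L * K.
  by move=> tB; rewrite /dom indicE mem_set ?mulr1//= in_itv/= -ler_norml.
have bG n t : `|G n t| <= dom t.
  have [tB|/supp[p0 d0]] := leP `|t| B; last first.
    by rewrite /G p0 d0 !mulr0 addr0 normr0 mulr_ge0// addr_ge0// mulr_ge0.
  rewrite domE//; apply: (le_trans (ler_normD _ _)).
  apply: lerD; rewrite normrM; apply: ler_pM => //.
  by rewrite bF//; exact: dquot_bound.
have cvGl : {ae lebesgue_measure, forall t : measurableTypeR R, setT t -> (fun n => (G n t)%:E) @ \oo --> (Gl t)%:E}.
  move: cdF; apply: (@filterS _ _ (ae_filter_ringOfSetsType lebesgue_measure)) => t ct _.
  apply: cvg_EFin; first by near=> n.
  have [tB|/supp[p0 d0]] := leP `|t| B; last first.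
    rewrite /Gl derive1E d0 p0 !mulr0 addr0; apply: cvg_near_cst; near=> n.
    by rewrite /= /G p0 d0 !mulr0 addr0.
  rewrite /Gl derive1E; apply: cvgD; apply: cvgM; try exact: cvg_cst.
    rewrite -F1E; last by lra.
    have [+ <-] := dA t; exact: dquot_cvg.
  apply: cvg_trans ct; apply: near_eq_cvg; near=> n; by rewrite bF.
have idom : lebesgue_measure.-integrable setT (EFin \o dom).
  apply: (@integrable1_bounded _ dom B (M * K' + L * K)).
  - by apply: measurable_funM => //; exact: measurable_indic.
  - move=> t; have C0 : 0 <= M * K' + L * K by rewrite addr_ge0// mulr_ge0.
    by rewrite /dom normrM ger0_norm// indicE; case: (_ \in _); rewrite ?normr1 ?normr0 ?mulr1 ?mulr0.
  - move=> t Bt; rewrite /dom indicE memNset ?mulr0//= in_itv/= -ler_norml => h.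
    by have := lt_le_trans Bt h; rewrite ltxx.
have m1 n : measurable_fun (setT : set (measurableTypeR R)) (fun t => (G n t)%:E).
  by apply/measurable_EFinP; exact: continuous_measurable_fun.
have m2 : measurable_fun (setT : set (measurableTypeR R)) (fun t => (Gl t)%:E) by exact/measurable_EFinP.
have hb : {ae lebesgue_measure, forall t : measurableTypeR R, forall n, setT t ->
    (`|(G n t)%:E| <= (EFin \o dom) t)%E}.
  by apply: aeW => t n _; rewrite /= lee_fin.
have [_ _ cI] := dominated_convergence measurableT m1 m2 cvGl idom hb.
have <- := cvg_lim (@ereal_hausdorff R) cI.
rewrite (_ : (fun n => _) = fun=> 0%E) ?lim_cst//.
by apply/funext => n; exact: G0.
Unshelve. all: by end_near.
Qed.

End lipschitz_ibp.

(** * Smooth ramps and weak differential inequalities *)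

Section smooth_ramp.
Context {R : realType}.

Lemma Ck_affine k (a b : R) : Ck k (fun s : R^o => (s - a) * b).
Proof.
apply: CkM; last exact: Ck_cst.
by apply: CkD; [exact: Ck_id|exact: Ck_cst].
Qed.

(* a smooth version, vanishing outside [[0, l + d]], of the indicator of [[0, l]] *)
Definition bump (l d s : R) : R := step (s / d) - step ((s - l) / d).

Definition dbump (l d s : R) : R := (dstep (s / d) - dstep ((s - l) / d)) / d.

Lemma is_derive_step_affine (a b s : R) :
  is_derive s (1 : R) (fun s => step ((s - a) * b)) (dstep ((s - a) * b) * b).
Proof.
have d1 : is_derive s (1 : R) (fun s => (s - a) * b) b.
  apply: (is_derive_eq (is_deriveMf (is_deriveBf (is_derive_id s 1) (is_derive_cstf s 1 a)) (is_derive_cstf s 1 b))).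
  by rewrite subr0 mulr0 add0r mulr1.
exact: (@is_derive1_comp _ step (fun s => (s - a) * b) s _ _ (is_derive_step _) d1).
Qed.

Lemma is_derive_bump l d s : is_derive s (1 : R) (bump l d) (dbump l d s).
Proof.
have h1 := is_derive_step_affine 0 d^-1 s; have h2 := is_derive_step_affine l d^-1 s.
have {}h1 : is_derive s (1 : R) (fun s => step (s / d)) (dstep (s / d) / d).
  by move: h1; under eq_fun do rewrite subr0; rewrite subr0.
apply: (is_derive_eq (is_deriveBf h1 h2)).
by rewrite /dbump; ring.
Qed.

Lemma Ck_bump l d k : Ck k (bump l d : R^o -> R).
Proof.
apply: CkD.
  apply: (@Ck_comp _ _ k step (fun s : R^o => s / d)); first exact: Ck_step.
  by apply: CkM; [exact: Ck_id|exact: Ck_cst].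
by apply: CkN; apply: (@Ck_comp _ _ k step (fun s : R^o => (s - l) / d)); [exact: Ck_step|exact: Ck_affine].
Qed.

Lemma Ck_dbump l d k : Ck k (dbump l d : R^o -> R).
Proof.
rewrite (_ : dbump l d = 'D_1 (bump l d : R^o -> R)).
  by have [_ /(_ 1)[]] := @Ck_bump l d k.+1.
by apply/funext => s; have [_ ->] := is_derive_bump l d s.
Qed.

Lemma bump_ge0 l d s : 0 < d -> 0 <= l -> 0 <= bump l d s.
Proof.
move=> d0 l0; rewrite subr_ge0; apply: step_nondecreasing.
by rewrite ler_pM2r ?invr_gt0// gerBl.
Qed.

Lemma bump_le1 l d s : bump l d s <= 1.
Proof. by have := step_le1 (s / d); have := step_ge0 ((s - l) / d); rewrite /bump; lra. Qed.

Lemma bump_supp l d s : 0 < d -> 0 <= l -> ~~ (0 <= s <= l + d) ->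
  bump l d s = 0 /\ dbump l d s = 0.
Proof.
move=> d0 l0; rewrite negb_and -!ltNge => /orP[s0|sl].
  have h1 : s / d <= 0 by rewrite pmulr_lle0 ?invr_gt0// ltW.
  have h2 : (s - l) / d <= 0 by rewrite pmulr_lle0 ?invr_gt0//; lra.
  by rewrite /bump /dbump !step_le0// !dstep_le0// !subr0 mul0r.
have h1 : 1 <= s / d by rewrite ler_pdivlMr// mul1r; lra.
have h2 : 1 <= (s - l) / d by rewrite ler_pdivlMr// mul1r; lra.
by rewrite /bump /dbump !step_ge1// !dstep_ge1// !subrr mul0r.
Qed.

Lemma bump_eq1 l d s : 0 < d -> d <= s <= l -> bump l d s = 1.
Proof.
move=> d0 /andP[ds sl]; rewrite /bump step_ge1 ?ler_pdivlMr ?mul1r//.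
by rewrite step_le0 ?subr0// pmulr_lle0 ?invr_gt0// subr_le0.
Qed.

End smooth_ramp.

Section weak_derivative.
Context {R : realType}.

(** The weak equation [m' = n] with [n <= M] is tested against a ramp that rises just after [s0] and
    falls just after [s1]. The room for the fall is [d0]. *)
Lemma weak_derivative_bound (m n : R -> R) (M C s0 s1 d0 : R) :
  s0 < s1 -> 0 < d0 -> 0 <= M -> continuous m -> measurable_fun setT n ->
  (forall s, s0 <= s <= s1 + d0 -> `|n s| <= C /\ n s <= M) ->
  (forall alpha dalpha : R -> R, (forall k, Ck k (alpha : R^o -> R)) ->
     (forall s : R, is_derive s (1 : R) alpha (dalpha s)) ->
     (forall s, ~~ (s0 <= s <= s1 + d0) -> alpha s = 0 /\ dalpha s = 0) ->
     (\int[lebesgue_measure]_s (dalpha s * m s + alpha s * n s)%:E = 0)%E) ->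
  m s1 - m s0 <= M * (s1 - s0).
Proof.
move=> s01 d00 M0 cm mn hn hw.
apply/ler_addgt0Pr => e' e'0.
(* The error is [e] at each end, plus [M * d <= e * M] for the extra length [d] of the ramp. *)
pose e := e' / (M + 2).
have M2 : 0 < M + 2 by rewrite ltr_wpDl.
have e0 : 0 < e by rewrite divr_gt0.
have ee : e' = e * M + e + e by rewrite /e; field; rewrite gt_eqF.
have cmp c : exists2 d, 0 < d & forall s, `|c - s| < d -> `|m c - m s| <= e.
  have /cvgrPdist_le/(_ _ e0)/nbhs_ballP[d /= dd hd] := cm c.
  by exists d => // s cs; exact: hd.
have [dA dA0 hA] := cmp s0; have [dB dB0 hB] := cmp s1.
pose d := Num.min (Num.min (dA / 2) (dB / 2)) (Num.min (Num.min d0 e) (s1 - s0)).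
have d_gt0 : 0 < d by rewrite !lt_min (divr_gt0 dA0)// (divr_gt0 dB0)// d00 e0 subr_gt0 s01.
have ddA : d < dA by apply: (@le_lt_trans _ _ (dA / 2)); [rewrite !ge_min lexx|lra].
have ddB : d < dB by apply: (@le_lt_trans _ _ (dB / 2)); [rewrite !ge_min lexx orbT|lra].
have dd0 : d <= d0 by rewrite !ge_min lexx !orbT.
have de : d <= e by rewrite !ge_min lexx !orbT.
have ds : d <= s1 - s0 by rewrite !ge_min lexx !orbT.
pose al s := bump (s1 - s0) d (s - s0).
pose dal s := dbump (s1 - s0) d (s - s0).
have l0 : 0 <= s1 - s0 by lra.
have Cal k : Ck k (al : R^o -> R).
  apply: (@Ck_comp _ _ k (bump (s1 - s0) d) (fun s : R^o => s - s0)); first exact: Ck_bump.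
  by apply: CkD; [exact: Ck_id|exact: Ck_cst].
have Dal s : is_derive s (1 : R) al (dal s).
  have d1 : is_derive s (1 : R) (fun s => s - s0) 1.
    by apply: (is_derive_eq (is_deriveBf (is_derive_id s 1) (is_derive_cstf s 1 s0))); rewrite subr0.
  have := @is_derive1_comp _ (bump (s1 - s0) d) (fun s => s - s0) s _ _ (is_derive_bump _ _ _) d1.
  by rewrite mulr1; exact.
have supp s : ~~ (s0 <= s <= s1 + d) -> al s = 0 /\ dal s = 0.
  move=> hs; apply: bump_supp => //; apply: contra hs => /andP[? ?]; apply/andP; split; lra.
have h0 := hw al dal Cal Dal.
have {}h0 : (\int[lebesgue_measure]_s (dal s * m s + al s * n s)%:E = 0)%E.
  apply: h0 => s hs; apply: supp; apply: contra hs => /andP[? ?]; apply/andP; split => //; lra.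
pose D : set (measurableTypeR R) := `[s0, s1 + d]%classic.
have mD : measurable D by exact: measurable_itv.
rewrite (@integral_cond _ _ _ lebesgue_measure D (fun s => dal s * m s + al s * n s)) in h0 => //; last first.
  move=> s nD; have [-> ->] : al s = 0 /\ dal s = 0.
    by apply: supp; apply/negP => hs; apply: nD; rewrite /D/= in_itv.
  by rewrite !mul0r addr0.
(* A majorant of the integrand with an explicit primitive: [m] is replaced by [m s0 + e] where the
   ramp rises and by [m s1 - e] where it falls, and the term in [n] by [M]. *)
pose J s := dstep ((s - s0) * d^-1) * d^-1 * (m s0 + e) - dstep ((s - s1) * d^-1) * d^-1 * (m s1 - e) + M.
pose PJ s := step ((s - s0) * d^-1) * (m s0 + e) - step ((s - s1) * d^-1) * (m s1 - e) + M * s.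
have dPJ s : is_derive s (1 : R) PJ (J s).
  have h1 := is_deriveMf (is_derive_step_affine s0 d^-1 s) (is_derive_cstf s 1 (m s0 + e)).
  have h2 := is_deriveMf (is_derive_step_affine s1 d^-1 s) (is_derive_cstf s 1 (m s1 - e)).
  have h3 := is_deriveMf (is_derive_cstf s 1 M) (is_derive_id s 1).
  apply: (is_derive_eq (is_deriveDf (is_deriveBf h1 h2) h3)).
  by rewrite /J; ring.
have cdst (c : R) : continuous (fun s : R => dstep ((s - c) * d^-1)).
  apply: (@continuous_compf _ _ (fun s : R => (s - c) * d^-1)).
    exact: (Ck_continuous (@Ck_affine R 0 c d^-1)).
  exact: (Ck_continuous (@Ck_dstep R 0)).
have cc (c : R) : continuous (fun _ : R => c) by move=> ?; exact: cvg_cst.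
have cJ : continuous J.
  apply: continuousDf => //; apply: continuousBf; by do 2!apply: continuousMf => //.
have Dfin : (lebesgue_measure D < +oo)%E.
  have : (lebesgue_measure (`[s0, (s1 + d)%R]%classic : set R) < +oo)%E.
    by rewrite lebesgue_measure_itv/=; case: ifP => _; rewrite ?ltry.
  exact.
have iJ : lebesgue_measure.-integrable D (EFin \o J).
  apply: continuous_compact_integrable; first exact: segment_compact.
  exact: continuous_subspaceT.
have cal : continuous al by exact: (Ck_continuous (Cal 0)).
have cdal : continuous dal.
  apply: (@continuous_compf _ _ (fun s : R => s - s0)).
    by apply: continuousBf => // ?; exact: cvg_id.
  exact: (Ck_continuous (@Ck_dbump R _ _ 0)).
have al01 s : 0 <= al s <= 1 by rewrite bump_ge0// bump_le1.
have iI : lebesgue_measure.-integrable D (EFin \o (fun s => dal s * m s + al s * n s)).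
  have i1 : lebesgue_measure.-integrable D (EFin \o (fun s => dal s * m s)).
    apply: continuous_compact_integrable; first exact: segment_compact.
    by apply: continuous_subspaceT; exact: continuousMf.
  have i2 : lebesgue_measure.-integrable D (EFin \o (fun s => al s * n s)).
    apply: measurable_bounded_integrable => //.
      apply: (@measurable_funS _ _ _ _ setT) => //.
      by apply: measurable_funM => //; exact: continuous_measurable_fun.
    exists C; split; first exact: num_real.
    move=> x Cx s Ds /=; apply: le_trans (ltW Cx).
    have [nC _] : `|n s| <= C /\ n s <= M.
      by apply: hn; move: Ds; rewrite /D/= in_itv/= => /andP[-> ?]; lra.
    have /andP[a0 a1] := al01 s.
    rewrite normrM (ger0_norm a0) -[leRHS]mul1r; exact: ler_pM.
  have := integrableD mD i1 i2.
  by rewrite (_ : (_ \+ _)%E = EFin \o (fun s => dal s * m s + al s * n s)).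
have IJ s : s \in D -> ((dal s * m s + al s * n s)%:E <= (J s)%:E)%E.
  rewrite inE /D/= in_itv/= lee_fin => /andP[hs1 hs2].
  have [_ nM] : `|n s| <= C /\ n s <= M by apply: hn; rewrite hs1/=; lra.
  have /andP[a0 a1] := al01 s.
  have aM : al s * n s <= M.
    apply: (@le_trans _ _ (al s * M)); first exact: ler_wpM2l.
    by rewrite -[leRHS]mul1r ler_wpM2r.
  have dE : dal s = dstep ((s - s0) * d^-1) * d^-1 - dstep ((s - s1) * d^-1) * d^-1.
    have es : s - s0 - (s1 - s0) = s - s1 by rewrite opprB addrA subrK.
    by rewrite /dal /dbump mulrBl es.
  have st (c a b : R) : (0 <= s - c <= d -> a <= b) -> dstep ((s - c) * d^-1) * d^-1 * a <= dstep ((s - c) * d^-1) * d^-1 * b.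
    move=> hab; have [h|] := boolP (0 <= s - c <= d).
      by apply: ler_wpM2l; [rewrite mulr_ge0 ?dstep_ge0 ?invr_ge0 ?ltW|exact: hab].
    rewrite negb_and -!ltNge => /orP[h|h].
      by rewrite dstep_le0 ?mul0r// pmulr_lle0 ?invr_gt0// ltW.
    by rewrite dstep_ge1 ?mul0r// ler_pdivlMr// mul1r ltW.
  have h1 := st s0 (m s) (m s0 + e); have h2 := st s1 (m s1 - e) (m s).
  rewrite /J dE.
  have {}h1 : dstep ((s - s0) * d^-1) * d^-1 * m s <= dstep ((s - s0) * d^-1) * d^-1 * (m s0 + e).
    apply: h1 => /andP[? ?]; have := hA s; rewrite distrC ger0_norm; last by lra.
    by move=> /(_ _)/wrap[]; [lra|rewrite ler_norml => /andP[? ?]; lra].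
  have {}h2 : dstep ((s - s1) * d^-1) * d^-1 * (m s1 - e) <= dstep ((s - s1) * d^-1) * d^-1 * m s.
    apply: h2 => /andP[? ?]; have := hB s; rewrite distrC ger0_norm; last by lra.
    by move=> /(_ _)/wrap[]; [lra|rewrite ler_norml => /andP[? ?]; lra].
  lra.
have := le_integral mD iI iJ IJ.
rewrite h0 (FTC_cc _ dPJ cJ); last by lra.
rewrite lee_fin /PJ.
have e1 : step ((s1 + d - s0) * d^-1) = 1 by rewrite step_ge1// ler_pdivlMr// mul1r; lra.
have e2 : step ((s1 + d - s1) * d^-1) = 1 by rewrite step_ge1// ler_pdivlMr// mul1r; lra.
have e3 : step ((s0 - s0) * d^-1) = 0 by rewrite step_le0// subrr mul0r.
have e4 : step ((s0 - s1) * d^-1) = 0 by rewrite step_le0// pmulr_lle0 ?invr_gt0//; lra.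
rewrite e1 e2 e3 e4.
have Md : M * d <= e * M by rewrite mulrC ler_wpM2r.
rewrite ee; lra.
Qed.

End weak_derivative.

Section segment_integrals.
Context {R : realType}.

Definition segm (X : R) : set (measurableTypeR R) := `[- X, X]%classic.

Lemma measurable_segm X : measurable (segm X).
Proof. exact: measurable_itv. Qed.

Lemma segm_fin X : (lebesgue_measure (segm X) < +oo)%E.
Proof.
have : (lebesgue_measure (`[(- X)%R, X]%classic : set R) < +oo)%E.
  by rewrite lebesgue_measure_itv/=; case: ifP => _; rewrite ?ltry.
exact.
Qed.

Lemma integrable_segm_cont X (f : R -> R) : continuous f ->
  lebesgue_measure.-integrable (segm X) (EFin \o f).
Proof.
move=> cf; apply: continuous_compact_integrable; first exact: segment_compact.
exact: continuous_subspaceT.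
Qed.

Lemma integrable_segm_bounded X C (f : R -> R) : measurable_fun setT f ->
  (forall x, `|x| <= X -> `|f x| <= C) ->
  lebesgue_measure.-integrable (segm X) (EFin \o f).
Proof.
move=> mf fC; apply: measurable_bounded_integrable.
- exact: measurable_segm.
- exact: segm_fin.
- exact: (@measurable_funS _ _ _ _ setT).
- exists C; split; first exact: num_real.
  by move=> M CM x; rewrite /segm/= in_itv/= -ler_norml => /fC h; apply: le_trans h (ltW CM).
Qed.

Lemma Rintegral_segm_cst X (c : R) : 0 <= X ->
  \int[lebesgue_measure]_(x in segm X) c = c * (X + X).
Proof.
move=> X0; rewrite Rintegral_cst; last exact: measurable_segm.
congr (_ * _).
have : fine (lebesgue_measure (`[- X, X]%classic : set R)) = X + X.
  rewrite lebesgue_measure_itv/=; case: ifP => h; rewrite /= ?opprK//.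
  move: h; rewrite lte_fin => /negbT; rewrite -leNgt => h; lra.
exact.
Qed.

Lemma Rintegral_segm_bound X C (f : R -> R) : 0 <= X -> measurable_fun setT f ->
  (forall x, `|x| <= X -> `|f x| <= C) ->
  `|\int[lebesgue_measure]_(x in segm X) f x| <= C * (X + X).
Proof.
move=> X0 mf fC; have mS := measurable_segm X.
have i1 := integrable_segm_bounded mf fC.
apply: (le_trans (le_normr_Rintegral mS i1)).
rewrite -(Rintegral_segm_cst C X0); apply: le_Rintegral => //.
- apply: (@integrable_segm_bounded X C (fun x => `|f x|)); first exact: measurableT_comp.
  by move=> x xX; rewrite normr_id; exact: fC.
- by apply: (@integrable_segm_bounded X `|C|) => //; exact: measurable_cst.
- by move=> x; rewrite /segm/= in_itv/= -ler_norml; exact: fC.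
Qed.

Lemma continuous_Rintegral_segm X (h : R * R -> R) : 0 <= X -> continuous h ->
  continuous (fun s => \int[lebesgue_measure]_(x in segm X) h (s, x)).
Proof.
move=> X0 ch s; apply/cvgrPdist_le => e e0.
have X1 : 0 < X + X + 1 by lra.
have e'0 : 0 < e / (X + X + 1) by rewrite divr_gt0.
have [d d0 hd] := compact_unif_cont (@compact_ball2 R (`|s| + X)) ch e'0.
apply/nbhs_ballP; exists d => //= s'; rewrite /ball/= => ss'.
have cs (r : R) : continuous (fun x => h (r, x)).
  by move=> x; apply: (@continuous_comp _ _ _ (fun x => (r, x)) h); [exact: continuous_pairr|exact: ch].
rewrite -RintegralB; [|exact: measurable_segm|exact: integrable_segm_cont|exact: integrable_segm_cont].
have := @Rintegral_segm_bound X (e / (X + X + 1)) (fun x => h (s, x) - h (s', x)) X0.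
move=> /(_ _ _)/wrap[||h1].
- by apply: continuous_measurable_fun; exact: continuousBf.
- move=> x xX; apply: hd => /=.
    by rewrite prod_normE/= ge_max; apply/andP; split; [rewrite lerDl|rewrite (le_trans xX)// lerDr].
  by rewrite prod_normE/= subrr normr0 gt_max ss' d0.
apply: (le_trans h1); rewrite mulrAC ler_pdivrMr// ler_wpM2l ?ltW//.
by rewrite ltrDl.
Qed.

Lemma Rintegral_itv_segm X (a b : R) : - X <= a -> a <= b -> b <= X ->
  \int[lebesgue_measure]_(x in segm X) \1_(`[a, b]%classic) x = b - a.
Proof.
move=> Xa ab bX.
have mab : measurable (`[a, b]%classic : set (measurableTypeR R)) by exact: measurable_itv.
rewrite /Rintegral integral_indic//; last exact: measurable_segm.
rewrite (_ : _ `&` _ = `[a, b]%classic); last first.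
  apply/seteqP; split=> x /=; first by case.
  by rewrite /segm/= !in_itv/= => /andP[ax xb]; rewrite ax xb (le_trans Xa ax) (le_trans xb bX).
have : fine (lebesgue_measure (`[a, b]%classic : set R)) = b - a.
  rewrite lebesgue_measure_itv/=; case: ifP => h; rewrite /= ?opprK//.
  move: h; rewrite lte_fin => /negbT; rewrite -leNgt => h; lra.
exact.
Qed.

Lemma continuous_bump_line (sg p l d : R) : continuous (fun x => bump l d (sg * (x - p))).
Proof.
apply: (@continuous_compf _ _ (fun x : R => sg * (x - p))).
  have cc (c : R) : continuous (fun _ : R => c) by move=> ?; exact: cvg_cst.
  by apply: continuousMf => //; apply: continuousBf => // ?; exact: cvg_id.
exact: (Ck_continuous (@Ck_bump R l d 0)).
Qed.

Lemma bump_integral (sg p l d X : R) : sg = 1 \/ sg = - 1 -> 0 < d -> d <= l ->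
  `|p| + (l + d) <= X ->
  l - d <= \int[lebesgue_measure]_(x in segm X) bump l d (sg * (x - p)) <= l + d.
Proof.
move=> hsg d0 dl pX.
have p1 := ler_norm p; have p2 := ler_norm (- p); rewrite normrN in p2.
have ib : lebesgue_measure.-integrable (segm X) (EFin \o (fun x => bump l d (sg * (x - p)))).
  by apply: integrable_segm_cont; exact: continuous_bump_line.
have ii (a b : R) : lebesgue_measure.-integrable (segm X) (EFin \o (\1_(`[a, b]%classic) : R -> R)).
  apply: (@integrable_segm_bounded X 1); first by exact: measurable_indic.
  by move=> x _; rewrite indicE; case: (_ \in _); rewrite ?normr1 ?normr0.
have up (a b : R) : - X <= a -> a <= b -> b <= X ->
    (forall x, 0 <= sg * (x - p) <= l + d -> a <= x <= b) ->
    \int[lebesgue_measure]_(x in segm X) bump l d (sg * (x - p)) <= b - a.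
  move=> Xa ab bX h; rewrite -(@Rintegral_itv_segm X a b)//.
  apply: le_Rintegral => //; first exact: measurable_segm.
  move=> x _; rewrite indicE.
  have [hx|hx] := boolP (0 <= sg * (x - p) <= l + d).
    by rewrite mem_set ?bump_le1//= in_itv; exact: h.
  by have [-> _] := bump_supp d0 (le_trans (ltW d0) dl) hx; exact: ler0n.
have lo (a b : R) : - X <= a -> a <= b -> b <= X ->
    (forall x, a <= x <= b -> d <= sg * (x - p) <= l) ->
    b - a <= \int[lebesgue_measure]_(x in segm X) bump l d (sg * (x - p)).
  move=> Xa ab bX h; rewrite -(@Rintegral_itv_segm X a b)//.
  apply: le_Rintegral => //; first exact: measurable_segm.
  move=> x _; rewrite indicE; have [hx|hx] := boolP (a <= x <= b).
    by rewrite (bump_eq1 d0 (h _ hx)); case: (_ \in _); rewrite ?ler01.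
  by rewrite memNset ?bump_ge0 ?(le_trans (ltW d0) dl)//= in_itv/=; exact/negP.
case: hsg => sgE; apply/andP; split.
- have -> : l - d = (p + l) - (p + d) by ring.
  by apply: lo; rewrite ?sgE; [lra|lra|lra|move=> x; rewrite mul1r; lra].
- have -> : l + d = (p + (l + d)) - p by ring.
  by apply: up; rewrite ?sgE; [lra|lra|lra|move=> x; rewrite mul1r; lra].
- have -> : l - d = (p - d) - (p - l) by ring.
  by apply: lo; rewrite ?sgE; [lra|lra|lra|move=> x; rewrite mulN1r; lra].
- have -> : l + d = p - (p - (l + d)) by ring.
  by apply: up; rewrite ?sgE; [lra|lra|lra|move=> x; rewrite mulN1r; lra].
Qed.

End segment_integrals.

(** * The balance law on a thin strip along a line *)

Section line_estimate.
Context {R : realType}.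
Variables (u g : R * R -> R) (G : R).
Hypotheses (cu : continuous u) (mg : measurable_fun setT (g : plane R -> R))
  (gG : forall p, `|g p| <= G) (bl : balance_law u g).
Variables (sg a c l d s0 s1 d0 X e : R).
Hypotheses (hsg : sg = 1 \/ sg = - 1) (d_gt0 : 0 < d) (dl : d <= l) (s01 : s0 < s1) (d00 : 0 < d0)
  (hX : forall s, s0 <= s <= s1 + d0 -> `|a + c * s| + (l + d) <= X)
  (he : forall s x, s0 <= s <= s1 + d0 -> 0 <= sg * (x - (a + c * s)) <= d ->
     `|u (s, x) - c / 2| <= e).

Let sg2 : sg * sg = 1. Proof. by case: hsg => ->; rewrite ?mulr1// mulrN1 opprK. Qed.
Let G0 : 0 <= G. Proof. exact: le_trans (normr_ge0 _) (gG (0, 0)). Qed.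
Let l0 : 0 <= l. Proof. exact: le_trans (ltW d_gt0) dl. Qed.
Let X0 : 0 <= X.
Proof.
have h : s0 <= s0 <= s1 + d0 by rewrite lexx/= (le_trans (ltW s01))// lerDl ltW.
by apply: le_trans (hX h); rewrite addr_ge0// addr_ge0// ltW.
Qed.

Let zeta (q : R * R) : R := sg * (q.2 - (a + c * q.1)).
Let h1 (q : R * R) : R := sg * bump l d (zeta q) * u q.
Let h2 (q : R * R) : R := (u q ^+ 2 - c * u q) * dbump l d (zeta q) + sg * (g q * bump l d (zeta q)).
Let T := `|s0| + `|s1 + d0|.
(** A truncation of [h2] to a box, made bounded and integrable on the whole plane. At the times
    where the test function lives it agrees with [h2], which vanishes for [|x| > X]. *)
Let H2 (q : R * R) : R := if (`|q.1| <= T) && (`|q.2| <= X) then h2 q else 0.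

Let H2_out (q : R * R) : X < `|q.2| -> H2 q = 0.
Proof. by move=> h; rewrite /H2 [`|q.2| <= X]leNgt h andbF. Qed.

Let sT s : s0 <= s <= s1 + d0 -> `|s| <= T.
Proof.
move=> /andP[h3 h4]; rewrite /T ler_norml.
have n1 := ler_norm (- s0); have n2 := ler_norm (s1 + d0); rewrite normrN in n1.
have n3 := normr_ge0 s0; have n4 := normr_ge0 (s1 + d0).
by apply/andP; split; lra.
Qed.

Let cc (k : R) : continuous (fun _ : R * R => k).
Proof. by move=> ?; exact: cvg_cst. Qed.

Let czeta : continuous zeta.
Proof.
apply: continuousMf => //; apply: continuousBf; first by move=> ?; exact: cvg_snd.
by apply: continuousDf => //; apply: continuousMf => // ?; exact: cvg_fst.
Qed.

Let cbz : continuous (fun q => bump l d (zeta q)).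
Proof. exact: (continuous_compf czeta (Ck_continuous (@Ck_bump R l d 0))). Qed.

Let cdbz : continuous (fun q => dbump l d (zeta q)).
Proof. exact: (continuous_compf czeta (Ck_continuous (@Ck_dbump R l d 0))). Qed.

Let ch1 : continuous h1.
Proof. by apply: continuousMf => //; apply: continuousMf. Qed.

Let cu2 : continuous (fun q => u q ^+ 2).
Proof. by under eq_fun do rewrite expr2; exact: continuousMf. Qed.

Let mh2 : measurable_fun setT (h2 : plane R -> R).
Proof.
apply: measurable_funD.
  apply: continuous_borel2; apply: continuousMf => //.
  by apply: continuousBf => //; exact: continuousMf.
apply: measurable_funM; first exact: measurable_cst.
by apply: measurable_funM => //; exact: continuous_borel2.
Qed.

Let mH2 : measurable_fun setT (H2 : plane R -> R).
Proof.
apply: measurable_fun_ifT => //.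
apply: (measurable_fun_bool true); rewrite setTI.
rewrite (_ : _ @^-1` _ = (`[- T, T]%classic `*` `[- X, X]%classic)).
  by apply: measurableX; exact: measurable_itv.
by apply/seteqP; split=> q /=; rewrite !in_itv/= -!ler_norml => /andP.
Qed.

Let bounded_h2 : exists2 C, 0 <= C & forall q : R * R, `|H2 q| <= C.
Proof.
have cf : continuous (fun q => (u q ^+ 2 - c * u q) * dbump l d (zeta q)).
  by apply: continuousMf => //; apply: continuousBf => //; exact: continuousMf.
have cI : compact ((fun q => (u q ^+ 2 - c * u q) * dbump l d (zeta q)) @` [set q : R * R | `|q| <= T + X]).
  by apply: continuous_compact; [exact: continuous_subspaceT|exact: compact_ball2].
have /compact_bounded[C [_ hC]] := cI.
exists (`|C| + 1 + G) => [|q]; first by rewrite !addr_ge0.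
rewrite /H2; case: ifP => [/andP[q1 q2]|_]; last by rewrite normr0 !addr_ge0.
apply: (le_trans (ler_normD _ _)); apply: lerD.
  apply: (hC (`|C| + 1)); first by rewrite ltr_pwDr// ler_norm.
  exists q => //=; rewrite prod_normE ge_max.
  have T0 : 0 <= T by rewrite addr_ge0.
  by apply/andP; split; [apply: le_trans q1 _; rewrite lerDl|apply: le_trans q2 _; rewrite lerDr].
have b0 := bump_ge0 (zeta q) d_gt0 l0; have b1 := bump_le1 l d (zeta q).
have sg1 : `|sg| = 1 by case: hsg => ->; rewrite ?normrN normr1.
rewrite !normrM sg1 mul1r (ger0_norm b0) -[leRHS]mulr1; exact: ler_pM.
Qed.

Let m s := \int[lebesgue_measure]_(x in segm X) h1 (s, x).
Let n s := \int[lebesgue_measure]_x H2 (s, x).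

Let iH2 : leb2.-integrable setT (fun q => (H2 q)%:E).
Proof.
have [C _ hC] := bounded_h2.
apply: (@integrable2_bounded _ _ (Num.max T X) C); [exact: mH2|exact: hC|] => q.
by rewrite !gt_max /H2 => -[/andP[+ _]|/andP[_ +]]; case: ifP => // /andP[? ?]; rewrite ltNge; [move/negP|move/negP].
Qed.

Let mn : measurable_fun setT n.
Proof.
have := @measurable_fubini_F _ _ _ _ _ (@lebesgue_measure R) (@lebesgue_measure R) _ iH2.
by move=> h; exact: (measurableT_comp (@fine_measurable R setT measurableT) h).
Qed.

Let n_segm s : s0 <= s <= s1 + d0 -> n s = \int[lebesgue_measure]_(x in segm X) h2 (s, x).
Proof.
move=> /sT hs; rewrite /n /Rintegral; congr fine.
apply: integral_cond => x.
  by rewrite /segm/= in_itv/= -ler_norml /H2/= => ->; rewrite hs.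
by rewrite /segm/= in_itv/= -ler_norml /H2/= => /negP/negbTE ->; rewrite andbF.
Qed.

Let out s x : s0 <= s <= s1 + d0 -> X < `|x| ->
  bump l d (zeta (s, x)) = 0 /\ dbump l d (zeta (s, x)) = 0.
Proof.
move=> /hX hs Xx; apply: bump_supp => //; apply/negP; rewrite /zeta/= => /andP[z1 z2].
move: Xx; rewrite ltNge => /negP; apply.
have n1 := ler_norm (a + c * s); have n2 := ler_norm (- (a + c * s)); rewrite normrN in n2.
by rewrite ler_norml; case: hsg z1 z2 => ->; rewrite ?mul1r ?mulN1r => *; apply/andP; split; lra.
Qed.

(* The equation tested against [al s * bump l d (sg * (x - (a + c * s)))]. The
   flux across the line is [u ^+ 2 - c * u = (u - c / 2) ^+ 2 - c ^+ 2 / 4]: the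
   square is at most [e ^+ 2] near the line and has the good sign on the other
   edge of the strip, and the constant integrates to [0]. *)
Lemma line_estimate :
  \int[lebesgue_measure]_(x in segm X)
      (sg * bump l d (sg * (x - (a + c * s1))) * u (s1, x)) -
  \int[lebesgue_measure]_(x in segm X)
      (sg * bump l d (sg * (x - (a + c * s0))) * u (s0, x))
  <= (e ^+ 2 + G * (l + d)) * (s1 - s0).
Proof.
change (m s1 - m s0 <= (e ^+ 2 + G * (l + d)) * (s1 - s0)).
have [C C0 hC] := bounded_h2.
have M0 : 0 <= e ^+ 2 + G * (l + d) by rewrite addr_ge0 ?sqr_ge0// mulr_ge0// addr_ge0// ltW.
have sliceh2 s : measurable_fun setT (fun x => h2 (s, x)).
  exact: (measurable_fun_pair2 _ mh2).
apply: (@weak_derivative_bound R m n _ (C * (X + X)) s0 s1 d0) => //.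
- exact: (continuous_Rintegral_segm X0 ch1).
- move=> s hs; rewrite n_segm//; have Ts := sT hs.
  have bh x : `|x| <= X -> `|h2 (s, x)| <= C.
    by move=> xX; have := hC (s, x); rewrite /H2/= Ts xX.
  split; first exact: (Rintegral_segm_bound X0 (sliceh2 s) bh).
  pose sig x := dstep ((sg * (x - (a + c * s))) / d) / d.
  have csig : continuous sig.
    apply: continuousMf; last by move=> ?; exact: cvg_cst.
    apply: (@continuous_compf _ _ (fun x : R => sg * (x - (a + c * s)) / d)); last exact: (Ck_continuous (@Ck_dstep R 0)).
    have c1 (k : R) : continuous (fun _ : R => k) by move=> ?; exact: cvg_cst.
    by apply: continuousMf => //; apply: continuousMf => //; apply: continuousBf => // ?; exact: cvg_id.
  have cdb : continuous (fun x => dbump l d (sg * (x - (a + c * s)))).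
    by move=> x; apply: (@continuous_comp _ _ _ (fun x => (s, x)) (fun q => dbump l d (zeta q))); [exact: continuous_pairr|exact: cdbz].
  have c1 (k : R) : continuous (fun _ : R => k) by move=> ?; exact: cvg_cst.
  pose J x := e ^+ 2 * sig x - c ^+ 2 / 4 * dbump l d (sg * (x - (a + c * s))).
  have cJ : continuous J by apply: continuousBf; apply: continuousMf.
  pose B x := G * bump l d (sg * (x - (a + c * s))).
  have cB : continuous B by apply: continuousMf => //; exact: continuous_bump_line.
  apply: (@le_trans _ _ (\int[lebesgue_measure]_(x in segm X) (J x + B x))).
    apply: le_Rintegral; [exact: measurable_segm|exact: integrable_segm_bounded bh|..].
      by apply: integrable_segm_cont; exact: continuousDf.
    move=> x _; rewrite /h2 /J /B /zeta/=; set z := sg * _.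
    have b0 := bump_ge0 z d_gt0 l0.
    have hg : sg * (g (s, x) * bump l d z) <= G * bump l d z.
      rewrite mulrA ler_wpM2r//; have := gG (s, x); rewrite ler_norml => /andP[? ?].
      by case: hsg => ->; rewrite ?mul1r ?mulN1r; lra.
    have dE : dbump l d z = sig x - dstep ((z - l) / d) / d by rewrite /dbump mulrBl.
    have q0 : 0 <= dstep ((z - l) / d) / d by rewrite mulr_ge0 ?dstep_ge0 ?invr_ge0 ?ltW.
    have s00 : 0 <= sig x by rewrite /sig mulr_ge0 ?dstep_ge0 ?invr_ge0 ?ltW.
    have hq : (u (s, x) - c / 2) ^+ 2 * sig x <= e ^+ 2 * sig x.
      have [hz|hz] := boolP (0 <= z <= d).
        apply: ler_wpM2r => //; rewrite -[leLHS]ger0_norm ?sqr_ge0// normrX.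
        have h := he hs hz; have h0 := normr_ge0 (u (s, x) - c / 2).
        by rewrite !expr2; exact: ler_pM.
      suff -> : sig x = 0 by rewrite !mulr0.
      move: hz; rewrite negb_and -!ltNge /sig => /orP[h|h].
        by rewrite dstep_le0 ?mul0r// pmulr_lle0 ?invr_gt0// ltW.
      by rewrite dstep_ge1 ?mul0r// ler_pdivlMr// mul1r ltW.
    have hq2 : 0 <= (u (s, x) - c / 2) ^+ 2 * (dstep ((z - l) / d) / d) by rewrite mulr_ge0// sqr_ge0.
    have -> : u (s, x) ^+ 2 - c * u (s, x) = (u (s, x) - c / 2) ^+ 2 - c ^+ 2 / 4 by field.
    apply: lerD => //; rewrite dE; move: hq hq2; set A := (_ - _) ^+ 2; set q := dstep _ / d; set sx := sig x.
    by move=> *; rewrite mulrBl mulrBr; lra.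
  rewrite RintegralD; [|exact: measurable_segm|exact: integrable_segm_cont|exact: integrable_segm_cont].
  have hXs := hX hs.
  have n1 := ler_norm (a + c * s); have n2 := ler_norm (- (a + c * s)); rewrite normrN in n2.
  apply: lerD; last first.
    rewrite RintegralZl; [|exact: measurable_segm|].
      by apply: ler_wpM2l => //; have /andP[] := bump_integral hsg d_gt0 dl hXs.
    by apply: integrable_segm_cont; exact: continuous_bump_line.
  pose PJ x := sg * (e ^+ 2 * step ((sg * (x - (a + c * s))) / d) - c ^+ 2 / 4 * bump l d (sg * (x - (a + c * s)))).
  have dPJ x : is_derive x (1 : R) PJ (J x).
    have dz : is_derive x (1 : R) (fun x => sg * (x - (a + c * s))) sg.
      apply: (is_derive_eq (is_deriveMf (is_derive_cstf x 1 sg) (is_deriveBf (is_derive_id x 1) (is_derive_cstf x 1 (a + c * s))))).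
      by rewrite mulr0 addr0 subr0 mulr1.
    have dz2 : is_derive x (1 : R) (fun x => sg * (x - (a + c * s)) / d) (sg / d).
      apply: (is_derive_eq (is_deriveMf dz (is_derive_cstf x 1 d^-1))).
      by rewrite mulr0 add0r mulrC.
    have k1 := @is_derive1_comp _ step (fun x => sg * (x - (a + c * s)) / d) x _ _ (is_derive_step _) dz2.
    have k2 := @is_derive1_comp _ (bump l d) (fun x => sg * (x - (a + c * s))) x _ _ (is_derive_bump _ _ _) dz.
    have k3 := is_deriveBf (is_deriveMf (is_derive_cstf x 1 (e ^+ 2)) k1) (is_deriveMf (is_derive_cstf x 1 (c ^+ 2 / 4)) k2).
    apply: (is_derive_eq (is_deriveMf (is_derive_cstf x 1 sg) k3)).
    rewrite /= !mulr0 !addr0 /J /sig.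
    transitivity ((sg * sg) * (e ^+ 2 * (dstep (sg * (x - (a + c * s)) / d) / d) - c ^+ 2 / 4 * dbump l d (sg * (x - (a + c * s))))); first by ring.
    by rewrite sg2 mul1r.
  rewrite /Rintegral (_ : (\int[_]_(x in _) _)%E = (PJ X - PJ (- X))%:E); last first.
    by apply: FTC_cc dPJ cJ; have := X0; lra.
  have pos1 r : l + d <= r -> step (r / d) = 1 /\ bump l d r = 0.
    move=> hr; rewrite /bump !step_ge1 ?subrr// ler_pdivlMr// mul1r; last by have := l0; lra.
    by lra.
  have pos0 r : r <= 0 -> step (r / d) = 0 /\ bump l d r = 0.
    have i0 : 0 < d^-1 by rewrite invr_gt0.
    move=> hr; rewrite /bump !step_le0 ?subrr// pmulr_lle0//; have := l0; lra.
  rewrite /= /PJ.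
  have [sgE|sgE] := hsg.
    have [e1 e2] : step (sg * (X - (a + c * s)) / d) = 1 /\ bump l d (sg * (X - (a + c * s))) = 0.
      by apply: pos1; rewrite sgE mul1r; lra.
    have [e3 e4] : step (sg * (- X - (a + c * s)) / d) = 0 /\ bump l d (sg * (- X - (a + c * s))) = 0.
      by apply: pos0; rewrite sgE mul1r; have := l0; have := d_gt0; lra.
    by rewrite e1 e2 e3 e4 sgE; lra.
  have [e1 e2] : step (sg * (X - (a + c * s)) / d) = 0 /\ bump l d (sg * (X - (a + c * s))) = 0.
    by apply: pos0; rewrite sgE mulN1r; have := l0; have := d_gt0; lra.
  have [e3 e4] : step (sg * (- X - (a + c * s)) / d) = 1 /\ bump l d (sg * (- X - (a + c * s))) = 0.
    by apply: pos1; rewrite sgE mulN1r; lra.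
  by rewrite e1 e2 e3 e4 sgE; lra.
- move=> al dal Cal Dal supp.
  pose phi (q : R * R) := sg * (al q.1 * bump l d (zeta q)).
  have cal : continuous al by exact: (Ck_continuous (Cal 0)).
  have dalE : dal = 'D_1 (al : R^o -> R) by apply/funext => s; have [_ ->] := Dal s.
  have cdal : continuous dal by rewrite dalE; have [_ /(_ 1)[]] := Cal 1.
  have Cphi k : Ck k phi.
    apply: CkM; first exact: Ck_cst.
    apply: CkM.
      by apply: (@Ck_comp _ _ k al (fun q : R * R => q.1)) => //; exact: Ck_fst.
    apply: (@Ck_comp _ _ k (bump l d) zeta); first exact: Ck_bump.
    apply: CkM; first exact: Ck_cst.
    apply: CkD; first exact: Ck_snd.
    apply: CkN; apply: CkD; first exact: Ck_cst.
    by apply: CkM; [exact: Ck_cst|exact: Ck_fst].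
  have inI s : al s != 0 \/ dal s != 0 -> s0 <= s <= s1 + d0.
    by move=> h; apply: contrapT => /negP/supp[z1 z2]; case: h; rewrite ?z1 ?z2 eqxx.
  have phi0 (q : R * R) : T + X < `|q| -> phi q = 0.
    rewrite prod_normE lt_max => hq; apply/eqP; apply: contraT.
    rewrite /phi mulf_eq0 mulf_eq0 !negb_or => /and3P[_ a0 b0].
    have hs := inI _ (or_introl a0); have := sT hs.
    case/orP: hq => h; first by have := X0; lra.
    have Xq : X < `|q.2| by apply: le_lt_trans h; rewrite lerDr addr_ge0.
    by have [z _] := out hs Xq; move: b0; rewrite -surjective_pairing in z *; rewrite z eqxx.
  have tphi : test_function phi by apply: test_function_intro (@compact_ball2 R (T + X)) Cphi phi0.
  have dphi v q : derivable phi q v by have [_ /(_ v)[]] := Cphi 1.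
  have D1 s x : 'D_(1, 0) phi (s, x) = sg * (dal s * bump l d (zeta (s, x))) - c * (al s * dbump l d (zeta (s, x))).
    have [_ <-] := is_derive_slice1 (dphi (1, 0) (s, x)).
    have dz : is_derive s (1 : R) (fun s => sg * (x - (a + c * s))) (- (sg * c)).
      have k0 := is_deriveMf (is_derive_cstf s 1 c) (is_derive_id s 1).
      apply: (is_derive_eq (is_deriveMf (is_derive_cstf s 1 sg) (is_deriveBf (is_derive_cstf s 1 x) (is_deriveDf (is_derive_cstf s 1 a) k0)))).
      ring.
    have k2 := @is_derive1_comp _ (bump l d) (fun s => sg * (x - (a + c * s))) s _ _ (is_derive_bump _ _ _) dz.
    have k3 := is_deriveMf (is_derive_cstf s 1 sg) (is_deriveMf (Dal s) k2).
    have [_ ->] := k3; rewrite mulr0 addr0 /= /zeta/=.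
    transitivity (sg * (dal s * bump l d (sg * (x - (a + c * s)))) - (sg * sg) * (c * (al s * dbump l d (sg * (x - (a + c * s)))))); first by ring.
    by rewrite sg2 mul1r.
  have D2 s x : 'D_(0, 1) phi (s, x) = al s * dbump l d (zeta (s, x)).
    have [_ <-] := is_derive_slice2 (dphi (0, 1) (s, x)).
    have dz : is_derive x (1 : R) (fun x => sg * (x - (a + c * s))) sg.
      apply: (is_derive_eq (is_deriveMf (is_derive_cstf x 1 sg) (is_deriveBf (is_derive_id x 1) (is_derive_cstf x 1 (a + c * s))))).
      by rewrite mulr0 addr0 subr0 mulr1.
    have k2 := @is_derive1_comp _ (bump l d) (fun x => sg * (x - (a + c * s))) x _ _ (is_derive_bump _ _ _) dz.
    have k3 := is_deriveMf (is_derive_cstf x 1 sg) (is_deriveMf (is_derive_cstf x 1 (al s)) k2).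
    have [_ ->] := k3; rewrite !mulr0 !addr0 /= /zeta/=.
    transitivity ((sg * sg) * (al s * dbump l d (sg * (x - (a + c * s))))); first by ring.
    by rewrite sg2 mul1r.
  pose f (q : R * R) := dal q.1 * h1 q + al q.1 * H2 q.
  have fE q : u q * 'D_(1, 0) phi q + flux (u q) * 'D_(0, 1) phi q + g q * phi q = f q.
    case: q => s x; rewrite D1 D2 /f /flux /phi /h1 /=.
    have [hs|/supp[-> ->]] := boolP (s0 <= s <= s1 + d0); last by ring.
    have [xX|xX] := leP `|x| X.
      by rewrite /H2/= sT//= xX /h2; ring.
    have [-> ->] := out hs xX; rewrite H2_out//; ring.
  have := bl tphi.
  under eq_integral => q _ do rewrite fE.
  move=> bl0.
  have mf : measurable_fun setT (f : plane R -> R).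
    have cf (k : R -> R) : continuous k -> continuous (fun q : R * R => k q.1).
      by move=> ck; apply: (@continuous_compf _ _ (fun q : R * R => q.1)) => // ?; exact: cvg_fst.
    apply: measurable_funD; apply: measurable_funM => //; apply: continuous_borel2 => //; exact: cf.
  have cf1 : continuous (fun q : R * R => dal q.1 * h1 q).
    by apply: continuousMf => //; apply: (@continuous_compf _ _ (fun q : R * R => q.1)) => // ?; exact: cvg_fst.
  have z1 (q : R * R) : T + X < `|q| -> dal q.1 * h1 q = 0.
    rewrite prod_normE lt_max => hq; apply/eqP; apply: contraT.
    rewrite mulf_eq0 negb_or /h1 !mulf_eq0 !negb_or => /andP[a0 /andP[/andP[_ b0] _]].
    have hs := inI _ (or_intror a0); have := sT hs.
    case/orP: hq => h; first by have := X0; lra.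
    have Xq : X < `|q.2| by apply: le_lt_trans h; rewrite lerDr addr_ge0.
    by have [z _] := out hs Xq; move: b0; rewrite -surjective_pairing in z *; rewrite z eqxx.
  have [K1 K10 hK1] := continuous_supp_bounded (@compact_ball2 R (T + X)) cf1 z1.
  have al0 t : T < `|t| -> al t = 0.
    by move=> Tt; apply/eqP; apply: contraT => a0; have := sT (inI _ (or_introl a0)); lra.
  have [K2 K20 hK2] := continuous_supp_bounded (@compact_ball1 R T) cal al0.
  have i_f : leb2.-integrable setT (fun q => (f q)%:E).
    apply: (@integrable2_bounded _ _ (T + X) (K1 + K2 * C)) => // q.
      apply: (le_trans (ler_normD _ _)); apply: lerD => //.
      by rewrite normrM; apply: ler_pM.
    move=> hq; have hq' : T + X < `|q : R * R| by rewrite prod_normE lt_max; apply/orP.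
    rewrite /f z1// add0r /H2; case: ifP => [/andP[q1 q2]|_]; last by rewrite mulr0.
    case: hq => h; [have := X0; lra|].
    have T0 : 0 <= T by rewrite addr_ge0.
    lra.
  rewrite -(integral12_prod_meas1 i_f) in bl0.
  rewrite -[RHS]bl0; apply: eq_integral => s _; rewrite /fubini_F.
  have slH : measurable_fun setT (fun x => H2 (s, x)) by exact: (measurable_fun_pair2 _ mH2).
  have iH : lebesgue_measure.-integrable setT (EFin \o (fun x => H2 (s, x))).
    apply: (@integrable1_bounded _ _ X C) => // x Xx.
    by rewrite H2_out.
  have [hs|hs] := boolP (s0 <= s <= s1 + d0); last first.
    have [a0 da0] := supp _ hs; rewrite a0 da0 !mul0r addr0 integral0_eq// => x _.
    by rewrite /f/= a0 da0 !mul0r addr0.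
  have cs : continuous (fun x => h1 (s, x)).
    by move=> x; apply: (@continuous_comp _ _ _ (fun x => (s, x)) h1); [exact: continuous_pairr|exact: ch1].
  have h1out x : X < `|x| -> h1 (s, x) = 0.
    by move=> Xx; rewrite /h1; have [-> _] := out hs Xx; rewrite mulr0 mul0r.
  have [K3 K30 hK3] := continuous_supp_bounded (@compact_ball1 R X) cs h1out.
  have ih1 : lebesgue_measure.-integrable setT (EFin \o (fun x => h1 (s, x))).
    by apply: (@integrable1_bounded _ _ X K3) => //; exact: continuous_measurable_fun.
  rewrite (_ : m s = \int[lebesgue_measure]_x h1 (s, x)); last first.
    rewrite /m /Rintegral; congr fine; apply/esym; apply: integral_cond => x //.
    by rewrite /segm/= in_itv/= -ler_norml => /negP; rewrite -ltNge => /h1out.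
  rewrite /n -RintegralZl// -RintegralZl// -RintegralD//; last 2 first.
  - rewrite (_ : EFin \o _ = (fun x => (dal s)%:E * (EFin \o (fun x => h1 (s, x))) x)%E); last by apply/funext => x; rewrite /= EFinM.
    exact: integrableZl.
  - rewrite (_ : EFin \o _ = (fun x => (al s)%:E * (EFin \o (fun x => H2 (s, x))) x)%E); last by apply/funext => x; rewrite /= EFinM.
    exact: integrableZl.
  rewrite /Rintegral fineK//; apply: integrable_fin_num => //.
  apply: (@integrable1_bounded _ _ X (`|dal s| * K3 + `|al s| * C)).
  + by apply: measurable_funD; apply: measurable_funM => //; exact: continuous_measurable_fun.
  + move=> x; apply: (le_trans (ler_normD _ _)); rewrite (normrM (dal s)) (normrM (al s)).
    exact: (lerD (ler_wpM2l (normr_ge0 (dal s)) (hK3 x)) (ler_wpM2l (normr_ge0 (al s)) (hC (s, x)))).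
  + by move=> x Xx; rewrite h1out// H2_out// !mulr0 addr0.
Qed.

End line_estimate.

(** * Lipschitz bound along characteristics *)

Section characteristics.
Context {R : realType}.

Lemma C1_on_is_derive (I : set R) (gamma dgamma : R -> R) (t : R) :
  C1_on I gamma dgamma -> nbhs t I -> is_derive t (1 : R) gamma (dgamma t).
Proof.
move=> [dg _] nI; have It : I t by exact: nbhs_singleton.
have := dg t It.
have -> : within I t^' = t^'.
  rewrite eqEsubset; split=> A /= h; last exact: filterS h => s hs _.
  by apply: filterS2 nI h => s Is hs st; exact: hs.
move=> /cvgrPdist_lt h.
have cv : (fun k : R => k^-1 *: (gamma (k *: (1 : R) + t) - gamma t)) @ 0^' --> dgamma t.
  apply/cvgrPdist_lt => e e0; have := h e e0.
  rewrite /dnbhs /within/= => /nbhs_ballP[r/= r0 hr].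
  apply/nbhs_ballP; exists r => //= k; rewrite /ball/= sub0r normrN => kr k0.
  have := hr (k + t); rewrite /ball/= opprD addrCA subrr addr0 normrN => /(_ kr).
  rewrite /= addrK => /(_ _)/wrap[].
    by apply: contra_neq k0 => kt; apply: (addIr t); rewrite add0r.
  by rewrite -[k *: 1]/(k * 1) mulr1 mulrC.
by split; [apply/cvg_ex; exists (dgamma t)|apply/cvg_lim].
Qed.

Lemma derive1_flux (z : R) : derive1 flux z = 2 * z.
Proof.
rewrite derive1E /flux (_ : (fun z : R => z ^+ 2) = (fun z => z * z)); last by apply/funext => w; rewrite expr2.
have [_ ->] := is_deriveMf (is_derive_id z (1 : R)) (is_derive_id z (1 : R)).
by ring.
Qed.

Lemma characteristic_is_derive (u : R * R -> R) (I : set R) (gamma : R -> R) (t : R) :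
  characteristic u I gamma -> nbhs t I ->
  is_derive t (1 : R) gamma (2 * u (t, gamma t)).
Proof. by move=> [_ /C1_on_is_derive h] /h; rewrite derive1_flux. Qed.

Lemma sign_band (sg z d : R) : sg = 1 \/ sg = - 1 -> 0 <= sg * z <= d -> `|z| <= d.
Proof.
by rewrite ler_norml; case=> ->; rewrite ?mul1r ?mulN1r => /andP[z1 z2]; apply/andP; split; lra.
Qed.

(** Increments over a uniform subdivision are added up. Only short steps have to be estimated, so a
    different chord can replace the curve on each of them. *)
Lemma le_telescope (E : R -> R) (s t M h0 : R) : s < t -> 0 < h0 ->
  (forall r h, 0 < h -> h <= h0 -> s <= r -> r + h <= t ->
     E (r + h) - E r <= M * h) -> E t - E s <= M * (t - s).
Proof.
move=> st h00 hE.
pose N := (Num.truncn ((t - s) / h0)).+1; pose h := (t - s) / N%:R.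
have N0 : 0 < N%:R :> R by rewrite ltr0n.
have hp : 0 < h by rewrite divr_gt0// subr_gt0.
have hh0 : h <= h0.
  by rewrite ler_pdivrMr// mulrC -ler_pdivrMr// ltW// truncnS_gt.
have hN : h * N%:R = t - s by rewrite /h mulfVK// gt_eqF.
have step k : (k <= N)%N -> E (s + h * k%:R) - E s <= M * (h * k%:R).
  elim: k => [_|k IH kN]; first by rewrite !mulr0 addr0 subrr.
  have := IH (ltnW kN).
  have := hE (s + h * k%:R) h hp hh0.
  have -> : s + h * k%:R + h = s + h * k.+1%:R by rewrite -addrA -natr1 mulrDr mulr1.
  move=> /(_ _ _)/wrap[||]; first by rewrite lerDl mulr_ge0// ltW.
    have -> : t = s + h * N%:R by rewrite hN; ring.
    by rewrite lerD2l ler_pM2l// ler_nat.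
  have -> : M * (h * k.+1%:R) = M * h + M * (h * k%:R) by rewrite -natr1; ring.
  by move=> h1 h2; rewrite -[E _ - E s](subrKA (E (s + h * k%:R))); exact: lerD.
have := step N (leqnn _); rewrite hN.
by have -> : s + (t - s) = t by ring.
Qed.

End characteristics.

Section dafermos.
Context {R : realType}.
(* [gamma] is replaced by chords on short time intervals; on a strip of width
   [l] the gain is [o(l) + G * l * (t - s)], and then [l] tends to [0]. *)
Lemma dafermos_one_sided (u g : R * R -> R) (G : R) (gamma : R -> R) (sg s t : R) :
  continuous u -> measurable_fun setT (g : plane R -> R) ->
  (forall p, `|g p| <= G) -> balance_law u g ->
  (forall t : R, is_derive t (1 : R) gamma (2 * u (t, gamma t))) ->
  sg = 1 \/ sg = - 1 -> s < t ->
  sg * (u (t, gamma t) - u (s, gamma s)) <= G * (t - s).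
Proof.
move=> cu mg gG bl dgam hsg st.
have G0 : 0 <= G by exact: le_trans (normr_ge0 _) (gG (0, 0)).
have cgam : continuous gamma by exact: is_derive_continuous dgam.
pose T := `|s| + `|t|.
have T0 : 0 <= T by rewrite addr_ge0.
have sT r : s <= r -> r <= t -> `|r| <= T.
  move=> sr rt; rewrite ler_norml /T.
  have n1 := ler_norm (- s); have n2 := ler_norm t; rewrite normrN in n1.
  by have n3 := normr_ge0 s; have n4 := normr_ge0 t; apply/andP; split; lra.
have [Gam Gam0 hGam] : exists2 B : R, 0 <= B & forall r, s <= r -> r <= t -> `|gamma r| <= B.
  have cI : compact (gamma @` `[s, t]%classic).
    by apply: continuous_compact; [exact: continuous_subspaceT|exact: segment_compact].
  have /compact_bounded[C [_ hC]] := cI.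
  exists (`|C| + 1) => [|r sr rt]; first by rewrite addr_ge0.
  by apply: (hC (`|C| + 1)); [rewrite ltr_pwDr// ler_norm|exists r => //=; rewrite in_itv/= sr].
pose X := Gam + 3; pose W := T + X + 1.
have X0 : 0 <= X by rewrite addr_ge0.
have [U U0 hU] : exists2 B : R, 0 <= B & forall q : R * R, `|q| <= W -> `|u q| <= B.
  have cI : compact (u @` [set q : R * R | `|q| <= W]).
    by apply: continuous_compact; [exact: continuous_subspaceT|exact: compact_ball2].
  have /compact_bounded[C [_ hC]] := cI.
  exists (`|C| + 1) => [|q qW]; first by rewrite addr_ge0.
  by apply: (hC (`|C| + 1)); [rewrite ltr_pwDr// ler_norm|exists q].
have inW (r x : R) : `|r| <= T + 1 -> `|x| <= X -> `|((r, x) : R * R)| <= W.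
  by move=> h1 h2; rewrite prod_normE ge_max/= /W; apply/andP; split; lra.
have hgam r : s <= r -> r <= t -> `|gamma r| <= X.
  by move=> sr rt; have := hGam r sr rt; rewrite /X; lra.
suff key e' : 0 < e' -> e' <= 1 ->
    sg * (u (t, gamma t) - u (s, gamma s)) <= G * (t - s) + e' * (t - s + G * (t - s) + 4 + 2 * U).
  have A0 : 0 < t - s + G * (t - s) + 4 + 2 * U.
    have : 0 <= G * (t - s) by rewrite mulr_ge0// subr_ge0 ltW.
    by move: st U0; lra.
  apply/ler_addgt0Pr => e e0.
  have e1 : 0 < Num.min 1 (e / (t - s + G * (t - s) + 4 + 2 * U)) by rewrite lt_min ltr01 divr_gt0.
  apply: (le_trans (key _ e1 _)); first by rewrite ge_min lexx.
  by rewrite lerD2l -ler_pdivlMr// ge_min lexx orbT.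
move=> e'0 e'1.
(* Two scales are needed. On the strip of width [l], [u] differs from its value on the curve by at
   most [e']; near the edge, within [r1], by at most [l * e']. The second must be much finer because
   the flux error [e ^+ 2] is divided by [l] in the end. *)
have [r0 r00 hr0] := compact_unif_cont (@compact_ball2 R W) cu e'0.
pose l := Num.min 1 (r0 / 3).
have l0 : 0 < l by rewrite lt_min ltr01 divr_gt0.
have l1 : l <= 1 by rewrite ge_min lexx.
have lr : 3 * l <= r0 by rewrite mulrC -ler_pdivlMr// ge_min lexx orbT.
have le0 : 0 < l * e' by rewrite mulr_gt0.
pose e := l * e'.
have e2 : e ^+ 2 <= l * e'.
  rewrite expr2 -[leRHS]mulr1; apply: ler_wpM2l; first exact: ltW.
  by rewrite /e; apply: mulr_ile1 => //; apply: ltW.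
have [r1 r10 hr1] := compact_unif_cont (@compact_ball2 R W) cu le0.
pose d := Num.min (l * e') (r1 / 2).
have d0 : 0 < d by rewrite lt_min le0 divr_gt0.
have de : d <= l * e' by rewrite ge_min lexx.
have dl : d <= l by apply: (le_trans de); rewrite ger_pMr.
have dr : 2 * d <= r1 by rewrite mulrC -ler_pdivlMr// ge_min lexx orbT.
pose E r := \int[lebesgue_measure]_(x in segm X) (sg * bump l d (sg * (x - gamma r)) * u (r, x)).
pose B r := \int[lebesgue_measure]_(x in segm X) bump l d (sg * (x - gamma r)).
have BX r : s <= r -> r <= t -> `|gamma r| + (l + d) <= X.
  by move=> sr rt; have := hGam r sr rt; rewrite /X; lra.
have cbu r : continuous (fun x => sg * bump l d (sg * (x - gamma r)) * u (r, x)).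
  have cc (c : R) : continuous (fun _ : R => c) by move=> ?; exact: cvg_cst.
  apply: continuousMf.
    by apply: continuousMf => //; exact: continuous_bump_line.
  by move=> x; apply: (@continuous_comp _ _ _ (fun x => (r, x)) u); [exact: continuous_pairr|exact: cu].
have EB r : s <= r -> r <= t -> `|E r - sg * u (r, gamma r) * B r| <= e' * B r.
  move=> sr rt; rewrite /E /B.
  have ib := integrable_segm_cont X (@continuous_bump_line R sg (gamma r) l d).
  rewrite -!RintegralZl//; try exact: measurable_segm.
  rewrite -RintegralB; [|exact: measurable_segm|exact: integrable_segm_cont|]; last first.
    apply: integrable_segm_cont; apply: continuousMf; last exact: continuous_bump_line.
    by move=> ?; exact: cvg_cst.
  have cd : continuous (fun x => sg * bump l d (sg * (x - gamma r)) * u (r, x) - sg * u (r, gamma r) * bump l d (sg * (x - gamma r))).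
    apply: continuousBf => //; apply: continuousMf; last exact: continuous_bump_line.
    by move=> ?; exact: cvg_cst.
  apply: (le_trans (le_normr_Rintegral (measurable_segm X) (integrable_segm_cont X cd))).
  apply: le_Rintegral; first exact: measurable_segm.
  - apply: integrable_segm_cont.
    exact: (continuous_compf cd (fun z : R => @norm_continuous R R^o z)).
  - apply: integrable_segm_cont; apply: continuousMf; last exact: continuous_bump_line.
    by move=> ?; exact: cvg_cst.
  move=> x _.
  have -> : sg * bump l d (sg * (x - gamma r)) * u (r, x) - sg * u (r, gamma r) * bump l d (sg * (x - gamma r))
     = sg * (u (r, x) - u (r, gamma r)) * bump l d (sg * (x - gamma r)) by ring.
  have sg1 : `|sg| = 1 by case: hsg => ->; rewrite ?normrN normr1.
  have b0 := bump_ge0 (sg * (x - gamma r)) d0 (ltW l0).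
  rewrite !normrM sg1 mul1r (ger0_norm b0).
  have [hz|hz] := boolP (0 <= sg * (x - gamma r) <= l + d); last first.
    by have [-> _] := bump_supp d0 (ltW l0) hz; rewrite !mulr0.
  apply: ler_wpM2r => //; rewrite distrC; apply: hr0.
    by apply: inW; [have := sT r sr rt; lra|exact: hgam].
  rewrite prod_normE/= subrr normr0 gt_max r00/= distrC.
  apply: le_lt_trans (sign_band hsg hz) _.
  by clear -dl l0 lr; lra.
have main : E t - E s <= (e ^+ 2 + G * (l + d)) * (t - s).
  (* Within a time [2 * h] neither the curve nor its chord moves by more than about [U * h] (speeds
     are at most [2 * U]). The terms in [r1] keep the edge of the strip within [r1] of the point
     [(xi, gamma xi)], and the first term keeps the strip inside [X]. *)
  pose h0 := Num.min (1 / (8 * (U + 1))) (Num.min (1 / 4) (Num.min (r1 / 4) (r1 / (16 * (U + 1))))).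
  have U1 : 0 < U + 1 by rewrite ltr_wpDl.
  have h00 : 0 < h0.
    by rewrite !lt_min; repeat (apply/andP; split); rewrite ?divr_gt0// ?mulr_gt0.
  apply: (le_telescope st h00) => r h hp hh0 sr rht.
  have h1 : 8 * U * h <= 1.
    have : h <= 1 / (8 * (U + 1)) by apply: (le_trans hh0); rewrite ge_min lexx.
    by rewrite ler_pdivlMr ?mulr_gt0//; move: hp; nra.
  have h2 : h <= 1 / 4 by apply: (le_trans hh0); rewrite !ge_min lexx orbT.
  have h3 : h <= r1 / 4 by apply: (le_trans hh0); rewrite !ge_min lexx !orbT.
  have h4 : 16 * U * h <= r1.
    have : h <= r1 / (16 * (U + 1)) by apply: (le_trans hh0); rewrite !ge_min lexx !orbT.
    by rewrite ler_pdivlMr ?mulr_gt0//; move: hp; nra.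
  have rr : r < r + h by rewrite ltrDl.
  have rt : r <= t by apply: le_trans rht; exact: ltW.
  have Ub q : s <= q -> q <= t -> `|u (q, gamma q)| <= U.
    by move=> sq qt; apply: hU; apply: inW; [rewrite (le_trans (sT q sq qt))// lerDl|exact: hgam].
  have [xi xiI xiE] := MVT rr (fun x _ => dgam x) (continuous_subspaceT cgam).
  move: xiI; rewrite in_itv/= => /andP[rxi xirh].
  have sxi : s <= xi by rewrite (le_trans sr)// ltW.
  have xit : xi <= t by rewrite (le_trans _ rht)// ltW.
  (* By the mean value theorem this is the slope of the chord: the line meets the curve at both ends
     of the step, and [c / 2] is a value of [u] on the curve, as the estimate on the line
     requires. *)
  pose c := 2 * u (xi, gamma xi).
  have cU : `|c| <= 2 * U.
    by rewrite /c normrM ger0_norm// ler_pM2l//; exact: Ub.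
  have cUh v : 0 <= v -> `|c * v| <= 2 * U * v.
    by move=> v0; rewrite normrM (ger0_norm v0) ler_wpM2r.
  pose a := gamma r - c * r.
  have lineE q : a + c * q = gamma r + c * (q - r) by rewrite /a; ring.
  have e1 : gamma (r + h) = a + c * (r + h).
    by rewrite lineE -[LHS](subrK (gamma r)) xiE -/c addrC.
  have e0 : gamma r = a + c * r by rewrite lineE subrr mulr0 addr0.
  have := @line_estimate R u g G cu mg gG bl sg a c l d r (r + h) h X e hsg d0 dl rr hp.
  rewrite /E e1 e0 [r + h - r]addrAC subrr add0r; apply.
  - move=> q /andP[rq qh]; rewrite lineE.
    have q0 : 0 <= q - r by rewrite subr_ge0.
    have hc := cUh _ q0.
    have hcq : 2 * U * (q - r) <= 2 * U * (2 * h) by apply: ler_wpM2l; [rewrite mulr_ge0|clear -qh; lra].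
    have := ler_normD (gamma r) (c * (q - r)); have := hGam r sr rt; rewrite /X.
    by clear -hc hcq h1 dl l1; lra.
  - move=> q x /andP[rq qh]; rewrite lineE => hz.
    have -> : c / 2 = u (xi, gamma xi) by rewrite /c; field.
    rewrite distrC; apply: hr1.
      by apply: inW; [rewrite (le_trans (sT xi sxi xit))// lerDl|exact: hgam].
    rewrite prod_normE/= gt_max; apply/andP; split.
      by clear -rxi xirh rq qh h3 r10; rewrite ltr_norml; apply/andP; split; lra.
    have q0 : 0 <= q - r by rewrite subr_ge0.
    have hc := cUh _ q0.
    have hcq : 2 * U * (q - r) <= 2 * U * (2 * h) by apply: ler_wpM2l; [rewrite mulr_ge0|clear -qh; lra].
    have [y yI yE] := MVT rxi (fun x _ => dgam x) (continuous_subspaceT cgam).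
    move: yI; rewrite in_itv/= => /andP[ry yxi].
    have Uy : `|u (y, gamma y)| <= U by apply: Ub; clear -sr ry yxi xit; lra.
    have hy : `|gamma xi - gamma r| <= 2 * U * h.
      have xr : 0 <= xi - r by rewrite subr_ge0 ltW.
      rewrite yE normrM (ger0_norm xr); apply: ler_pM => //.
        by rewrite normrM ger0_norm// ler_pM2l.
      by rewrite lerBlDl ltW.
    have hx : `|x - (gamma r + c * (q - r))| <= d.
      exact: sign_band hsg hz.
    rewrite (_ : gamma xi - x = (gamma xi - gamma r) + (- (c * (q - r)) - (x - (gamma r + c * (q - r))))); last by ring.
    apply: (le_lt_trans (ler_normD _ _)).
    have := ler_normB (- (c * (q - r))) (x - (gamma r + c * (q - r))); rewrite normrN.
    move: hy hx hc hcq h4 r10 dr; clear; set n1 := `| _ |; set n2 := `| _ |; set n3 := `| _ |; set n4 := `| _ |.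
    set y1 := 2 * U * (q - r); rewrite -!mulrA; lra.
have Bb r : s <= r -> r <= t -> l - d <= B r <= l + d.
  by move=> sr rt; apply: bump_integral (BX _ sr rt).
clearbody E B.
have /andP[Bs1 Bs2] := Bb s (lexx _) (ltW st).
have /andP[Bt1 Bt2] := Bb t (ltW st) (lexx _).
have := EB s (lexx _) (ltW st); have := EB t (ltW st) (lexx _).
rewrite !ler_norml => /andP[Et _] /andP[_ Es].
have Ub q : s <= q -> q <= t -> `|u (q, gamma q)| <= U.
  by move=> sq qt; apply: hU; apply: inW; [rewrite (le_trans (sT q sq qt))// lerDl|exact: hgam].
have sgU q : s <= q -> q <= t -> `|sg * u (q, gamma q)| <= U.
  by move=> *; rewrite normrM (_ : `|sg| = 1) ?mul1r ?Ub//; case: hsg => ->; rewrite ?normrN normr1.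
have BU q : s <= q -> q <= t -> `|sg * u (q, gamma q) * (B q - l)| <= U * (l * e').
  move=> sq qt; rewrite normrM; apply: ler_pM => //; first exact: sgU.
  have /andP[b1 b2] := Bb q sq qt.
  by rewrite ler_norml; apply/andP; split; lra.
have := BU s (lexx _) (ltW st); have := BU t (ltW st) (lexx _).
rewrite !ler_norml => /andP[Ut _] /andP[_ Us].
have eB q : B q <= l + d -> e' * B q <= e' * (2 * l).
  by move=> h; apply: ler_wpM2l; [exact: ltW|clear -h dl; lra].
have e1 := eB _ Bs2; have e3 := eB _ Bt2.
have m2 : (e ^+ 2 + G * (l + d)) * (t - s) <= (l * e' + G * (l + l * e')) * (t - s).
  apply: ler_wpM2r; first by rewrite subr_ge0 ltW.
  by apply: lerD => //; apply: ler_wpM2l => //; rewrite lerD2l.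
(* Both sides are compared after multiplication by [l], the approximate mass of the bump, since
   every error above is of the order [l * e']. *)
rewrite -(ler_pM2l l0).
have -> : l * (sg * (u (t, gamma t) - u (s, gamma s))) = sg * u (t, gamma t) * l - sg * u (s, gamma s) * l by ring.
have -> : l * (G * (t - s) + e' * (t - s + G * (t - s) + 4 + 2 * U)) =
   (l * e' + G * (l + l * e')) * (t - s) + 2 * (e' * (2 * l)) + 2 * (U * (l * e')) by ring.
move: Et Es Ut Us main m2 e1 e3; clear; rewrite !mulrBr.
by lra.
Qed.

(** A strip to the right of the curve bounds the growth of [u] along it, and a strip to the left
    bounds its decrease. *)
Lemma dafermos (u g : R * R -> R) (G : R) (gamma : R -> R) :
  continuous u -> measurable_fun setT (g : plane R -> R) ->
  (forall p, `|g p| <= G) -> balance_law u g ->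
  (forall t : R, is_derive t (1 : R) gamma (2 * u (t, gamma t))) ->
  lipschitz_on_line G (fun t => u (t, gamma t)).
Proof.
move=> cu mg gG bl dgam; have h s t : s <= t -> `|u (t, gamma t) - u (s, gamma s)| <= G * (t - s).
  rewrite le_eqVlt => /predU1P[->|st]; first by rewrite !subrr normr0 mulr0.
  have h1 := dafermos_one_sided cu mg gG bl dgam (or_introl (erefl 1)) st.
  have h2 := dafermos_one_sided cu mg gG bl dgam (or_intror (erefl (- 1))) st.
  by rewrite ler_norml; apply/andP; split; lra.
move=> s t; have [st|/ltW ts] := leP s t.
  by rewrite distrC (distrC s) (ger0_norm (_ : 0 <= t - s)) ?subr_ge0//; exact: h.
by rewrite (ger0_norm (_ : 0 <= s - t)) ?subr_ge0//; exact: h.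
Qed.

End dafermos.

(** * Construction of a Lagrangian source *)

Section first_choice.
Context {R : realType} d (T : measurableType d).
Variables (S : nat -> set T) (f : nat -> T -> R) (f0 : T -> R).

Let F (s : seq nat) (p : T) : R :=
  foldr (fun n acc => if p \in S n then f n p else acc) (f0 p) s.

Let F_cases s p :
  (exists n, n \in s /\ S n p) /\ (exists2 m, S m p & forall s', F (s ++ s') p = f m p) \/
  (forall n, n \in s -> ~ S n p) /\ F s p = f0 p.
Proof.
elim: s => [|n s IH]; first by right.
have [Sn|nSn] := pselect (S n p).
  left; split; first by exists n; rewrite mem_head.
  by exists n => // s'; rewrite /F/= mem_set.
case: IH => [[[m [ms Sm]] [k Sk hk]]|[h1 h2]].
  left; split; first by exists m; rewrite in_cons ms orbT.
  by exists k => // s'; rewrite /F/= memNset//; exact: hk.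
right; split; last by rewrite /F/= memNset.
by move=> m; rewrite in_cons => /predU1P[->//|/h1].
Qed.

(** [h] is the limit of the finite choices [F (iota 0 N)]. Each is measurable, and at each point
    they are eventually constant. *)
Lemma measurable_first_choice : (forall n, measurable (S n)) ->
  (forall n, measurable_fun setT (f n)) -> measurable_fun setT f0 ->
  exists h : T -> R, [/\ measurable_fun setT h,
    forall n p, S n p -> exists2 m, S m p & h p = f m p &
    forall p, (forall n, ~ S n p) -> h p = f0 p].
Proof.
move=> mS mf mf0.
have mF s : measurable_fun setT (F s).
  elim: s => [|n s IH]; first exact: mf0.
  apply: measurable_fun_ifT => //.
  apply: (measurable_fun_bool true); rewrite setTI.
  rewrite (_ : _ @^-1` _ = S n); first exact: mS.
  by apply/seteqP; split=> p /=; [move/set_mem|move/mem_set].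
pose h p := limn (fun N => F (iota 0 N) p).
have hS n p : S n p -> exists2 m, S m p & (fun N => F (iota 0 N) p) @ \oo --> f m p.
  move=> Sn; have [[_ [m Sm hm]]|[h1 _]] := F_cases (iota 0 n.+1) p; last first.
    by have := h1 n; rewrite mem_iota/= add0n ltnS leqnn => /(_ isT).
  exists m => //; apply: cvg_near_cst; exists n.+1 => //= N /= nN.
  by rewrite -(subnKC nN) iotaD hm.
have h0 p : (forall n, ~ S n p) -> (fun N => F (iota 0 N) p) @ \oo --> f0 p.
  move=> nS; apply: cvg_near_cst; apply: nearW => N.
  by have [[[n [_ /nS]]]|[_ ->]] := F_cases (iota 0 N) p.
exists h; split.
- apply: (@measurable_fun_cvg _ T R setT (fun N => F (iota 0 N)) h) => // p _.
  have [[n Sn]|nS] := pselect (exists n, S n p).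
    by have [m _ hm] := hS n p Sn; apply/cvg_ex; exists (f m p).
  by apply/cvg_ex; exists (f0 p); apply: h0 => n Sn; apply: nS; exists n.
- by move=> n p /hS[m Sm hm]; exists m => //; exact: cvg_lim hm.
- by move=> p /h0 hp; exact: cvg_lim hp.
Qed.

End first_choice.

Section balance_integrable.
Context {R : realType}.

(** An enumeration of the rationals, with value 0 on codes that decode to nothing. It indexes the
    countable family of characteristics below, and later the times of the squeezing steps. *)
Definition rat_seq (n : nat) : R := ratr (odflt 0 (unpickle n)).

Lemma rat_seq_dense (a b : R) : a < b -> exists n, a < rat_seq n < b.
Proof.
move=> /rat_in_itvoo[q]; rewrite in_itv/= => h; exists (pickle q).
by rewrite /rat_seq pickleK.
Qed.

Lemma balance_integrable (u g : R * R -> R) (M : R) (phi : R * R -> R) :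
  continuous u -> measurable_fun setT (g : plane R -> R) ->
  (forall p, `|g p| <= M) -> test_function phi ->
  leb2.-integrable setT (fun p => (u p * 'D_(1, 0) phi p
    + flux (u p) * 'D_(0, 1) phi p + g p * phi p)%:E).
Proof.
move=> cu mg gM tphi.
have [cphi [c1 d1]] := @test_function_derive R (R * R)%type phi (1, 0) tphi.
have [_ [c2 d2]] := @test_function_derive R (R * R)%type phi (0, 1) tphi.
have [B B0 hB] := test_function_support tphi.
have cfl : continuous (fun p => flux (u p)).
  by rewrite /flux; under eq_fun do rewrite expr2; exact: continuousMf.
pose f p := u p * 'D_(1, 0) phi p + flux (u p) * 'D_(0, 1) phi p.
have cf : continuous f by exact: (continuousDf (continuousMf cu c1) (continuousMf cfl c2)).
have f0 p : B < `|p| -> f p = 0.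
  by move=> /hB h; rewrite /f !near0_derive// !mulr0 addr0.
have phi0 p : B < `|p| -> phi p = 0 by move=> /hB /nbhs_singleton.
have [M1 M10 hM1] := continuous_supp_bounded (@compact_ball2 R B) cf f0.
have [M2 M20 hM2] := continuous_supp_bounded (@compact_ball2 R B) cphi phi0.
apply: (@integrable2_bounded _ _ B (M1 + M * M2)).
- apply: measurable_funD; first exact: continuous_borel2.
  by apply: measurable_funM => //; exact: continuous_borel2.
- move=> p; apply: (le_trans (ler_normD _ _)); apply: lerD; first exact: hM1.
  by rewrite normrM; exact: ler_pM.
- move=> p hp; have hp' : B < `|p : R * R| by rewrite prod_normE lt_max; apply/orP.
  by rewrite -/(f p) f0// phi0// mulr0 addr0.
Qed.

Lemma balance_law_unique (u g h : R * R -> R) (M N : R) (phi : R * R -> R) :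
  continuous u -> measurable_fun setT (g : plane R -> R) ->
  (forall p, `|g p| <= M) -> measurable_fun setT (h : plane R -> R) ->
  (forall p, `|h p| <= N) -> balance_law u g -> balance_law u h ->
  test_function phi -> (\int[leb2]_p ((h p - g p) * phi p)%:E = 0)%E.
Proof.
move=> cu mg gM mh hN bg bh tphi.
pose F k p := u p * 'D_(1, 0) phi p + flux (u p) * 'D_(0, 1) phi p + k p * phi p.
have i1 : leb2.-integrable setT (EFin \o F g) by exact: balance_integrable gM tphi.
have i2 : leb2.-integrable setT (EFin \o F h) by exact: balance_integrable hN tphi.
have e1 : (\int[leb2]_p (F g p)%:E = 0)%E by exact: bg.
have e2 : (\int[leb2]_p (F h p)%:E = 0)%E by exact: bh.
have e3 := integralB_EFin measurableT i2 i1.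
rewrite e1 e2 sube0 in e3; rewrite -[RHS]e3; apply: eq_integral => p _.
by rewrite -EFinB; congr EFin; rewrite /F; ring.
Qed.

End balance_integrable.

Section lagrangian_sources.
Context {R : realType}.
Variables (u g : R * R -> R) (K : set (R * R)) (chi : R * R -> R).
Hypothesis uK : counterexample u g K.
Hypothesis chiL : lagrangian_parameterization u chi.

Let w (y t : R) : R := u (t, chi (t, y)).

Lemma lagrangian_lipschitz y : lipschitz_on_line 1 (w y).
Proof.
have [cu [mg gG] bl _ _] := uK; have [cchi char _ _] := chiL.
apply: (dafermos cu mg gG bl) => t.
by apply: characteristic_is_derive (char y) _; exact: filterT.
Qed.

(** An upper limit is defined and measurable everywhere. The clamp to [[-1, 1]] makes the bound
    immediate and changes nothing where the quotients converge, because [u] is 1-Lipschitz along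
    characteristics. *)
Let D (p : plane R) : R :=
  Num.max (- 1) (Num.min 1 (limn_sup (fun n => dquot (w p.2) n p.1))).

Let D_bound p : `|D p| <= 1.
Proof.
rewrite /D ler_norml; apply/andP; split; first by rewrite le_max lexx.
by rewrite ge_max ge_min lexx/= andbT; lra.
Qed.

Let measurable_D : measurable_fun setT D.
Proof.
apply: measurable_maxr; first exact: measurable_cst.
apply: measurable_minr; first exact: measurable_cst.
have hb (p : plane R) n : `|dquot (w p.2) n p.1| <= 1.
  by apply: dquot_bound => //; exact: lagrangian_lipschitz.
apply: (@measurable_fun_limn_sup _ (plane R) R setT (fun n (p : plane R) => dquot (w p.2) n p.1)).
- by move=> p _; exists 1 => _ [n _ <-]; have := hb p n; rewrite ler_norml => /andP[].
- by move=> p _; exists (- 1) => _ [n _ <-]; have := hb p n; rewrite ler_norml => /andP[].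
- move=> n; apply: continuous_borel2.
  have [cu _ _ _ _] := uK; have [cchi _ _ _] := chiL.
  have cs : continuous (fun p : R * R => p.2) by move=> ?; exact: cvg_snd.
  have cw (c : R) : continuous (fun p : R * R => u (p.1 + c, chi (p.1 + c, p.2))).
    have c1 : continuous (fun p : R * R => p.1 + c).
      by apply: continuousDf => ?; [exact: cvg_fst|exact: cvg_cst].
    have c2 : continuous (fun p : R * R => chi (p.1 + c, p.2)).
      move=> p; apply: (@continuous_comp _ _ _ (fun p : R * R => (p.1 + c, p.2)) chi); last exact: cchi.
      by apply: continuous_pair; [exact: c1|exact: cs].
    move=> p; apply: (@continuous_comp _ _ _ (fun p : R * R => (p.1 + c, chi (p.1 + c, p.2))) u); last exact: cu.
    by apply: continuous_pair; [exact: c1|exact: c2].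
  rewrite /dquot /w; apply: continuousMf; first by move=> ?; exact: cvg_cst.
  apply: continuousBf; first exact: cw.
  by have := cw 0; under eq_fun do rewrite addr0.
Qed.

Let D_cvg y t l : dquot (w y) ^~ t @ \oo --> l -> D (t, y) = l.
Proof.
move=> hl; rewrite /D/= (cvg_limn_inf_sup hl).2.
have : `|l| <= 1.
  have hn : (fun n => `|dquot (w y) n t|) @ \oo --> `|l| by exact: cvg_norm.
  rewrite -(cvg_lim _ hn)//; apply: limr_le; first by apply/cvg_ex; exists `|l|.
  by apply: nearW => n; apply: dquot_bound => //; exact: lagrangian_lipschitz.
rewrite ler_norml => /andP[l1 l2].
by rewrite /Num.min ifN ?max_r// -leNgt.
Qed.

(* Several [y] may share the point [(t, x)]. If some rational [y] does, the
   derivative along the first one is chosen: for each fixed [y] it agrees with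
   the derivative along [y] for almost every such [t], since only countably many
   curves are involved. Otherwise [y] is unique and equal to [Y (t, x)]. *)
Lemma lagrangian_derivative : exists h : R * R -> R,
  [/\ measurable_fun setT (h : plane R -> R), forall p, `|h p| <= 1 &
   forall y, {ae lebesgue_measure, forall t : R, dquot (w y) ^~ t @ \oo --> h (t, chi (t, y))}].
Proof.
have [cchi char mono _] := chiL.
have onto := lagrangian_onto chiL.
have [Y YE] := inverse_exists cchi mono onto.
have mY := measurable_Y cchi YE.
pose S n : set (plane R) := [set p | chi (p.1, rat_seq n) = p.2].
have cslice y : continuous (fun p : R * R => chi (p.1, y)).
  move=> p; apply: (@continuous_comp _ _ _ (fun p : R * R => (p.1, y)) chi); last exact: cchi.
  have cf : continuous (fun p : R * R => p.1) by move=> ?; exact: cvg_fst.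
  have cc : continuous (fun _ : R * R => y) by move=> ?; exact: cvg_cst.
  by apply: continuous_pair; [exact: cf|exact: cc].
have mS n : measurable (S n).
  rewrite (_ : S n = (fun p : R * R => chi (p.1, rat_seq n) - p.2) @^-1` [set 0]).
    apply: closed_borel2; apply: closed_comp; last exact: closed_eq.
    by move=> p _; apply: continuousBf => // ?; exact: cvg_snd.
  by apply/seteqP; split=> p /=; rewrite /S/=; [move=> ->; rewrite subrr|move/eqP; rewrite subr_eq0 => /eqP].
have mpair (y : plane R -> R) : measurable_fun setT y -> measurable_fun setT (fun p : plane R => D (p.1, y p)).
  move=> my; apply: (measurableT_comp measurable_D).
  by apply: measurable_fun_pair => //; exact: measurable_fst.
have [h [mh hS h0]] := measurable_first_choice mS
  (fun n => mpair (fun=> rat_seq n) (@measurable_cst _ _ _ _ _ _)) (mpair _ mY).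
exists h; split => //.
  move=> p; have [[n Sn]|nS] := pselect (exists n, S n p).
    by have [m _ ->] := hS n p Sn.
  by rewrite h0// => n Sn; apply: nS; exists n.
move=> y.
have d1 := lipschitz_ae_derivable ler01 (lagrangian_lipschitz y).
have d2 := ae_foralln (fun n => lipschitz_ae_derivable ler01 (lagrangian_lipschitz (rat_seq n))).
have lw n : lipschitz_on_line 2 (fun t => w y t - w (rat_seq n) t).
  move=> s t; have := lagrangian_lipschitz y s t; have := lagrangian_lipschitz (rat_seq n) s t.
  have -> : w y s - w (rat_seq n) s - (w y t - w (rat_seq n) t) = (w y s - w y t) - (w (rat_seq n) s - w (rat_seq n) t) by ring.
  move=> e1 e2; apply: (le_trans (ler_normB _ _)).
  by move: e1 e2; rewrite !mul1r mulr_natl mulr2n => e1 e2; exact: lerD.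
(* For almost every [t] and every [n]: if the curves of [y] and [rat_seq n] meet at time [t], then
   [u] has the same derivative along both. *)
have d3 := ae_foralln (fun n => lipschitz_zero_ae (ler0n R 2) (lw n)).
move: d1 d2 d3; apply: (@filterS3 _ _ (ae_filter_ringOfSetsType lebesgue_measure)) => t dt drt d0t.
have cy := dquot_cvg dt.
set l := 'D_1 _ t in cy.
suff -> : h (t, chi (t, y)) = l by [].
have [[n Sn]|nS] := pselect (exists n, S n (t, chi (t, y))).
  have [m Sm ->] := hS n _ Sn; rewrite /S/= in Sm.
  apply: D_cvg; rewrite /=.
  have wE : w y t - w (rat_seq m) t = 0 by rewrite /w Sm subrr.
  have cm := dquot_cvg (drt m).
  have cB : (fun k => dquot (w y) k t - dquot (fun t => w y t - w (rat_seq m) t) k t) @ \oo --> l - 0.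
    exact: (cvgB cy (d0t m wE)).
  have e : dquot (w (rat_seq m)) ^~ t = (fun k => dquot (w y) k t - dquot (fun t => w y t - w (rat_seq m) t) k t).
    by apply/funext => k; rewrite /dquot; ring.
  by rewrite e -[l]subr0.
rewrite h0; last by move=> n Sn; apply: nS; exists n.
have -> /= : Y (t, chi (t, y)) = y.
  have Yy : Y (t, chi (t, y)) <= y by rewrite YE.
  (* A rational strictly between [Y (t, x)] and [y] would, by monotonicity, give a curve through the
     same point, which this case excludes. *)
  apply/eqP; rewrite eq_le Yy leNgt; apply/negP => /rat_seq_dense[n /andP[q1 q2]].
  apply: nS; exists n; rewrite /S/=; apply/eqP; rewrite eq_le; apply/andP; split.
    by apply: mono; exact: ltW.
  by rewrite -YE ltW.
exact: D_cvg.
Qed.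

Lemma lagrangian_source_not_eulerian :
  exists h, lagrangian_source u chi h /\ ~ eulerian_source u h.
Proof.
have [cu _ _ [cK K0] _] := uK; have [cchi char mono _] := chiL.
have [h [mh h1 hae]] := lagrangian_derivative.
have lipw y : lipschitz_on_line 2 (w y).
  by move=> s t; apply: (le_trans (lagrangian_lipschitz y s t)); rewrite ler_wpM2r//; lra.
have mK : measurable (K : set (plane R)) by exact: compact_borel2.
(* Changing [h] on [K] is invisible along every curve, which spends null time in [K]. The bound 2
   leaves room for [h + 1_K]. *)
have src k : measurable_fun setT (k : plane R -> R) -> (forall p, `|k p| <= 2) ->
    (forall p, ~ K p -> k p = h p) -> lagrangian_source u chi k.
  move=> mk k2 kh; split; first by split => //; exists 2.
  move=> y phi tphi; apply: (lipschitz_ibp (ler0n R 2) (lipw y)) => //.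
    have mt : measurable_fun setT (fun t : measurableTypeR R => ((t, chi (t, y)) : plane R)).
      apply: measurable_fun_pair => //.
      by apply: continuous_measurable_fun; exact: (continuous_slice chiL).
    exact: (measurableT_comp mk mt).
  have [mN N0] := lagrangian_slice_null uK chiL y.
  have aeN : {ae lebesgue_measure, forall t : R, ~ K (t, chi (t, y))}.
    by exists [set t | K (t, chi (t, y))]; split => // t /= /contrapT.
  move: (hae y) aeN; apply: (@filterS2 _ _ (ae_filter_ringOfSetsType lebesgue_measure)) => t ht nK.
  by rewrite kh.
have sh : lagrangian_source u chi h.
  by apply: src => // p; rewrite (le_trans (h1 p))// ler1n.
have [[bh blh]|] := pselect (eulerian_source u h); last by exists h.
pose k p := h p + \1_K p.
have mk : measurable_fun setT (k : plane R -> R).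
  by apply: measurable_funD => //; exact: measurable_indic.
exists k; split.
  apply: src => //.
    move=> p; apply: (le_trans (ler_normD _ _)); rewrite (_ : 2 = 1 + 1)//; apply: lerD => //.
    by rewrite indicE; case: (_ \in _); rewrite ?normr1 ?normr0.
  by move=> p nK; rewrite /k indicE memNset// addr0.
move=> [_ blk].
have [B B0 KB] : exists2 B : R, 0 <= B & forall p, K p -> `|p| <= B.
  have /compact_bounded[C [_ hC]] := cK.
  exists (`|C| + 1) => [|q qK]; first by rewrite addr_ge0.
  by apply: (hC (`|C| + 1)); rewrite ?ltr_pwDr// ler_norm.
(* A cutoff equal to 1 on [[- B, B]] and to 0 outside [[- B - 1, B + 1]]. The product test function
   is 1 on [K], so the difference of the two Eulerian sources integrates to [leb2 K]. *)
pose b (s : R) := bump (2 * B + 1) 1 (s + (B + 1)).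
have b1 s : `|s| <= B -> b s = 1.
  by rewrite ler_norml => /andP[? ?]; apply: bump_eq1 => //; apply/andP; split; lra.
have b0 s : B + 1 < `|s| -> b s = 0.
  move=> hs; have [] := @bump_supp R (2 * B + 1) 1 (s + (B + 1)) => //; first by lra.
  apply/negP => /andP[? ?]; move: hs; rewrite ltNge => /negP; apply.
  by rewrite ler_norml; apply/andP; split; lra.
have Cb n : Ck n (b : R^o -> R).
  apply: (@Ck_comp _ _ n (bump (2 * B + 1) 1) (fun s : R^o => s + (B + 1))); first exact: Ck_bump.
  by apply: CkD; [exact: Ck_id|exact: Ck_cst].
pose phi (p : R * R) := b p.1 * b p.2.
have Cphi n : Ck n phi.
  apply: CkM; apply: (@Ck_comp _ _ n b) => //; [exact: Ck_fst|exact: Ck_snd].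
have tphi : test_function phi.
  apply: test_function_intro (@compact_ball2 R (B + 1)) Cphi _ => p.
  by rewrite prod_normE lt_max /phi => /orP[|] /b0 ->; rewrite ?mul0r ?mulr0.
have phiK p : K p -> phi p = 1.
  by move=> /KB; rewrite prod_normE ge_max => /andP[? ?]; rewrite /phi !b1// mulr1.
have k2 p : `|k p| <= 2.
  apply: (le_trans (ler_normD _ _)); rewrite (_ : 2 = 1 + 1)//; apply: lerD => //.
  by rewrite indicE; case: (_ \in _); rewrite ?normr1 ?normr0.
have e := balance_law_unique cu mh h1 mk k2 blh blk tphi.
have : (\int[leb2]_p (\1_K p)%:E = 0)%E.
  rewrite -[RHS]e; apply: eq_integral => p _; congr EFin; rewrite /k addrC addKr indicE.
  by have [/set_mem/phiK ->|_] := boolP (p \in K); rewrite ?mulr1 ?mul0r.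
rewrite integral_indic// setIT => K00.
by move: K0; rewrite K00 ltxx.
Qed.

End lagrangian_sources.

(** * The counterexample *)

Section gradients.
Context {R : realType}.
Implicit Types f ft fx : R * R -> R.

(** The class [C^1] encoded by the chain rule along arbitrary differentiable curves. In this form it
    is stable under products, inverses and the substitution [p] to [(p.1, g p)], and it applies
    directly to characteristics. *)
Definition has_grad f ft fx : Prop :=
  [/\ continuous f, continuous ft, continuous fx &
    forall (a b : R -> R) (s a' b' : R), is_derive s (1 : R) a a' ->
      is_derive s (1 : R) b b' ->
      is_derive s (1 : R) (fun r => f (a r, b r))
        (ft (a s, b s) * a' + fx (a s, b s) * b')].

Lemma has_grad_eq f ft fx ft' fx' : has_grad f ft fx ->
  ft =1 ft' -> fx =1 fx' -> has_grad f ft' fx'.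
Proof. by move=> h /funext <- /funext <-. Qed.

Lemma has_grad_cst (c : R) : has_grad (fun=> c) (fun=> 0) (fun=> 0).
Proof.
split; try by move=> ?; exact: cvg_cst.
move=> a b s a' b' _ _; apply: (is_derive_eq (is_derive_cstf s 1 c)).
by rewrite !mul0r addr0.
Qed.

Lemma has_grad_fst : has_grad fst (fun=> 1) (fun=> 0).
Proof.
split; try by move=> ?; [exact: cvg_fst|exact: cvg_cst].
- by move=> ?; exact: cvg_fst.
- by move=> ?; exact: cvg_cst.
- by move=> ?; exact: cvg_cst.
by move=> a b s a' b' da _; apply: (is_derive_eq da); rewrite mul1r mul0r addr0.
Qed.

Lemma has_grad_snd : has_grad snd (fun=> 0) (fun=> 1).
Proof.
split.
- by move=> ?; exact: cvg_snd.
- by move=> ?; exact: cvg_cst.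
- by move=> ?; exact: cvg_cst.
by move=> a b s a' b' _ db; apply: (is_derive_eq db); rewrite mul1r mul0r add0r.
Qed.

Lemma has_gradD f ft fx g gt gx : has_grad f ft fx -> has_grad g gt gx ->
  has_grad (fun p => f p + g p) (fun p => ft p + gt p) (fun p => fx p + gx p).
Proof.
move=> [cf c1 c2 hf] [cg c3 c4 hg].
split; [exact: continuousDf|exact: continuousDf|exact: continuousDf|].
move=> a b s a' b' da db.
apply: (is_derive_eq (is_deriveDf (hf _ _ _ _ _ da db) (hg _ _ _ _ _ da db))).
by ring.
Qed.

Lemma has_gradM f ft fx g gt gx : has_grad f ft fx -> has_grad g gt gx ->
  has_grad (fun p => f p * g p) (fun p => ft p * g p + f p * gt p)
    (fun p => fx p * g p + f p * gx p).
Proof.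
move=> [cf c1 c2 hf] [cg c3 c4 hg].
split; first exact: (continuousMf cf cg).
- exact: (continuousDf (continuousMf c1 cg) (continuousMf cf c3)).
- exact: (continuousDf (continuousMf c2 cg) (continuousMf cf c4)).
move=> a b s a' b' da db.
apply: (is_derive_eq (is_deriveMf (hf _ _ _ _ _ da db) (hg _ _ _ _ _ da db))).
by ring.
Qed.

Lemma has_grad_comp (h h' : R -> R) f ft fx :
  (forall x : R, is_derive x (1 : R) h (h' x)) -> continuous h' ->
  has_grad f ft fx ->
  has_grad (fun p => h (f p)) (fun p => h' (f p) * ft p)
    (fun p => h' (f p) * fx p).
Proof.
move=> dh ch' [cf c1 c2 hf]; have ch := is_derive_continuous dh.
have chf := continuous_compf cf ch'.
split; [exact: (continuous_compf cf ch)|exact: continuousMf|exact: continuousMf|].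
move=> a b s a' b' da db.
have k := @is_derive1_comp _ h _ s _ _ (dh (f (a s, b s))) (hf _ _ _ _ _ da db).
by apply: (is_derive_eq k); rewrite mulrDr !mulrA.
Qed.

Lemma continuousVf (T : topologicalType) (f : T -> R) : continuous f ->
  (forall x, f x != 0) -> continuous (fun x => (f x)^-1).
Proof. by move=> cf f0 x; apply: cvgV => //; exact: cf. Qed.

Lemma has_gradV f ft fx : (forall p, f p != 0) -> has_grad f ft fx ->
  has_grad (fun p => (f p)^-1) (fun p => - ft p / f p ^+ 2)
    (fun p => - fx p / f p ^+ 2).
Proof.
move=> f0 [cf c1 c2 hf].
have cV : continuous (fun p => (f p ^+ 2)^-1).
  apply: continuousVf; last by move=> p; rewrite expf_neq0.
  by under eq_fun do rewrite expr2; exact: continuousMf.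
have cN (k : R * R -> R) : continuous k -> continuous (fun p => - k p).
  by move=> ck p; exact: (cvgN (ck p)).
split; first exact: continuousVf.
- exact: (continuousMf (cN _ c1) cV).
- exact: (continuousMf (cN _ c2) cV).
move=> a b s a' b' da db.
apply: (is_derive_eq (is_deriveVf (f0 (a s, b s)) (hf _ _ _ _ _ da db))).
by field; exact: f0.
Qed.

Lemma has_grad_sub f ft fx g gt gx : has_grad f ft fx -> has_grad g gt gx ->
  has_grad (fun p => f (p.1, g p))
    (fun p => ft (p.1, g p) + fx (p.1, g p) * gt p)
    (fun p => fx (p.1, g p) * gx p).
Proof.
move=> [cf c1 c2 hf] [cg c3 c4 hg].
have cs (k : R * R -> R) : continuous k -> continuous (fun p => k (p.1, g p)).
  move=> ck p; apply: (@continuous_comp _ _ _ (fun p : R * R => (p.1, g p)) k); last exact: ck.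
  have cfst : continuous (fun p : R * R => p.1) by move=> ?; exact: cvg_fst.
  by apply: continuous_pair; [exact: cfst|exact: cg].
split; first exact: cs.
- exact: (continuousDf (cs _ c1) (continuousMf (cs _ c2) c3)).
- exact: (continuousMf (cs _ c2) c4).
move=> a b s a' b' da db.
apply: (is_derive_eq (hf _ _ _ _ _ da (hg _ _ _ _ _ da db))).
by rewrite /=; ring.
Qed.

Lemma has_grad_slice1 f ft fx (t x : R) : has_grad f ft fx ->
  is_derive t (1 : R) (fun s => f (s, x)) (ft (t, x)).
Proof.
move=> [_ _ _ h].
apply: (is_derive_eq (h _ _ _ _ _ (is_derive_id t (1 : R)) (is_derive_cstf t 1 x))).
by rewrite mulr1 mulr0 addr0.
Qed.

Lemma has_grad_slice2 f ft fx (t x : R) : has_grad f ft fx ->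
  is_derive x (1 : R) (fun s => f (t, s)) (fx (t, x)).
Proof.
move=> [_ _ _ h].
apply: (is_derive_eq (h _ _ _ _ _ (is_derive_cstf x 1 t) (is_derive_id x (1 : R)))).
by rewrite mulr1 mulr0 add0r.
Qed.

End gradients.

(** * The squeezing profile *)

Section squeezing_profile.
Context {R : realType}.

Lemma atan_lipschitz (x y : R) : `|atan x - atan y| <= `|x - y|.
Proof.
wlog xy : x y / y <= x.
  move=> h; have [/h//|/ltW/h] := leP y x.
  by rewrite distrC (distrC y).
move: xy; rewrite le_eqVlt => /predU1P[->|yx]; first by rewrite !subrr.
have [c _ ->] := MVT yx (fun z _ => is_derive1_atan z)
  (continuous_subspaceT (@continuous_atan R)).
rewrite normrM ler_piMl// ger0_norm ?invr_ge0 ?addr_ge0 ?sqr_ge0//.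
by rewrite invf_le1 ?ltr_pwDl ?sqr_ge0// lerDl sqr_ge0.
Qed.

(* For [w = cot (phi / 2)] one has [phi + 2 atan w = pi] modulo [2 pi]. *)
Lemma half_angle (phi : R) : cos phi != 1 ->
  cos (phi + 2 * atan (sin phi / (1 - cos phi))) = - 1 /\
  sin (phi + 2 * atan (sin phi / (1 - cos phi))) = 0.
Proof.
move=> c1; set w := _ / _; set a := atan w.
have c0 : 1 - cos phi != 0 by rewrite subr_eq0 eq_sym.
have ca0 : cos a != 0.
  by rewrite cos_atan invr_eq0 sqrtr_eq0 -ltNge ltr_pwDl// sqr_ge0.
have sa : sin a = w * cos a.
  have h : sin a / cos a = w by exact: (atanK w).
  by rewrite -[LHS](mulfVK ca0) h.
have cs := cos2Dsin2 phi.
have w2 : w ^+ 2 = (1 + cos phi) / (1 - cos phi).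
  have -> : w ^+ 2 = sin phi ^+ 2 / (1 - cos phi) ^+ 2 by rewrite /w exprMn exprVn.
  have -> : sin phi ^+ 2 = (1 + cos phi) * (1 - cos phi) by rewrite sin2cos2; ring.
  by field.
have ca2 : cos a ^+ 2 = (1 - cos phi) / 2.
  have h := cos2Dsin2 a; rewrite sa exprMn w2 in h.
  have : cos a ^+ 2 * (1 + (1 + cos phi) / (1 - cos phi)) = 1 by rewrite -[RHS]h; ring.
  have -> : 1 + (1 + cos phi) / (1 - cos phi) = 2 / (1 - cos phi) by field.
  move=> e; rewrite -[LHS](@mulfK _ (2 / (1 - cos phi))); last by rewrite mulf_neq0 ?invr_eq0.
  by rewrite e mul1r invf_div.
have c2a : cos (2 * a) = - cos phi.
  rewrite mulr_natl cos_mulr2n ca2; lra.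
have s2a : sin (2 * a) = sin phi.
  rewrite mulr_natl sin_mulr2n sa.
  have -> : (cos a * (w * cos a)) *+ 2 = w * cos a ^+ 2 * 2 by rewrite -[in LHS]mulr_natr; ring.
  by rewrite ca2 /w; field.
split.
  rewrite cosD c2a s2a -cs; ring.
by rewrite sinD c2a s2a; ring.
Qed.

(** [2 * atan (sin phi / (1 - cos phi))] would send every phase to [pi] exactly. Replacing 1 by
    [b > 1] removes the singularity at phase 0, and [7/4] instead of 2 keeps the slope of
    [phi + profile b phi] above [1/8]. *)
Definition profile (b phi : R) : R := 7 / 4 * atan (sin phi / (b - cos phi)).

Definition profile1 (b phi : R) : R :=
  7 / 4 * ((b * cos phi - 1) / (b ^+ 2 + 1 - 2 * b * cos phi)).

Definition profile2 (b phi : R) : R :=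
  7 / 4 * ((- (b * sin phi) * (b ^+ 2 + 1 - 2 * b * cos phi) -
    (b * cos phi - 1) * (2 * b * sin phi)) /
    (b ^+ 2 + 1 - 2 * b * cos phi) ^+ 2).

Variable b : R.
Hypothesis b1 : 1 < b.

Let bcos phi : 0 < b - cos phi.
Proof. by rewrite subr_gt0; apply: le_lt_trans b1; exact: cos_le1. Qed.

Let den phi : (b - 1) ^+ 2 <= b ^+ 2 + 1 - 2 * b * cos phi.
Proof.
have := cos_le1 phi => c1.
rewrite -subr_ge0 (_ : _ - _ = 2 * b * (1 - cos phi)); last by ring.
by rewrite !mulr_ge0 ?subr_ge0// (le_trans ler01)// ltW.
Qed.

Let den0 phi : 0 < b ^+ 2 + 1 - 2 * b * cos phi.
Proof. by apply: lt_le_trans (den phi); rewrite exprn_gt0// subr_gt0. Qed.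

Lemma is_derive_profile (phi : R) : is_derive phi (1 : R) (profile b) (profile1 b phi).
Proof.
have b0 := lt0r_neq0 (bcos phi).
have k1 := is_deriveBf (is_derive_cstf phi 1 b) (is_derive_cos phi).
have k2 := is_deriveMf (is_derive_sin phi) (@is_deriveVf _ _ (fun y => b - cos y) _ _ _ b0 k1).
have k3 := @is_derive1_comp _ atan _ phi _ _ (is_derive1_atan _) k2.
apply: (is_derive_eq (is_deriveMf (is_derive_cstf phi 1 (7 / 4)) k3)).
rewrite /profile1 mulr0 addr0; congr (_ * _).
have d0 := lt0r_neq0 (den0 phi).
have e1 : 1 + (sin phi / (b - cos phi)) ^+ 2 = (b ^+ 2 + 1 - 2 * b * cos phi) / (b - cos phi) ^+ 2.
  rewrite exprMn exprVn sin2cos2; field; exact: b0.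
rewrite e1 invf_div.
rewrite (_ : sin phi * _ + _ = (cos phi * (b - cos phi) - sin phi ^+ 2) / (b - cos phi) ^+ 2); last by field.
rewrite sin2cos2; field; by rewrite d0.
Qed.

Lemma is_derive_profile1 (phi : R) : is_derive phi (1 : R) (profile1 b) (profile2 b phi).
Proof.
have d0 := lt0r_neq0 (den0 phi).
have kb := is_deriveMf (is_derive_cstf phi 1 b) (is_derive_cos phi).
have k1 := is_deriveBf kb (is_derive_cstf phi 1 1).
have k2 := is_deriveBf (is_derive_cstf phi 1 (b ^+ 2 + 1)) (is_deriveMf (is_derive_cstf phi 1 (2 * b)) (is_derive_cos phi)).
have k3 := is_deriveMf k1 (@is_deriveVf _ _ (fun y => b ^+ 2 + 1 - 2 * b * cos y) _ _ _ d0 k2).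
apply: (is_derive_eq (is_deriveMf (is_derive_cstf phi 1 (7 / 4)) k3)).
by rewrite /profile2; field.
Qed.

Lemma continuous_profile2 : continuous (profile2 b).
Proof.
have cc (c : R) : continuous (fun _ : R => c) by move=> ?; exact: cvg_cst.
have cs := @continuous_sin R; have co := @continuous_cos R.
have cd : continuous (fun phi => b ^+ 2 + 1 - 2 * b * cos phi).
  exact: (continuousBf (cc _) (continuousMf (cc _) co)).
have cbs : continuous (fun phi => - (b * sin phi)).
  by move=> x; apply: cvgN; exact: (continuousMf (cc b) cs).
apply: (continuousMf (cc _)); apply: continuousMf.
  apply: continuousBf; first exact: continuousMf.
  apply: continuousMf; last exact: (continuousMf (cc _) cs).
  exact: (continuousBf (continuousMf (cc _) co) (cc _)).
apply: continuousVf; last by move=> x; rewrite expf_neq0// gt_eqF.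
by under eq_fun do rewrite expr2; exact: continuousMf.
Qed.

Lemma profile1_ge phi : - (7 / 8) <= profile1 b phi.
Proof.
rewrite /profile1 -subr_ge0.
have d0 := den0 phi.
rewrite (_ : _ - _ = 7 / 8 * ((b ^+ 2 - 1) / (b ^+ 2 + 1 - 2 * b * cos phi))).
  by rewrite mulr_ge0// ?divr_ge0 ?(ltW d0)// subr_ge0 expr2; have := b1; nra.
by field; rewrite gt_eqF.
Qed.

Lemma profile_bounded : exists2 B : R, 0 <= B & forall phi,
  [/\ `|profile b phi| <= B, `|profile1 b phi| <= B & `|profile2 b phi| <= B].
Proof.
have b0 : 0 < b by exact: lt_trans b1.
pose m := (b - 1) ^+ 2; have m0 : 0 < m by rewrite exprn_gt0// subr_gt0.
have csb (phi : R) : `|cos phi| <= 1 /\ `|sin phi| <= 1.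
  by rewrite !ler_norml !cos_geN1 !cos_le1 sin_geN1 sin_le1.
pose M := b ^+ 2 + 1 + 2 * b.
have M1 : 1 <= M.
  by rewrite /M addrAC lerDr addr_ge0 ?sqr_ge0// mulr_ge0// ltW.
have n1 phi : `|b * cos phi - 1| <= M.
  have [c1 _] := csb phi; apply: (le_trans (ler_normB _ _)); rewrite normr1 normrM gtr0_norm//.
  have h2 : b * `|cos phi| <= b by rewrite ler_piMr// ltW.
  rewrite /M; have := sqr_ge0 b; lra.
have n2 phi : `|b ^+ 2 + 1 - 2 * b * cos phi| <= M.
  have [c1 _] := csb phi; apply: (le_trans (ler_normB _ _)); apply: lerD.
    by rewrite ger0_norm// addr_ge0// sqr_ge0.
  by rewrite normrM gtr0_norm ?mulr_gt0// ler_piMr// mulr_ge0// ltW.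
have n3 phi : `|b * sin phi| <= M.
  have [_ c1] := csb phi; rewrite normrM gtr0_norm//.
  have h2 : b * `|sin phi| <= b by rewrite ler_piMr// ltW.
  rewrite /M; have := sqr_ge0 b; lra.
have iD phi : `|(b ^+ 2 + 1 - 2 * b * cos phi)^-1| <= m^-1.
  rewrite ger0_norm ?invr_ge0 ?(ltW (den0 _))//; rewrite lef_pV2 ?posrE//; exact: den.
have M0 : 0 <= M by exact: le_trans M1.
clearbody m.
have x1 : 0 <= 7 / 4 * (pi / 2) :> R by rewrite !mulr_ge0 ?pi_ge0.
have x2 : 0 <= 7 / 4 * (M / m) by rewrite mulr_ge0// divr_ge0// ltW.
have x3 : 0 <= 7 / 4 * ((M * M + M * (2 * M)) / (m ^+ 2)).
  by rewrite mulr_ge0// divr_ge0 ?sqr_ge0// addr_ge0// !mulr_ge0.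
exists (7 / 4 * (pi / 2) + 7 / 4 * (M / m) + 7 / 4 * ((M * M + M * (2 * M)) / (m ^+ 2))).
  by rewrite !addr_ge0.
move=> phi.
have y1 : `|profile b phi| <= 7 / 4 * (pi / 2).
  rewrite /profile normrM ger0_norm// ler_wpM2l// ler_norml.
  by rewrite (ltW (atan_gtNpi2 _)) (ltW (atan_ltpi2 _)).
have y2 : `|profile1 b phi| <= 7 / 4 * (M / m).
  rewrite /profile1 normrM ger0_norm// ler_wpM2l// normrM.
  by apply: ler_pM => //; exact: n1.
have y3 : `|profile2 b phi| <= 7 / 4 * ((M * M + M * (2 * M)) / (m ^+ 2)).
  rewrite /profile2 normrM ger0_norm// ler_wpM2l// normrM; apply: ler_pM => //.
    apply: (le_trans (ler_normB _ _)); apply: lerD; rewrite normrM; apply: ler_pM => //.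
      by rewrite normrN.
    by rewrite -mulrA normrM ger0_norm// ler_wpM2l.
  rewrite -!exprVn normrX; apply: lerXn2r; rewrite ?nnegrE ?invr_ge0 ?(ltW m0)//.
by split; lra.
Qed.

End squeezing_profile.

Section squeezing.
Context {R : realType}.

Lemma cos_small (s : R) : `|s| <= pi / 2 -> 0 <= cos s.
Proof. by rewrite ler_norml => h; exact: cos_ge0_pihalf. Qed.

(** With [a0] the half angle of the singular profile, [phi + 2 * a0] is [pi] modulo [2 pi] and the
    error is [s = - a0 / 4 + 7/4 * (a - a0)]. The choice [b = 1 + d^2 / 7] gives [|a - a0| <= 1/7],
    since both denominators are at least [d]. Then [|s| <= pi / 8 + 1/4 <= pi / 4], using only
    [pi >= 2]. *)
Lemma profile_squeeze (d phi : R) : 0 < d -> d <= 1 -> d <= 1 - cos phi ->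
  let psi := phi + profile (1 + d ^+ 2 / 7) phi in
  cos psi <= 0 /\ 0 <= cos (2 * psi).
Proof.
move=> d0 d1 dphi psi.
have cphi0 : 0 < 1 - cos phi by apply: lt_le_trans dphi.
have c1 : cos phi != 1 by rewrite -subr_eq0 -oppr_eq0 opprB gt_eqF.
have [ca sa] := half_angle c1.
set a0 := atan _ in ca sa.
pose a := atan (sin phi / (1 + d ^+ 2 / 7 - cos phi)).
pose s := - (a0 / 4) + 7 / 4 * (a - a0).
have psiE : psi = (phi + 2 * a0) + s by rewrite /psi /profile -/a /s; field.
have t0 : 0 <= d ^+ 2 / 7 by rewrite divr_ge0// sqr_ge0.
have aa0 : `|a - a0| <= 1 / 7.
  apply: (le_trans (atan_lipschitz _ _)).
  have den : 0 < 1 + d ^+ 2 / 7 - cos phi by rewrite addrAC ltr_pwDl.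
  have sub_inv (x y z : R) : 0 < x -> 0 < y -> z / x - z / y = - (z * (x - y) / (x * y)).
    by move=> x0 y0; field; rewrite !gt_eqF.
  rewrite sub_inv// (_ : _ - _ - _ = d ^+ 2 / 7); last by ring.
  rewrite normrN normrM normrM (ger0_norm t0) (gtr0_norm (_ : 0 < _^-1)); last first.
    by rewrite invr_gt0 mulr_gt0.
  rewrite ler_pdivrMr ?mulr_gt0//.
  have sb : `|sin phi| <= 1 by rewrite ler_norml sin_geN1 sin_le1.
  apply: (@le_trans _ _ (d ^+ 2 / 7)); first by rewrite ler_piMl.
  have : d ^+ 2 <= (1 + d ^+ 2 / 7 - cos phi) * (1 - cos phi).
    rewrite expr2; apply: ler_pM; rewrite ?(ltW d0)//.
    by apply: (le_trans dphi); rewrite addrAC lerDl.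
  lra.
have a0b : `|a0| <= pi / 2.
  by rewrite ler_norml (ltW (atan_gtNpi2 _)) (ltW (atan_ltpi2 _)).
have pi2 := @pi_ge2 R.
have sb : `|s| <= pi / 4.
  by move: aa0 a0b; rewrite /s !ler_norml => /andP[? ?] /andP[? ?]; apply/andP; split; lra.
have cpsi : cos psi = - cos s by rewrite psiE cosD ca sa mul0r subr0 mulN1r.
split.
  rewrite cpsi oppr_le0; apply: cos_small; apply: (le_trans sb); lra.
rewrite mulr_natl cos_mulr2n cpsi sqrrN -cos_mulr2n -mulr_natl; apply: cos_small.
by rewrite normrM ger0_norm//; lra.
Qed.

End squeezing.

(** * Cutoffs and rapid oscillations with bounded derivatives *)

Section bounded_C2.
Context {R : realType}.
Implicit Types (w f g : R -> R).

Definition C2b w w1 w2 (B : R) : Prop :=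
  [/\ forall z : R, is_derive z (1 : R) w (w1 z),
      forall z : R, is_derive z (1 : R) w1 (w2 z), continuous w2 &
      forall z, [/\ `|w z| <= B, `|w1 z| <= B & `|w2 z| <= B]].

Lemma C2b_ge0 w w1 w2 B : C2b w w1 w2 B -> 0 <= B.
Proof. by move=> [_ _ _ /(_ 0)[h _ _]]; exact: le_trans h. Qed.

Lemma C2b_continuous w w1 w2 B : C2b w w1 w2 B -> continuous w /\ continuous w1.
Proof. by move=> [h1 h2 _ _]; split; [exact: is_derive_continuous h1|exact: is_derive_continuous h2]. Qed.

Lemma C2b_cst (c : R) : C2b (fun=> c) (fun=> 0) (fun=> 0) `|c|.
Proof.
split; try by move=> z; exact: is_derive_cstf.
- by move=> z; exact: cvg_cst.
- by move=> z; rewrite normr0 lexx normr_ge0.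
Qed.

Lemma C2bM f f1 f2 A g g1 g2 B : C2b f f1 f2 A -> C2b g g1 g2 B ->
  C2b (fun z => f z * g z) (fun z => f1 z * g z + f z * g1 z)
    (fun z => f2 z * g z + 2 * (f1 z * g1 z) + f z * g2 z) (4 * (A * B)).
Proof.
move=> hf hg; have A0 := C2b_ge0 hf; have B0 := C2b_ge0 hg.
have [cf cf1] := C2b_continuous hf; have [cg cg1] := C2b_continuous hg.
case: hf hg => [df df1 cf2 bf] [dg dg1 cg2 bg]; split.
- by move=> z; apply: (is_derive_eq (is_deriveMf (df z) (dg z))); ring.
- move=> z; have k := is_deriveDf (is_deriveMf (df1 z) (dg z)) (is_deriveMf (df z) (dg1 z)).
  by apply: (is_derive_eq k); ring.
- have c2 : continuous (fun _ : R => 2 : R) by move=> ?; exact: cvg_cst.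
  exact: (continuousDf (continuousDf (continuousMf cf2 cg) (continuousMf c2 (continuousMf cf1 cg1))) (continuousMf cf cg2)).
move=> z; have [x0 x1 x2] := bf z; have [y0 y1 y2] := bg z.
have h (x y : R) : `|x| <= A -> `|y| <= B -> `|x * y| <= A * B.
  by move=> xA yB; rewrite normrM; exact: ler_pM.
have AB : 0 <= A * B by rewrite mulr_ge0.
split.
- by have := h _ _ x0 y0; lra.
- apply: (le_trans (ler_normD _ _)); have := h _ _ x1 y0; have := h _ _ x0 y1; lra.
- apply: (le_trans (ler_normD _ _)); apply: (@le_trans _ _ (`|f2 z * g z| + `|2 * (f1 z * g1 z)| + `|f z * g2 z|)).
    by rewrite lerD2r; exact: ler_normD.
  rewrite [`|2 * _|]normrM [`|2|]ger0_norm//.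
  have := h _ _ x2 y0; have := h _ _ x1 y1; have := h _ _ x0 y2; lra.
Qed.

Lemma is_derive_affine (a c z : R) : is_derive z (1 : R) (fun z => a * z + c) a.
Proof.
apply: (is_derive_eq (is_deriveDf (is_deriveMf (is_derive_cstf z 1 a) (is_derive_id z 1)) (is_derive_cstf z 1 c))).
by rewrite mulr0 !addr0 mulr1.
Qed.

Lemma C2b_affine w w1 w2 B (a c : R) : C2b w w1 w2 B ->
  C2b (fun z => w (a * z + c)) (fun z => a * w1 (a * z + c))
    (fun z => a ^+ 2 * w2 (a * z + c)) ((1 + `|a|) ^+ 2 * B).
Proof.
move=> hw; have B0 := C2b_ge0 hw; case: hw => [dw dw1 cw2 bw].
have ca : continuous (fun z => a * z + c) by apply: is_derive_continuous => z; exact: is_derive_affine.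
split.
- move=> z; have k := @is_derive1_comp _ w _ z _ _ (dw _) (is_derive_affine a c z).
  by apply: (is_derive_eq k); rewrite mulrC.
- move=> z; have k := @is_derive1_comp _ w1 _ z _ _ (dw1 _) (is_derive_affine a c z).
  by apply: (is_derive_eq (is_deriveMf (is_derive_cstf z 1 a) k)); ring.
- apply: continuousMf; first by move=> ?; exact: cvg_cst.
  exact: continuous_compf.
move=> z; have [x0 x1 x2] := bw (a * z + c).
have a0 := normr_ge0 a.
have e1 : 1 <= (1 + `|a|) ^+ 2 by rewrite expr2; nra.
have e2 : `|a| <= (1 + `|a|) ^+ 2 by rewrite expr2; nra.
have e3 : `|a| ^+ 2 <= (1 + `|a|) ^+ 2 by rewrite !expr2; nra.
split; rewrite ?normrM ?normrX; last 2 first.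
- exact: ler_pM.
- by apply: ler_pM => //; rewrite exprn_ge0.
by apply: (le_trans x0); rewrite ler_peMl.
Qed.

Lemma C2b_comp h h1 h2 A w w1 w2 B : C2b h h1 h2 A -> C2b w w1 w2 B ->
  C2b (fun z => h (w z)) (fun z => h1 (w z) * w1 z)
    (fun z => h2 (w z) * w1 z ^+ 2 + h1 (w z) * w2 z) (2 * (A * (1 + B) ^+ 2)).
Proof.
move=> hh hw; have A0 := C2b_ge0 hh; have B0 := C2b_ge0 hw.
have [ch ch1] := C2b_continuous hh; have [cw cw1] := C2b_continuous hw.
case: hh hw => [dh dh1 ch2 bh] [dw dw1 cw2 bw]; split.
- by move=> z; exact: (@is_derive1_comp _ h _ z _ _ (dh _) (dw z)).
- move=> z; have k := @is_derive1_comp _ h1 _ z _ _ (dh1 _) (dw z).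
  by apply: (is_derive_eq (is_deriveMf k (dw1 z))); rewrite /=; ring.
- apply: continuousDf; apply: continuousMf.
  + exact: continuous_compf.
  + by under eq_fun do rewrite expr2; exact: continuousMf.
  + exact: continuous_compf.
  + exact: cw2.
move=> z; have [x0 x1 x2] := bh (w z); have [y0 y1 y2] := bw z.
have e1 : 1 <= (1 + B) ^+ 2 by rewrite expr2; nra.
have e2 : B <= (1 + B) ^+ 2 by rewrite expr2; nra.
have e3 : B ^+ 2 <= (1 + B) ^+ 2 by rewrite !expr2; nra.
have AB : A <= A * (1 + B) ^+ 2 by rewrite ler_peMr.
have m (x y C : R) : `|x| <= A -> `|y| <= C -> C <= (1 + B) ^+ 2 -> `|x * y| <= A * (1 + B) ^+ 2.
  by move=> xA yC CB; rewrite normrM; apply: ler_pM => //; exact: le_trans CB.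
have y1' : `|w1 z ^+ 2| <= B ^+ 2 by rewrite normrX lerXn2r ?nnegrE.
split.
- lra.
- have := m _ _ _ x1 y1 e2; lra.
- apply: (le_trans (ler_normD _ _)); have := m _ _ _ x2 y1' e3; have := m _ _ _ x1 y2 e2; lra.
Qed.

Lemma C2b_cos : C2b (@cos R) (fun z => - sin z) (fun z => - cos z) 1.
Proof.
split.
- by move=> z; exact: is_derive_cos.
- by move=> z; exact: (is_deriveNf (is_derive_sin z)).
- by move=> z; apply: cvgN; exact: continuous_cos.
- by move=> z; rewrite !normrN !ler_norml cos_geN1 cos_le1 sin_geN1 sin_le1.
Qed.

Lemma C2b_step : exists s2 B, C2b (@step R) (@dstep R) s2 B.
Proof.
pose s2 : R -> R := 'D_1 (@dstep R : R^o -> R).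
have [_ /(_ 1)[dds cs2]] := @Ck_dstep R 1.
have c1 : continuous (@dstep R) by exact: (Ck_continuous (@Ck_dstep R 0)).
have d0 (x : R) : 1 < `|x| -> dstep x = 0.
  by rewrite lter_normr => /orP[h|h]; [rewrite dstep_ge1// ltW|rewrite dstep_le0//; lra].
have s20 (x : R) : 1 < `|x| -> s2 x = 0.
  move=> x1; apply: near0_derive.
  apply/nbhs_ballP; exists (`|x| - 1) => /=; first by rewrite subr_gt0.
  move=> y; rewrite /ball/= => xy; apply: d0.
  by have := ler_normD (x - y) y; rewrite subrK; move: xy; lra.
have [B1 B10 h1] := continuous_supp_bounded (@compact_ball1 R 1) c1 d0.
have [B2 B20 h2] := continuous_supp_bounded (@compact_ball1 R 1) cs2 s20.
exists s2, (1 + B1 + B2); split.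
- by move=> z; exact: is_derive_step.
- by move=> z; split; [exact: dds|].
- exact: cs2.
move=> z; have := h1 z; have := h2 z; have s0 := step_ge0 z; have s1 := step_le1 z.
rewrite (ger0_norm s0); split; lra.
Qed.

Lemma C2b_profile (b : R) : 1 < b ->
  exists B, C2b (profile b) (profile1 b) (profile2 b) B.
Proof.
move=> b1; have [B B0 hB] := profile_bounded b1; exists B; split.
- by move=> z; exact: is_derive_profile.
- by move=> z; exact: is_derive_profile1.
- exact: continuous_profile2.
- exact: hB.
Qed.

(** [k] is the product over [M] in [l] of [step (cos (2 * M * z) / e)]. It makes a new map the
    identity on the bands that earlier frequencies protect. *)
Lemma cutoff_exists (l : seq R) (e : R) : 0 < e -> exists k k1 k2 B,
  [/\ C2b k k1 k2 B, forall z, 0 <= k z <= 1,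
    forall z M, M \in l -> cos (2 * M * z) <= 0 -> k z = 0 &
    forall z, (forall M, M \in l -> e <= cos (2 * M * z)) -> k z = 1].
Proof.
move=> e0; elim: l => [|M l [k [k1 [k2 [B [hk k01 kz ke]]]]]].
  by do 4 eexists; split; [exact: (C2b_cst 1)|move=> z; rewrite ler01 lexx|done|done].
have [s2 [Bs hs]] := C2b_step.
have hc := C2bM (C2b_affine (2 * M) 0 C2b_cos) (C2b_cst e^-1).
have h := C2bM (C2b_comp hs hc) hk.
do 4 eexists; split; first exact: h.
- move=> z /=; have /andP[k0 k'1] := k01 z.
  by rewrite mulr_ge0 ?step_ge0//= mulr_ile1 ?step_ge0 ?step_le1.
- move=> z M' /=; rewrite in_cons => /predU1P[->|M'l] c0; last by rewrite (kz z M')// mulr0.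
  by rewrite addr0 step_le0 ?mul0r// pmulr_lle0 ?invr_gt0.
- move=> z hM /=; rewrite ke ?mulr1; last by move=> M' M'l; apply: hM; rewrite in_cons M'l orbT.
  by rewrite addr0 step_ge1// ler_pdivlMr// mul1r; apply: hM; rewrite mem_head.
Qed.

(** A perturbation of size [1 / N] whose derivatives have sizes 1 and [N]. The shift [c] is 0 to
    squeeze the phase [N z] towards [pi], and [pi] to squeeze it towards 0. *)
Definition osc (k p : R -> R) (N c z : R) : R := N^-1 * (k z * p (N * z + c)).

Definition osc1 (k k1 p p1 : R -> R) (N c z : R) : R :=
  N^-1 * (k1 z * p (N * z + c)) + k z * p1 (N * z + c).

Definition osc2 (k k1 k2 p p1 p2 : R -> R) (N c z : R) : R :=
  N^-1 * (k2 z * p (N * z + c)) + 2 * (k1 z * p1 (N * z + c)) +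
  N * (k z * p2 (N * z + c)).

Lemma osc_C2 k k1 k2 A p p1 p2 B N c : 1 <= N -> C2b k k1 k2 A ->
  C2b p p1 p2 B ->
  [/\ forall z : R, is_derive z (1 : R) (osc k p N c) (osc1 k k1 p p1 N c z),
      forall z : R, is_derive z (1 : R) (osc1 k k1 p p1 N c) (osc2 k k1 k2 p p1 p2 N c z),
      continuous (osc2 k k1 k2 p p1 p2 N c) &
      forall z, [/\ `|osc k p N c z| <= A * B / N,
        `|osc1 k k1 p p1 N c z| <= 4 * (A * B) &
        `|osc2 k k1 k2 p p1 p2 N c z| <= 4 * (A * B) * N]].
Proof.
move=> N1 hk hp; have A0 := C2b_ge0 hk; have B0 := C2b_ge0 hp.
have N0 : 0 < N by exact: lt_le_trans N1.
have N0' : N != 0 by rewrite gt_eqF.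
have [ck ck1] := C2b_continuous hk; have [cp cp1] := C2b_continuous hp.
case: hk hp => [dk dk1 ck2 bk] [dp dp1 cp2 bp].
have dpN z := @is_derive1_comp _ p _ z _ _ (dp _) (is_derive_affine N c z).
have dp1N z := @is_derive1_comp _ p1 _ z _ _ (dp1 _) (is_derive_affine N c z).
split.
- move=> z; have h := is_deriveMf (dk z) (dpN z).
  apply: (is_derive_eq (is_deriveMf (is_derive_cstf z 1 N^-1) h)).
  by rewrite /osc1 /=; field.
- move=> z; have h := is_deriveMf (is_derive_cstf z 1 N^-1) (is_deriveMf (dk1 z) (dpN z)).
  apply: (is_derive_eq (is_deriveDf h (is_deriveMf (dk z) (dp1N z)))).
  by rewrite /osc2 /=; field.
- have ca : continuous (fun z => N * z + c) by apply: is_derive_continuous => z; exact: is_derive_affine.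
  have cc (r : R) : continuous (fun _ : R => r) by move=> ?; exact: cvg_cst.
  have cpN := continuous_compf ca cp; have cp1N := continuous_compf ca cp1; have cp2N := continuous_compf ca cp2.
  exact: (continuousDf (continuousDf (continuousMf (cc _) (continuousMf ck2 cpN)) (continuousMf (cc _) (continuousMf ck1 cp1N))) (continuousMf (cc _) (continuousMf ck cp2N))).
move=> z; have [x0 x1 x2] := bk z; have [y0 y1 y2] := bp (N * z + c).
have h (x y : R) : `|x| <= A -> `|y| <= B -> `|x * y| <= A * B.
  by move=> xA yB; rewrite normrM; exact: ler_pM.
have AB : 0 <= A * B by rewrite mulr_ge0.
have iN : 0 <= N^-1 by rewrite invr_ge0 ltW.
have iN1 : N^-1 <= 1 by rewrite invf_le1.
have ABN : A * B <= A * B * N by rewrite ler_peMr.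
have hi (x y : R) : `|x| <= A -> `|y| <= B -> `|N^-1 * (x * y)| <= A * B.
  by move=> xA yB; rewrite normrM (ger0_norm iN) -[leRHS]mul1r; apply: ler_pM => //; exact: h.
split.
- by rewrite /osc normrM (ger0_norm iN) mulrC ler_wpM2r//; exact: h.
- apply: (le_trans (ler_normD _ _)); have := hi _ _ x1 y0; have := h _ _ x0 y1; lra.
- apply: (le_trans (ler_normD _ _)).
  have n1 := ler_normD (N^-1 * (k2 z * p (N * z + c))) (2 * (k1 z * p1 (N * z + c))).
  have n2 := hi _ _ x2 y0; have n3 := h _ _ x1 y1.
  rewrite [`|2 * _|]normrM [`|2|]ger0_norm// in n1.
  have n4 : `|N * (k z * p2 (N * z + c))| <= A * B * N.
    by rewrite normrM (gtr0_norm N0) [leRHS]mulrC; apply: ler_wpM2l; [exact: ltW|exact: h].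
  lra.
Qed.

(** The profile contributes at least [- 7/8] and the derivative of the cutoff at least [- 1/16],
    because [N >= 16 A B]. A margin of [1/16] is left for the monotonicity of [L (t, .)]. *)
Lemma osc1_ge k k1 k2 A p p1 p2 B N c z : C2b k k1 k2 A -> C2b p p1 p2 B ->
  0 <= k z <= 1 -> - (7 / 8) <= p1 (N * z + c) -> 1 <= N -> 16 * (A * B) <= N ->
  - (15 / 16) <= osc1 k k1 p p1 N c z.
Proof.
move=> hk hp /andP[k0 k_le1] p1z N1 hN; have A0 := C2b_ge0 hk; have B0 := C2b_ge0 hp.
have N0 : 0 < N by exact: lt_le_trans N1.
have [_ _ _ bk] := hk; have [_ _ _ bp] := hp.
have [_ x1 _] := bk z; have [y0 _ _] := bp (N * z + c).
have : `|N^-1 * (k1 z * p (N * z + c))| <= 1 / 16.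
  rewrite normrM (gtr0_norm (_ : 0 < N^-1)) ?invr_gt0// mulrC ler_pdivrMr// normrM.
  have : `|k1 z| * `|p (N * z + c)| <= A * B by exact: ler_pM.
  lra.
rewrite ler_norml /osc1 => /andP[h _].
have : - (7 / 8) <= k z * p1 (N * z + c) by nra.
lra.
Qed.

End bounded_C2.

(** * Flows and their perturbation *)

Section flows.
Context {R : realType}.

Let comb (x1 x2 x3 e1 e2 e3 : R) : `|x1| <= e1 -> `|x2| <= e2 -> `|x3| <= e3 ->
  `|- (1 / 2) * (x1 + 2 * x2) - x2 + 1 / 2 * x3| <= 1 / 2 * e1 + 2 * e2 + 1 / 2 * e3.
Proof.
rewrite !ler_norml => /andP[? ?] /andP[? ?] /andP[? ?].
by apply/andP; split; lra.
Qed.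

(* [fY] is transported by the field [(1, 2 fu)], so that its level lines are
   characteristics of [fu], and [fJ] is the reciprocal of [fYx]. *)
Record flow := Flow { fu : R * R -> R; fut : R * R -> R; fux : R * R -> R;
  fY : R * R -> R; fYt : R * R -> R; fYx : R * R -> R;
  fJ : R * R -> R; fJt : R * R -> R; fJx : R * R -> R }.

Definition fg (s : flow) (p : R * R) : R := fut s p + 2 * fu s p * fux s p.

(** The equation for [fJ] is the [x]-derivative of the transport equation of [fY], rewritten for the
    reciprocal of [fYx]; storing [fJ] avoids second derivatives of [fY]. The bound on [fJ] keeps
    [fYx] away from 0, and the last one limits the number of periods of a phase across the
    square. *)
Definition flow_ok (s : flow) (C : R) : Prop :=
  [/\ [/\ has_grad (fu s) (fut s) (fux s), has_grad (fY s) (fYt s) (fYx s) &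
        has_grad (fJ s) (fJt s) (fJx s)],
      forall p, [/\ fJ s p * fYx s p = 1, 0 < fJ s p,
        fYt s p + 2 * fu s p * fYx s p = 0 &
        fJt s p + 2 * fu s p * fJx s p = 2 * fux s p * fJ s p],
      forall p, [/\ fJ s p <= C, `|fJx s p| <= C & `|fux s p| <= C] &
      forall t, fY s (t, 1) - fY s (t, 0) <= C].

(** Data of [L(t, z) = z + qA t * wA z + qB t * wB z] with two derivatives of each factor: the pair
    [A] acts before the chosen time and the pair [B] after it. *)
Record squeeze := Squeeze {
  qA : R -> R; qA1 : R -> R; qA2 : R -> R; wA : R -> R; wA1 : R -> R; wA2 : R -> R;
  qB : R -> R; qB1 : R -> R; qB2 : R -> R; wB : R -> R; wB1 : R -> R; wB2 : R -> R }.

Variable q : squeeze.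

Definition sL p := p.2 + (qA q p.1 * wA q p.2 + qB q p.1 * wB q p.2).
Definition sLt p := qA1 q p.1 * wA q p.2 + qB1 q p.1 * wB q p.2.
Definition sLz p := 1 + (qA q p.1 * wA1 q p.2 + qB q p.1 * wB1 q p.2).
Definition sLtt p := qA2 q p.1 * wA q p.2 + qB2 q p.1 * wB q p.2.
Definition sLtz p := qA1 q p.1 * wA1 q p.2 + qB1 q p.1 * wB1 q p.2.
Definition sLzz p := qA q p.1 * wA2 q p.2 + qB q p.1 * wB2 q p.2.

(** In the application [a] is [O(1/N)] and [D] is [O(N)]. The condition [a * D <= B] keeps products
    such as [sLt * sLzz] bounded independently of [N]. *)
Definition squeeze_ok (a B D : R) : Prop :=
  [/\ C2b (qA q) (qA1 q) (qA2 q) B, C2b (qB q) (qB1 q) (qB2 q) B,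
      [/\ forall z : R, is_derive z (1 : R) (wA q) (wA1 q z),
        forall z : R, is_derive z (1 : R) (wA1 q) (wA2 q z), continuous (wA2 q) &
        forall z, [/\ `|wA q z| <= a, `|wA1 q z| <= B & `|wA2 q z| <= D]],
      [/\ forall z : R, is_derive z (1 : R) (wB q) (wB1 q z),
        forall z : R, is_derive z (1 : R) (wB1 q) (wB2 q z), continuous (wB2 q) &
        forall z, [/\ `|wB q z| <= a, `|wB1 q z| <= B & `|wB2 q z| <= D]] &
      [/\ 0 <= a, a <= 1, a * D <= B & forall p, 1 / 16 <= sLz p]].

Section squeezed.
Variables (a B D : R).
Hypothesis qok : squeeze_ok a B D.

Let has_grad_term (f f' w w' : R -> R) :
  (forall z : R, is_derive z (1 : R) f (f' z)) -> continuous f' ->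
  (forall z : R, is_derive z (1 : R) w (w' z)) -> continuous w' ->
  has_grad (fun p => f p.1 * w p.2) (fun p => f' p.1 * w p.2) (fun p => f p.1 * w' p.2).
Proof.
move=> df cf' dw cw'.
apply: (has_grad_eq (has_gradM (has_grad_comp df cf' has_grad_fst) (has_grad_comp dw cw' has_grad_snd))) => p /=; ring.
Qed.

Lemma has_grad_sL : has_grad sL sLt sLz.
Proof.
have [hqA hqB [dA dA1 cA2 _] [dB dB1 cB2 _] _] := qok.
have [_ cqA1] := C2b_continuous hqA; have [_ cqB1] := C2b_continuous hqB.
case: hqA hqB => [dqA _ _ _] [dqB _ _ _].
have cA1 := is_derive_continuous dA1; have cB1 := is_derive_continuous dB1.
apply: (has_grad_eq (has_gradD has_grad_snd (has_gradD (has_grad_term dqA cqA1 dA cA1) (has_grad_term dqB cqB1 dB cB1)))) => p //=.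
by rewrite add0r.
Qed.

Lemma has_grad_sLt : has_grad sLt sLtt sLtz.
Proof.
have [hqA hqB [dA dA1 cA2 _] [dB dB1 cB2 _] _] := qok.
case: hqA hqB => [_ dqA cqA _] [_ dqB cqB _].
have cA1 := is_derive_continuous dA1; have cB1 := is_derive_continuous dB1.
exact: (has_gradD (has_grad_term dqA cqA dA cA1) (has_grad_term dqB cqB dB cB1)).
Qed.

Lemma has_grad_sLz : has_grad sLz sLtz sLzz.
Proof.
have [hqA hqB [dA dA1 cA2 _] [dB dB1 cB2 _] _] := qok.
have [_ cqA1] := C2b_continuous hqA; have [_ cqB1] := C2b_continuous hqB.
case: hqA hqB => [dqA _ _ _] [dqB _ _ _].
apply: (has_grad_eq (has_gradD (has_grad_cst 1) (has_gradD (has_grad_term dqA cqA1 dA1 cA2) (has_grad_term dqB cqB1 dB1 cB2)))) => p /=;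
  by rewrite add0r.
Qed.

Lemma sLz_gt0 p : 0 < sLz p.
Proof. by have [_ _ _ _ [_ _ _ /(_ p)]] := qok; apply: lt_le_trans. Qed.

Lemma sL_inj t y z : sL (t, y) = sL (t, z) -> y = z.
Proof.
have dL w : is_derive w (1 : R) (fun w => sL (t, w)) (sLz (t, w)) := has_grad_slice2 t w has_grad_sL.
have cL : continuous (fun w => sL (t, w)) by exact: is_derive_continuous dL.
have lt v w : v < w -> sL (t, v) < sL (t, w).
  move=> vw; have [c _ h] := MVT vw (fun w _ => dL w) (continuous_subspaceT cL).
  by rewrite -subr_gt0 h mulr_gt0 ?subr_gt0//; exact: sLz_gt0.
by move=> h; case: (ltgtP y z) => // /lt; rewrite h ltxx.
Qed.

Let bnd2 (x y x' y' A A' : R) : `|x| <= A -> `|x'| <= A -> `|y| <= A' -> `|y'| <= A' ->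
  `|x * y + x' * y'| <= 2 * (A * A').
Proof.
move=> h1 h2 h3 h4; apply: (le_trans (ler_normD _ _)).
rewrite mulr_natl mulr2n; apply: lerD; rewrite normrM; exact: ler_pM.
Qed.

Lemma squeeze_bounds p :
  [/\ `|sL p - p.2| <= 2 * (B * a), `|sLt p| <= 2 * (B * a), `|sLtt p| <= 2 * (B * a),
      `|sLtz p| <= 2 * (B * B) & `|sLzz p| <= 2 * (B * D)].
Proof.
have [[_ _ _ /(_ p.1)[x0 x1 x2]] [_ _ _ /(_ p.1)[y0 y1 y2]] [_ _ _ /(_ p.2)[z0 z1 z2]] [_ _ _ /(_ p.2)[v0 v1 v2]] _] := qok.
split; try exact: bnd2.
by rewrite /sL addrC addKr; exact: bnd2.
Qed.

End squeezed.

Variable s : flow.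

Let P (p : R * R) := (p.1, fY s p).
Let H p := sLt (P p) / sLz (P p).
Let Ht p := sLtt (P p) / sLz (P p) - sLt (P p) * sLtz (P p) / sLz (P p) ^+ 2.
Let Hz p := sLtz (P p) / sLz (P p) - sLt (P p) * sLzz (P p) / sLz (P p) ^+ 2.

(** Inserting [Y' = L(t, Y)] into [Y'_t + 2 u' Y'_x = 0] and using the equation of [Y] gives
    [u' = u - (1/2) (L_t / L_z) J]. In the [x]-derivative, [Hz * fYx * fJ] reduces to [Hz]. *)
Definition squeezed : flow := Flow
  (fun p => fu s p - 1 / 2 * (H p * fJ s p))
  (fun p => fut s p - 1 / 2 * ((Ht p + Hz p * fYt s p) * fJ s p + H p * fJt s p))
  (fun p => fux s p - 1 / 2 * (Hz p + H p * fJx s p))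
  (fun p => sL (P p))
  (fun p => sLt (P p) + sLz (P p) * fYt s p)
  (fun p => sLz (P p) * fYx s p)
  (fun p => fJ s p / sLz (P p))
  (fun p => fJt s p / sLz (P p) - fJ s p * (sLtz (P p) + sLzz (P p) * fYt s p) / sLz (P p) ^+ 2)
  (fun p => fJx s p / sLz (P p) - sLzz (P p) / sLz (P p) ^+ 2).

Lemma squeezed_grad a B D C : squeeze_ok a B D -> flow_ok s C ->
  [/\ has_grad (fu squeezed) (fut squeezed) (fux squeezed),
      has_grad (fY squeezed) (fYt squeezed) (fYx squeezed) &
      has_grad (fJ squeezed) (fJt squeezed) (fJx squeezed)].
Proof.
move=> qok [[hu hY hJ] rel _ _].
have z0 p : sLz (P p) != 0 by rewrite gt_eqF//; exact: (sLz_gt0 qok).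
have gL := has_grad_sub (has_grad_sL qok) hY.
have gLt := has_grad_sub (has_grad_sLt qok) hY.
have gLz := has_grad_sub (has_grad_sLz qok) hY.
have gV := has_gradV z0 gLz.
split.
- have g1 := has_gradM (has_gradM gLt gV) hJ.
  have g2 := has_gradM (has_grad_cst (- (1 / 2))) g1.
  have := has_gradD hu g2.
  set f := (fun p => _ + _) => h.
  have -> : fu squeezed = f by apply/funext => p; rewrite /f /squeezed/= /H /P mulNr.
  apply: (has_grad_eq h) => p /=; have := z0 p; have [jy _ _ _] := rel p.
    by rewrite /Ht /Hz /H /P => z; field.
  rewrite /Hz /H /P; move: jy; set lz := sLz _; move=> jy z.
  rewrite (_ : sLtz _ / lz - _ = (sLtz (P p) / lz - sLt (P p) * sLzz (P p) / lz ^+ 2) * (fJ s p * fYx s p)); last by rewrite jy mulr1.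
  by rewrite /P; field.
- exact: gL.
- apply: (has_grad_eq (has_gradM hJ gV)) => p /=; have := z0 p; have [jy _ _ _] := rel p.
    by rewrite /P => z; field.
  rewrite /P; move: jy; set lz := sLz _; move=> jy z.
  rewrite (_ : sLzz _ / lz ^+ 2 = sLzz (P p) / lz ^+ 2 * (fJ s p * fYx s p)); last by rewrite jy mulr1.
  by rewrite /P; field.
Qed.

(** In the formula for the sources, the derivative of [H(t, Y)] along the old flow is [Ht] alone
    since [Y] is transported, and [fJ] is differentiated through its own equation. Every term
    therefore contains [H] or [Ht], both [O(a)]; [Hz] appears only multiplied by [H]. *)
Lemma squeezed_rel a B D C p : squeeze_ok a B D -> flow_ok s C ->
  [/\ fJ squeezed p * fYx squeezed p = 1, 0 < fJ squeezed p,
      fYt squeezed p + 2 * fu squeezed p * fYx squeezed p = 0,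
      fJt squeezed p + 2 * fu squeezed p * fJx squeezed p = 2 * fux squeezed p * fJ squeezed p &
      fg squeezed p - fg s p =
        - (1 / 2) * (Ht p * fJ s p + 2 * H p * fux s p * fJ s p)
        - H p * fJ s p * fux s p
        + 1 / 2 * (H p * fJ s p * (Hz p + H p * fJx s p))].
Proof.
move=> qok [_ /(_ p)[jy j0 eY eJ] _ _].
have lz0 : 0 < sLz (P p) by exact: (sLz_gt0 qok).
have j1 : fJ s p != 0 by rewrite gt_eqF.
have lz1 : sLz (P p) != 0 by rewrite gt_eqF.
have yx : fYx s p = (fJ s p)^-1 by rewrite -[LHS](mulKf j1) jy mulr1.
have yt : fYt s p = - (2 * fu s p / fJ s p) by rewrite -yx; apply/eqP; rewrite -addr_eq0 eY.
have jt : fJt s p = 2 * fux s p * fJ s p - 2 * fu s p * fJx s p by rewrite -eJ addrK.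
split.
- by rewrite /= yx; field; rewrite j1.
- by rewrite /= divr_gt0.
- by rewrite /= yt yx /H; field; rewrite j1.
- by rewrite /= yt jt /Hz /H; field; rewrite lz1 j1.
- by rewrite /fg /= yt jt; field; rewrite j1.
Qed.

Definition squeeze_const (B C : R) : R :=
  1 / 2 * ((32 * B + 1024 * (B * (B * B))) * C + 64 * (B * (C * C))) +
  32 * (B * (C * C)) +
  16 * (B * C) * (32 * (B * B) + 1024 * (B * (B * B)) + 32 * (B * C)).

Lemma squeezed_bounds a B D C p : squeeze_ok a B D -> flow_ok s C ->
  [/\ `|fu squeezed p - fu s p| <= a * (16 * (B * C)),
      `|fg squeezed p - fg s p| <= a * squeeze_const B C,
      fJ squeezed p <= 16 * C, `|fJx squeezed p| <= 16 * C + 512 * (B * D) &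
      `|fux squeezed p| <= C + (16 * (B * B) + 512 * (B * (B * B)) + 16 * (B * C))].
Proof.
move=> qok sok; have [_ _ _ _ gE] := squeezed_rel p qok sok.
have [hqA _ _ _ [a0 a1 aD zge]] := qok; have B0 := C2b_ge0 hqA.
have [_ lt ltt ltz lzz] := squeeze_bounds qok (P p).
have lz0 := sLz_gt0 qok (P p).
have [_ /(_ p)[_ j0 _ _] /(_ p)[jC jxC uxC] _] := sok.
have C0 : 0 <= C by apply: le_trans jC; exact: ltW.
have D0 : 0 <= D.
  by have [_ _ [_ _ _ /(_ 0)[_ _ h]] _ _] := qok; exact: le_trans h.
have jC' : `|fJ s p| <= C by rewrite gtr0_norm.
have BB : 0 <= B * B by rewrite mulr_ge0.
have BBB : 0 <= B * (B * B) by rewrite mulr_ge0.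
have BC : 0 <= B * C by rewrite mulr_ge0.
have i16 : `|(sLz (P p))^-1| <= 16.
  rewrite gtr0_norm ?invr_gt0// -[leRHS]invrK lef_pV2 ?posrE ?invr_gt0//.
  by have := zge (P p); rewrite div1r.
have m (x y A A' : R) : `|x| <= A -> `|y| <= A' -> `|x * y| <= A * A'.
  by move=> xA yA; rewrite normrM; exact: ler_pM.
have i256 : `|(sLz (P p) ^+ 2)^-1| <= 256.
  by rewrite expr2 invfM (_ : 256 = 16 * 16); [exact: m|ring].
have hH : `|H p| <= a * (32 * B).
  by have := m _ _ _ _ lt i16; rewrite (_ : 2 * (B * a) * 16 = a * (32 * B))//; ring.
have hHt : `|Ht p| <= a * (32 * B + 1024 * (B * (B * B))).
  apply: (le_trans (ler_normB _ _)).
  have h1 := m _ _ _ _ ltt i16; have h2 := m _ _ _ _ (m _ _ _ _ lt ltz) i256.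
  apply: (le_trans (lerD h1 h2)); rewrite le_eqVlt; apply/orP; left; apply/eqP; ring.
have hHz : `|Hz p| <= 32 * (B * B) + 1024 * (B * (B * B)).
  apply: (le_trans (ler_normB _ _)); apply: lerD.
    by have := m _ _ _ _ ltz i16; rewrite (_ : 2 * (B * B) * 16 = 32 * (B * B))//; ring.
  have h2 := m _ _ _ _ (m _ _ _ _ lt lzz) i256; apply: (le_trans h2).
  rewrite (_ : _ * 256 = 1024 * (B * B * (a * D))); last by ring.
  rewrite [B * (B * B)]mulrA; exact: (ler_wpM2l (ler0n R 1024) (ler_wpM2l BB aD)).
have hHj : `|H p * fJ s p| <= a * (32 * (B * C)).
  by have := m _ _ _ _ hH jC'; rewrite (_ : a * (32 * B) * C = a * (32 * (B * C)))//; ring.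
have hHjx : `|Hz p + H p * fJx s p| <= 32 * (B * B) + 1024 * (B * (B * B)) + 32 * (B * C).
  apply: (le_trans (ler_normD _ _)); apply: lerD => //.
  apply: (le_trans (m _ _ _ _ hH jxC)).
  rewrite (_ : a * (32 * B) * C = a * (32 * (B * C))); last by ring.
  by rewrite ler_piMl// mulr_ge0.
have half : `|1 / 2 : R| = 1 / 2 by rewrite ger0_norm.
split.
- rewrite /= addrAC subrr sub0r normrN normrM half.
  have -> : a * (16 * (B * C)) = 1 / 2 * (a * (32 * (B * C))) by field.
  by rewrite ler_wpM2l.
- rewrite gE.
  have h1 := m _ _ _ _ hHt jC'; have h2 := m _ _ _ _ hHj uxC; have h3 := m _ _ _ _ hHj hHjx.
  set x1 := Ht p * _ in h1 *; set x2 := H p * fJ s p * fux s p in h2 *; set x3 := H p * fJ s p * _ in h3 *.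
  have -> : 2 * H p * fux s p * fJ s p = 2 * x2 by rewrite /x2; ring.
  have -> : a * squeeze_const B C = 1 / 2 * (a * (32 * B + 1024 * (B * (B * B))) * C) +
     2 * (a * (32 * (B * C)) * C) + 1 / 2 * (a * (32 * (B * C)) * (32 * (B * B) + 1024 * (B * (B * B)) + 32 * (B * C))).
    by rewrite /squeeze_const; field.
  exact: comb.
- rewrite /= mulrC; apply: ler_pM; [by rewrite invr_ge0 ltW|exact: ltW| |exact: jC].
  exact: le_trans (ler_norm _) i16.
- rewrite /=; apply: (le_trans (ler_normB _ _)); apply: lerD.
    by rewrite [16 * C]mulrC; exact: m.
  have := m _ _ _ _ lzz i256; rewrite (_ : 2 * (B * D) * 256 = 512 * (B * D))//; ring.
- rewrite /=; apply: (le_trans (ler_normB _ _)); apply: lerD => //.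
  rewrite normrM half; have -> : 16 * (B * B) + 512 * (B * (B * B)) + 16 * (B * C) =
    1 / 2 * (32 * (B * B) + 1024 * (B * (B * B)) + 32 * (B * C)) by field.
  by rewrite ler_wpM2l.
Qed.

End flows.

Section squeezed_flows.
Context {R : realType}.

(* The new constants depend on [D], which grows with the frequency, whereas the
   size of the perturbation does not: this is what lets the frequency be chosen
   last. *)
Lemma squeezed_ok (B C : R) : 0 <= B -> 0 <= C -> exists2 K, 0 <= K &
  forall q s a D, squeeze_ok q a B D -> flow_ok s C ->
    exists C', flow_ok (squeezed q s) C' /\
      forall p, `|fu (squeezed q s) p - fu s p| <= a * K /\
        `|fg (squeezed q s) p - fg s p| <= a * K.
Proof.
move=> B0 C0.
have h2 : 0 <= 1 / 2 :> R by [].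
have squeeze_const0 : 0 <= squeeze_const B C by rewrite /squeeze_const; repeat first [assumption | exact: ler0n | apply: addr_ge0 | apply: mulr_ge0].
have K10 : 0 <= 16 * (B * C) by rewrite !mulr_ge0.
exists (16 * (B * C) + squeeze_const B C); first by rewrite addr_ge0.
move=> q s a D qok sok; have bnd p := squeezed_bounds p qok sok.
have [hqA _ _ _ [a0 a1 aD zge]] := qok.
have D0 : 0 <= D.
  by have [_ _ [_ _ _ /(_ 0)[_ _ h]] _ _] := qok; exact: le_trans h.
clear h2; pose X1 := 16 * C; pose X2 := 512 * (B * D); pose X3 := 16 * (B * B) + 512 * (B * (B * B)) + 16 * (B * C).
have x1 : 0 <= X1 by rewrite mulr_ge0.
have x2 : 0 <= X2 by rewrite /X2; repeat first [assumption | exact: ler0n | apply: mulr_ge0].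
have x3 : 0 <= X3 by rewrite /X3; repeat first [assumption | exact: ler0n | apply: addr_ge0 | apply: mulr_ge0].
exists (C + X1 + X2 + X3 + 4 * (B * a)); split; last first.
  move=> p; have [h1 h2 _ _ _] := bnd p; split.
    by apply: (le_trans h1); rewrite ler_wpM2l// lerDl.
  by apply: (le_trans h2); rewrite ler_wpM2l// lerDr.
have Ba : 0 <= B * a by rewrite mulr_ge0.
split.
- exact: (squeezed_grad qok sok).
- by move=> p; have [? ? ? ? _] := squeezed_rel p qok sok; split.
- move=> p; have [_ _ h1 h2 h3] := bnd p.
  move: h1 h2 h3; rewrite -/X1 -/X2 -/X3 => h1 h2 h3.
  by split; [apply: (le_trans h1)|apply: (le_trans h2)|apply: (le_trans h3)]; clear -x1 x2 x3 Ba C0; lra.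
- move=> t; have [_ _ _ /(_ t) hY] := sok.
  have [y1 _ _ _ _] := squeeze_bounds qok (t, fY s (t, 1)).
  have [y0 _ _ _ _] := squeeze_bounds qok (t, fY s (t, 0)).
  move: y1 y0; rewrite /= !ler_norml => /andP[? ?] /andP[? ?]; lra.
Qed.

End squeezed_flows.

(** * Measure of the resonant phases *)

Section phase.
Context {R : realType}.

Definition resonant (th : R -> R) (e : R) : set R :=
  [set x | 0 <= x <= 1 /\ `|cos (th x)| < e].

(* The antiderivative [F] below has a nonnegative derivative which is at least
   [3 Yx / (8 e)] where [|cos| < e]. *)
Lemma phase_slice (Y Yx : R -> R) (C M c e : R) :
  (forall x : R, is_derive x (1 : R) Y (Yx x)) -> continuous Yx -> 1 <= M ->
  0 < e -> e <= 1 / 2 -> 0 < C -> (forall x, C^-1 <= Yx x) -> Y 1 - Y 0 <= C ->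
  let A : set (measurableTypeR R) := resonant (fun x => M * Y x + c) e in
  measurable A /\ (lebesgue_measure A <= (8 / 3 * C * (pi + pi / 2 * C) * e)%:E)%E.
Proof.
move=> dY cYx M1 e0 e2 C0 hYx hY A.
have M0 : 0 < M by exact: lt_le_trans M1.
have cY := is_derive_continuous dY.
pose th x := M * Y x + c.
have cc (r : R) : continuous (fun _ : R => r) by move=> ?; exact: cvg_cst.
have cth : continuous th by exact: (continuousDf (continuousMf (cc _) cY) (cc _)).
have ccos : continuous (fun x => cos (th x)) by exact: (continuous_compf cth (@continuous_cos R)).
have csin : continuous (fun x => sin (th x)) by exact: (continuous_compf cth (@continuous_sin R)).
pose I : set (measurableTypeR R) := `[0, 1]%classic.
have mI : measurable I by exact: measurable_itv.
have AI x : A x -> 0 <= x <= 1 by case.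
have mA : measurable (A : set (measurableTypeR R)).
  rewrite (_ : A = I `&` (fun x => cos (th x)) @^-1` [set y | `|y| < e]); last first.
    by apply/seteqP; split=> x; rewrite /A /resonant /I/= in_itv.
  apply: measurableI => //; apply: open_measurable; apply: open_comp; first by move=> x _; exact: ccos.
  have -> : [set y : R | `|y| < e] = ball (0 : R) e.
    by apply/seteqP; split=> y; rewrite /ball/= sub0r normrN.
  exact: ball_open.
pose f x := Yx x * (sin (th x) ^+ 2 / (e * (1 + (cos (th x) / e) ^+ 2)) - atan (cos (th x) / e) * cos (th x) + pi / 2).
(* The oscillating term of [F] carries [1 / M], so [F 1 - F 0] is bounded whatever the frequency.
   The term [pi / 2 * Y] compensates [- atan (cos / e) * cos], the only negative contribution to the
   derivative. *)
pose F x := - (atan (cos (th x) / e) * (sin (th x) / M)) + pi / 2 * Y x.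
have e1 : e != 0 by rewrite gt_eqF.
have den x : 0 < 1 + (cos (th x) / e) ^+ 2 by rewrite ltr_pwDl// sqr_ge0.
have dth x : is_derive x (1 : R) th (M * Yx x).
  apply: (is_derive_eq (is_deriveDf (is_deriveMf (is_derive_cstf x 1 M) (dY x)) (is_derive_cstf x 1 c))).
  by rewrite mulr0 !addr0.
have dF x : is_derive x (1 : R) F (f x).
  have k1 := @is_derive1_comp _ (@cos R) th x _ _ (is_derive_cos _) (dth x).
  have k2 := @is_derive1_comp _ (@sin R) th x _ _ (is_derive_sin _) (dth x).
  have k3 := @is_derive1_comp _ (@atan R) (fun x => cos (th x) / e) x _ _ (is_derive1_atan _) (is_deriveMf k1 (is_derive_cstf x 1 e^-1)).
  have k4 := is_deriveMf k3 (is_deriveMf k2 (is_derive_cstf x 1 M^-1)).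
  apply: (is_derive_eq (is_deriveDf (is_deriveNf k4) (is_deriveMf (is_derive_cstf x 1 (pi / 2)) (dY x)))).
  have d := lt0r_neq0 (den x).
  rewrite /= /f.
  set z := atan _; set co := cos (th x) in d *; set si := sin (th x).
  have ec : e ^+ 2 + co ^+ 2 != 0 by rewrite gt_eqF// ltr_pwDl ?exprn_gt0 ?sqr_ge0.
  have -> : (1 + (co / e) ^+ 2)^-1 = e ^+ 2 / (e ^+ 2 + co ^+ 2).
    by rewrite -[RHS]invrK; congr (_^-1); field; rewrite e1 ec.
  have -> : si ^+ 2 / (e * (1 + (co / e) ^+ 2)) = si ^+ 2 * e / (e ^+ 2 + co ^+ 2).
    by field; rewrite e1 ec.
  by field; rewrite ec e1 (lt0r_neq0 M0).
have cf : continuous f.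
  have cce : continuous (fun x => cos (th x) / e) by exact: (continuousMf ccos (cc _)).
  apply: (continuousMf cYx); apply: continuousDf => //; apply: continuousBf; apply: continuousMf.
  - by under eq_fun do rewrite expr2; exact: continuousMf.
  - apply: continuousVf; last by move=> x; rewrite mulf_neq0// gt_eqF.
    apply: continuousMf => //; apply: continuousDf => //.
    by under eq_fun do rewrite expr2; exact: continuousMf.
  - exact: (continuous_compf cce (@continuous_atan R)).
  - exact: ccos.
have Yx0 x : 0 < Yx x by apply: lt_le_trans (hYx x); rewrite invr_gt0.
have at2 x : `|atan (cos (th x) / e) * cos (th x)| <= pi / 2.
  rewrite normrM -[leRHS]mulr1; apply: ler_pM => //.
    by rewrite ler_norml (ltW (atan_gtNpi2 _)) (ltW (atan_ltpi2 _)).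
  by rewrite ler_norml cos_geN1 cos_le1.
have q0 x : 0 <= sin (th x) ^+ 2 / (e * (1 + (cos (th x) / e) ^+ 2)).
  by rewrite divr_ge0 ?sqr_ge0// mulr_ge0 ?ltW.
have f0 x : 0 <= f x.
  rewrite /f mulr_ge0 ?(ltW (Yx0 _))//.
  by have := at2 x; have := q0 x; rewrite ler_norml => ? /andP[? ?]; lra.
pose k := 3 / 8 / (e * C).
have k0 : 0 < k by rewrite /k divr_gt0 ?mulr_gt0.
have fA x : A x -> k <= f x.
  case=> _ hc.
  have hs : 3 / 4 <= sin (th x) ^+ 2.
    rewrite sin2cos2 -real_normK ?num_real// lerBrDl.
    have : `|cos (th x)| ^+ 2 <= (1 / 2) ^+ 2 by rewrite lerXn2r ?nnegrE// (le_trans (ltW hc)).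
    by rewrite expr2 (expr2 (1 / 2)); lra.
  have hd : 1 + (cos (th x) / e) ^+ 2 <= 2.
    rewrite -real_normK ?num_real// normrM (gtr0_norm (_ : 0 < e^-1)) ?invr_gt0//.
    have : `|cos (th x)| / e <= 1 by rewrite ler_pdivrMr// mul1r ltW.
    have : 0 <= `|cos (th x)| / e by rewrite divr_ge0// ltW.
    by move=> h1 h2; rewrite -lerBrDl; apply: (le_trans (exprn_ile1 _ h1 h2)); lra.
  have hq : 3 / 8 / e <= sin (th x) ^+ 2 / (e * (1 + (cos (th x) / e) ^+ 2)).
    rewrite ler_pdivlMr ?mulr_gt0//.
    have -> : 3 / 8 / e * (e * (1 + (cos (th x) / e) ^+ 2)) = 3 / 8 * (1 + (cos (th x) / e) ^+ 2) by field.
    lra.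
  have -> : k = C^-1 * (3 / 8 / e) by have C1 := lt0r_neq0 C0; rewrite /k; field; rewrite C1 e1.
  apply: ler_pM; rewrite ?invr_ge0 ?(ltW C0)//.
    by rewrite divr_ge0// ltW.
  by have := at2 x; rewrite ler_norml => /andP[? ?]; lra.
split => //.
have lA : (k%:E * lebesgue_measure (A : set (measurableTypeR R)) <= (F 1 - F 0)%:E)%E.
  rewrite -(FTC_cc ler01 dF cf).
  have -> : (k%:E * lebesgue_measure (A : set (measurableTypeR R)) = \int[lebesgue_measure]_(x in I) (k%:E * (\1_A x)%:E))%E.
    rewrite ge0_integralZl//.
    - by rewrite integral_indic//; congr (_ * lebesgue_measure _)%E; apply/seteqP; split=> x //=; [move=> Ax; split => //; rewrite /I/= in_itv; exact: AI|case].
    - by apply: measurableT_comp => //; apply: measurable_funTS; exact: measurable_indic.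
    - by rewrite lee_fin ltW.
  apply: ge0_le_integral => //.
  - by move=> x _; rewrite mule_ge0// lee_fin ?ltW.
  - apply: emeasurable_funM; first exact: measurable_cst.
    by apply: measurableT_comp => //; apply: measurable_funTS; exact: measurable_indic.
  - by apply: measurableT_comp => //; apply: measurable_funTS; exact: continuous_measurable_fun.
  - move=> x _; rewrite -EFinM lee_fin indicE.
    by have [/set_mem/fA|_] := boolP (x \in A); rewrite ?mulr1 ?mulr0.
have FF : F 1 - F 0 <= pi + pi / 2 * C.
  have b x : `|atan (cos (th x) / e) * (sin (th x) / M)| <= pi / 2.
    rewrite normrM -[leRHS]mulr1; apply: ler_pM => //.
      by rewrite ler_norml (ltW (atan_gtNpi2 _)) (ltW (atan_ltpi2 _)).
    rewrite normrM (gtr0_norm (_ : 0 < M^-1)) ?invr_gt0// mulr_ile1 ?invr_ge0 ?(ltW M0) ?invf_le1//.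
    by rewrite ler_norml sin_geN1 sin_le1.
  have : pi / 2 * (Y 1 - Y 0) <= pi / 2 * C by apply: ler_wpM2l => //; rewrite divr_ge0 ?pi_ge0.
  have := b 1; have := b 0; rewrite /F !ler_norml => /andP[? ?] /andP[? ?].
  by rewrite mulrBr; lra.
have : (k%:E * lebesgue_measure (A : set (measurableTypeR R)) <= (pi + pi / 2 * C)%:E)%E.
  by apply: (le_trans lA); rewrite lee_fin.
rewrite -lee_pdivlMl// -EFinM => h; apply: (le_trans h); rewrite lee_fin.
have -> : k^-1 = 8 / 3 * C * e by have C1 := lt0r_neq0 C0; rewrite /k; field; rewrite C1 e1.
by rewrite mulrAC.
Qed.

Definition unit_square : set (R * R) := [set p | 0 <= p.1 <= 1 /\ 0 <= p.2 <= 1].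

Definition resonant2 (th : R * R -> R) (e : R) : set (R * R) :=
  [set p | unit_square p /\ `|cos (th p)| < e].

(** The bound does not depend on [M], so the frequency may be chosen after the width [e]. The shift
    [c] serves to treat [|sin|] as well as [|cos|]. *)
Lemma phase_measure (s : flow) (C M c e : R) : flow_ok s C -> 1 <= M -> 0 < e ->
  e <= 1 / 2 ->
  let A : set (plane R) := resonant2 (fun p => M * fY s p + c) e in
  measurable A /\ (leb2 A <= (8 / 3 * C * (pi + pi / 2 * C) * e)%:E)%E.
Proof.
move=> sok M1 e0 e2 A; have [[_ hY _] rel bnd lenY] := sok.
have [cY _ _ _] := hY.
have C0 : 0 < C.
  by have [j _ _] := bnd (0, 0); apply: lt_le_trans j; have [_ ? _ _] := rel (0, 0).
have mA : measurable A.
  have cc (r : R) : continuous (fun _ : R * R => r) by move=> ?; exact: cvg_cst.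
  have cf : continuous (fun p => cos (M * fY s p + c)).
    by apply: continuous_compf; [exact: (continuousDf (continuousMf (cc _) cY) (cc _))|exact: continuous_cos].
  rewrite (_ : A = (`[0, 1]%classic `*` `[0, 1]%classic) `&` (fun p => cos (M * fY s p + c)) @^-1` [set y | `|y| < e]); last first.
    by apply/seteqP; split=> p; rewrite /A /resonant2 /unit_square/= !in_itv.
  apply: measurableI; first by apply: measurableX; exact: measurable_itv.
  apply: open_borel2; apply: open_comp; first by move=> x _; exact: cf.
  have -> : [set y : R | `|y| < e] = ball (0 : R) e.
    by apply/seteqP; split=> y; rewrite /ball/= sub0r normrN.
  exact: ball_open.
split => //.
have K0 : 0 <= 8 / 3 * C * (pi + pi / 2 * C) * e.
  have p0 := @pi_ge0 R; have := ltW C0 => C0'.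
  by rewrite !mulr_ge0 ?(ltW e0)// addr_ge0// !mulr_ge0.
have := @leb2_le_slices R A 0 1 _ ler01 K0 mA.
rewrite subr0 mulr1; apply; first by move=> p [[]].
move=> t.
have dY x : is_derive x (1 : R) (fun x => fY s (t, x)) (fYx s (t, x)) := has_grad_slice2 t x hY.
have cYx : continuous (fun x => fYx s (t, x)).
  have [_ _ c2 _] := hY.
  by move=> x; apply: (@continuous_comp _ _ _ (fun x => (t, x)) (fYx s)); [exact: continuous_pairr|exact: c2].
have hC x : C^-1 <= fYx s (t, x).
  have [jy j0 _ _] := rel (t, x); have [jC _ _] := bnd (t, x).
  have -> : fYx s (t, x) = (fJ s (t, x))^-1 by rewrite -[LHS](mulKf (lt0r_neq0 j0)) jy mulr1.
  by rewrite lef_pV2.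
have [mS hS] := phase_slice c dY cYx M1 e0 e2 C0 hC (lenY t).
apply: le_trans hS; apply: le_measure; rewrite ?inE//.
  exact: measurable_xsection.
by move=> x; rewrite /xsection/= => /set_mem[[_ ?] ?].
Qed.

End phase.

(** * One squeezing step *)

Section squeezing_step.
Context {R : realType}.

Lemma C2b_le (w w1 w2 : R -> R) (B B' : R) : B <= B' -> C2b w w1 w2 B -> C2b w w1 w2 B'.
Proof.
move=> BB' [h1 h2 h3 h4]; split => // z; have [x0 x1 x2] := h4 z.
by split; apply: le_trans BB'.
Qed.

Lemma time_cutoffs (r eps : R) : 0 < eps -> exists qA qA1 qA2 qB qB1 qB2 B,
  [/\ C2b qA qA1 qA2 B /\ C2b qB qB1 qB2 B,
     forall t, 0 <= qA t <= 1 /\ 0 <= qB t <= 1,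
     forall t, t <= r -> qB t = 0, forall t, r <= t -> qA t = 0 &
     (forall t, t <= r - eps -> qA t = 1) /\ (forall t, r + eps <= t -> qB t = 1)].
Proof.
move=> e0; have [s2 [Bs hs]] := @C2b_step R.
have hA := C2b_affine (- eps^-1) (r / eps) hs.
have hB := C2b_affine (eps^-1) (- (r / eps)) hs.
have i0 : 0 < eps^-1 by rewrite invr_gt0.
have A0 := C2b_ge0 hA; have B0 := C2b_ge0 hB.
have eA t : - eps^-1 * t + r / eps = (r - t) / eps by ring.
have eB t : eps^-1 * t - r / eps = (t - r) / eps by ring.
have hA' := C2b_le (_ : _ <= (1 + `|- eps^-1|) ^+ 2 * Bs + (1 + `|eps^-1|) ^+ 2 * Bs) hA.
have hB' := C2b_le (_ : _ <= (1 + `|- eps^-1|) ^+ 2 * Bs + (1 + `|eps^-1|) ^+ 2 * Bs) hB.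
do 7 eexists; split.
- by split; [apply: hA'; rewrite lerDl|apply: hB'; rewrite lerDr].
- by move=> t; rewrite /= !step_ge0 !step_le1.
- by move=> t tr /=; rewrite eB step_le0// pmulr_lle0// subr_le0.
- by move=> t tr /=; rewrite eA step_le0// pmulr_lle0// subr_le0.
- split=> t tr /=; [rewrite eA|rewrite eB]; rewrite step_ge1// ler_pdivlMr// mul1r; lra.
Qed.

(* [phases l Y] collects the points of the square where the squeezing maps used
   so far are not forced to be the identity, and [pattern] the points where the
   last one has moved the phase [N Y] near [pi] (before time [r]) or [0] (after
   time [r]), modulo [2 pi]. *)
Definition phases (l : seq R) (Y : R * R -> R) : set (R * R) :=
  [set p | unit_square p /\ forall M, M \in l -> 0 <= cos (2 * M * Y p)].

Definition pattern (r eps N : R) (Y : R * R -> R) : set (R * R) :=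
  [set p | (p.1 <= r - eps /\ cos (N * Y p) <= 0 /\ 0 <= cos (2 * N * Y p)) \/
           (r + eps <= p.1 /\ 0 <= cos (N * Y p) /\ 0 <= cos (2 * N * Y p))].

Lemma measurable_unit_square : measurable (unit_square : set (plane R)).
Proof.
rewrite (_ : unit_square = `[0, 1]%classic `*` `[0, 1]%classic); last first.
  by apply/seteqP; split=> p; rewrite /unit_square/= !in_itv.
by apply: measurableX; exact: measurable_itv.
Qed.

Lemma closed_nonneg (f : R * R -> R) : continuous f -> closed [set p | 0 <= f p].
Proof. by move=> cf; apply: (@closed_comp _ _ f [set x | 0 <= x]) => [p _|]; [exact: cf|exact: closed_ge]. Qed.

Lemma continuous_phase (Y : R * R -> R) (M : R) : continuous Y ->
  continuous (fun p => cos (M * Y p)).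
Proof.
move=> cY; apply: continuous_compf; last exact: continuous_cos.
by apply: continuousMf => // ?; exact: cvg_cst.
Qed.

Lemma measurable_phases (l : seq R) (Y : R * R -> R) : continuous Y ->
  measurable (phases l Y : set (plane R)).
Proof.
move=> cY; elim: l => [|M l IH].
  rewrite (_ : phases [::] Y = unit_square); first exact: measurable_unit_square.
  by apply/seteqP; split=> p; [case|split].
rewrite (_ : phases _ _ = phases l Y `&` [set p | 0 <= cos (2 * M * Y p)]).
  apply: measurableI => //; apply: closed_borel2; apply: closed_nonneg; exact: continuous_phase.
apply/seteqP; split=> p.
  move=> [up h]; split; last by apply: h; rewrite mem_head.
  by split => // M' M'l; apply: h; rewrite in_cons M'l orbT.
by move=> [[up h] hM]; split => // M'; rewrite in_cons => /predU1P[->//|]; exact: h.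
Qed.

Lemma closed_pattern (r eps N : R) (Y : R * R -> R) : continuous Y ->
  closed (pattern r eps N Y).
Proof.
move=> cY; have c1 := continuous_phase (M := N) cY; have c2 := continuous_phase (M := 2 * N) cY.
have cc (c : R) : continuous (fun _ : R * R => c) by move=> ?; exact: cvg_cst.
have cf : continuous (fun p : R * R => p.1) by move=> ?; exact: cvg_fst.
have cN : continuous (fun p => 0 - cos (N * Y p)) by exact: continuousBf.
have ct1 : continuous (fun p : R * R => r - eps - p.1) by exact: continuousBf.
have ct2 : continuous (fun p : R * R => p.1 - (r + eps)) by exact: continuousBf.
rewrite (_ : pattern r eps N Y =
  ([set p | 0 <= r - eps - p.1] `&` ([set p | 0 <= 0 - cos (N * Y p)] `&` [set p | 0 <= cos (2 * N * Y p)])) `|`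
  ([set p | 0 <= p.1 - (r + eps)] `&` ([set p | 0 <= cos (N * Y p)] `&` [set p | 0 <= cos (2 * N * Y p)]))).
  by apply: closedU; apply: closedI; [|apply: closedI| |apply: closedI]; exact: closed_nonneg.
by apply/seteqP; split=> p; rewrite /pattern/= !subr_ge0.
Qed.

Lemma leb2U (A B : set (plane R)) (a b : R) :
  measurable A /\ (leb2 A <= a%:E)%E -> measurable B /\ (leb2 B <= b%:E)%E ->
  measurable (A `|` B) /\ (leb2 (A `|` B) <= (a + b)%:E)%E.
Proof.
move=> [mA hA] [mB hB]; split; first exact: measurableU.
have h := @measureU2 _ _ _ (@leb2 R) A B mA mB.
by apply: (le_trans h); rewrite EFinD; exact: leeD.
Qed.

Lemma resonances_measure (s : flow) (C e : R) (l : seq R) : flow_ok s C ->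
  0 < e -> e <= 1 / 2 -> (forall M, M \in l -> 1 <= M) ->
  let A : set (plane R) := [set p | unit_square p /\
    exists2 M, M \in l & `|cos (2 * M * fY s p)| < e] in
  measurable A /\
  (leb2 A <= ((size l)%:R * (8 / 3 * C * (pi + pi / 2 * C) * e))%:E)%E.
Proof.
move=> sok e0 e2; elim: l => [|M l IH] hl.
  move=> A; have -> : A = set0 by apply/seteqP; split => // p [_ [M]].
  by split; [exact: measurable0|rewrite measure0 mul0r].
have [|mA hA] := IH; first by move=> M' M'l; apply: hl; rewrite in_cons M'l orbT.
set A := [set p | _] in mA hA.
have M1 : 1 <= 2 * M by have := hl M (mem_head _ _); lra.
have [mB hB] := phase_measure 0 sok M1 e0 e2.
set B := resonant2 _ _ in mB hB.
move=> X; have -> : X = (B : set (plane R)) `|` A.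
  apply/seteqP; split=> p.
    move=> [up [M']]; rewrite in_cons => /predU1P[->|M'l] hM; last by right; split => //; exists M'.
    by left; split => //; rewrite addr0.
  case=> [[up hM]|[up [M' M'l hM]]]; split => //.
    by exists M; [exact: mem_head|move: hM; rewrite addr0].
  by exists M' => //; rewrite in_cons M'l orbT.
have [mU hU] := leb2U (conj mB hB) (conj mA hA).
split; [exact: mU|apply: (le_trans hU)]; rewrite lee_fin /= -natr1 le_eqVlt.
by apply/orP; left; apply/eqP; ring.
Qed.

(** The third clause freezes phase and velocity on the protected bands. The fourth keeps the points
    outside these bands outside them, so that the nonnegative cosines obtained at one step are still
    available at all later ones. *)
Definition good_step (l : seq R) (eta : R) (s s' : flow) (r N eps : R) : Prop :=
  [/\ 1 <= N /\ 0 < eps,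
      forall p, `|fu s' p - fu s p| <= eta /\ `|fg s' p - fg s p| <= eta,
      forall p M, M \in l -> cos (2 * M * fY s p) <= 0 ->
        fY s' p = fY s p /\ fu s' p = fu s p,
      forall p, (forall M, M \in l -> 0 <= cos (2 * M * fY s p)) ->
        forall M, M \in l -> 0 <= cos (2 * M * fY s' p) &
      (leb2 (phases l (fY s) `\` pattern r eps N (fY s') : set (plane R)) <= eta%:E)%E].

(* The resonances, the strip [|t - r| < eps] and the cutoff cost a set of small
   measure independent of [N], which is chosen last. *)
Lemma squeezing_step (s : flow) (C : R) (l : seq R) (r eta : R) : flow_ok s C ->
  0 < eta -> (forall M, M \in l -> 1 <= M) ->
  exists s' C' N eps, flow_ok s' C' /\ good_step l eta s s' r N eps.
Proof.
move=> sok eta0 hl; have [_ rel bnd _] := sok.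
have C0 : 0 < C.
  by have [j _ _] := bnd (0, 0); apply: lt_le_trans j; have [_ ? _ _] := rel (0, 0).
pose K := 8 / 3 * C * (pi + pi / 2 * C).
have K0 : 0 <= K.
  have p0 := @pi_ge0 R; have C0' := ltW C0.
  by rewrite /K; repeat first [assumption | exact: ler0n | apply: addr_ge0 | apply: mulr_ge0 | rewrite invr_ge0].
pose S : R := (size l).+1%:R.
have S0 : 0 < S by rewrite ltr0n.
(* [S] counts the old frequencies and the new one: all resonances together take at most [eta / 2],
   and the strip of half-width [eps = eta / 4] takes the other half. *)
pose e := Num.min (1 / 2) (eta / (2 * S * (K + 1))).
have K1 : 0 < K + 1 by rewrite ltr_wpDl.
have e0 : 0 < e by rewrite lt_min; apply/andP; split => //; rewrite divr_gt0// !mulr_gt0.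
have e2 : e <= 1 / 2 by rewrite ge_min lexx.
have SKe : S * (K * e) <= eta / 2.
  have : e <= eta / (2 * S * (K + 1)) by rewrite ge_min lexx orbT.
  rewrite ler_pdivlMr ?mulr_gt0// => h.
  have : 0 <= e * S by rewrite mulr_ge0// ltW.
  by move: h; clear; clearbody e S K; lra.
pose eps := eta / 4.
have eps0 : 0 < eps by rewrite divr_gt0.
(* Where [|sin| >= e], the identity [sin^2 = (1 - cos) (1 + cos)] gives [1 - cos >= e^2 / 2], the
   hypothesis of the squeezing estimate. *)
pose d := e ^+ 2 / 2.
have d0 : 0 < d by rewrite divr_gt0// exprn_gt0.
have d1 : d <= 1.
  have : e ^+ 2 <= 1 by rewrite exprn_ile1// ?ltW//; lra.
  by rewrite /d; lra.
have b1 : 1 < 1 + d ^+ 2 / 7 by rewrite ltrDl divr_gt0// exprn_gt0.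
have [k [k1 [k2 [Ak [hk k01 kz k1E]]]]] := cutoff_exists l e0.
have [Bp hp] := C2b_profile b1.
set b := 1 + d ^+ 2 / 7 in b1 hp.
have [qA [qA1 [qA2 [qB [qB1 [qB2 [Bq [[hqA hqB] q01 qBz qAz [qA1E qB1E]]]]]]]]] := time_cutoffs r eps0.
have Ak0 := C2b_ge0 hk; have Bp0 := C2b_ge0 hp; have Bq0 := C2b_ge0 hqA.
have AB0 : 0 <= Ak * Bp by rewrite mulr_ge0.
(* The terms bound the time factors, the first derivative of the oscillation, and
   [a * D = 4 * (Ak * Bp) ^+ 2]. None involves [N], so [K2] is known before [N] is chosen. *)
pose B := Bq + 4 * (Ak * Bp) + 4 * (Ak * Bp) ^+ 2.
have BqB : Bq <= B by rewrite /B -addrA lerDl addr_ge0 ?mulr_ge0 ?sqr_ge0.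
have ABB : 4 * (Ak * Bp) <= B by rewrite /B addrAC lerDr addr_ge0 ?mulr_ge0 ?sqr_ge0.
have ABB2 : 4 * (Ak * Bp) ^+ 2 <= B by rewrite /B lerDr addr_ge0 ?mulr_ge0.
have B0 : 0 <= B by apply: le_trans BqB.
pose mk N := Squeeze qA qA1 qA2 (osc k (profile b) N 0)
  (osc1 k k1 (profile b) (profile1 b) N 0)
  (osc2 k k1 k2 (profile b) (profile1 b) (profile2 b) N 0)
  qB qB1 qB2 (osc k (profile b) N pi)
  (osc1 k k1 (profile b) (profile1 b) N pi)
  (osc2 k k1 k2 (profile b) (profile1 b) (profile2 b) N pi).
have [K2 K20 hK2] := squeezed_ok B0 (ltW C0).
(* The summands ensure in turn [N >= 1], the slope bound [1/16] of [L] (and [a <= 1]), and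
   [a * K2 <= eta]. *)
pose N := 1 + 16 * (Ak * Bp) + Ak * Bp * K2 / eta.
have ABK : 0 <= Ak * Bp * K2 / eta by rewrite divr_ge0 ?mulr_ge0// ltW.
have N1 : 1 <= N by rewrite /N -addrA lerDl addr_ge0// mulr_ge0.
have N0 : 0 < N by exact: lt_le_trans N1.
have N16 : 16 * (Ak * Bp) <= N by rewrite /N addrAC lerDr addr_ge0.
have [dA dA1 cA2 bA] := osc_C2 0 N1 hk hp.
have [dB dB1 cB2 bB] := osc_C2 pi N1 hk hp.
pose a := Ak * Bp / N; pose D := 4 * (Ak * Bp) * N.
have qok : squeeze_ok (mk N) a B D.
  split; [exact: C2b_le hqA|exact: C2b_le hqB| | |].
  - split => // z; have [x0 x1 x2] := bA z; split => //; exact: le_trans ABB.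
  - split => // z; have [x0 x1 x2] := bB z; split => //; exact: le_trans ABB.
  split.
  - by rewrite /a divr_ge0// ltW.
  - rewrite /a ler_pdivrMr// mul1r; apply: le_trans N16; by rewrite ler_peMl// ler1n.
  - by rewrite (_ : a * D = 4 * (Ak * Bp) ^+ 2)// /a /D; field; rewrite gt_eqF.
  move=> [t z]; rewrite /sLz/=.
  have [/andP[qa0 qa1] /andP[qb0 qb1]] := q01 t.
  have wA1 := osc1_ge hk hp (k01 z) (profile1_ge b1 (N * z + 0)) N1 N16.
  have wB1 := osc1_ge hk hp (k01 z) (profile1_ge b1 (N * z + pi)) N1 N16.
  have aux (q w : R) : 0 <= q -> q <= 1 -> - (15 / 16) <= w -> 1 / 16 <= 1 + q * w by move=> *; nra.
  by case: (leP t r) => [/qBz ->|/ltW/qAz ->]; rewrite mul0r ?addr0 ?add0r; exact: aux.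
have [C' [s'ok s'b]] := hK2 _ _ _ _ qok sok.
exists (squeezed (mk N) s), C', N, eps; split => //.
have aK : a * K2 <= eta.
  rewrite /a mulrAC ler_pdivrMr// -ler_pdivrMl// mulrC.
  by rewrite /N lerDr addr_ge0// mulr_ge0.
have fix_k p : k (fY s p) = 0 -> fY (squeezed (mk N) s) p = fY s p /\ fu (squeezed (mk N) s) p = fu s p.
  move=> kp0; rewrite /= /sL /sLt /= /osc kp0 !mul0r !mulr0 !addr0; split => //.
  by rewrite mul0r mul0r mulr0 subr0.
split.
- by split.
- by move=> p; have [h1 h2] := s'b p; split; [exact: le_trans h1 aK|exact: le_trans h2 aK].
- by move=> p M Ml cM; apply: fix_k; exact: (kz _ M).
(* If the new phase were inside a protected band, [L] would fix it; by injectivity of [L] the old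
   phase would be the same point, against the assumption. *)
- move=> p hp0 M Ml; rewrite leNgt; apply/negP => cM.
  have k0 := kz _ M Ml (ltW cM).
  have h : sL (mk N) (p.1, fY (squeezed (mk N) s) p) = fY (squeezed (mk N) s) p.
    by rewrite {1}/sL /= /osc k0 !mul0r !mulr0 !addr0.
  have e' : fY (squeezed (mk N) s) p = fY s p by apply: (sL_inj qok) h.
  by have := hp0 M Ml; rewrite -e' leNgt cM.
(* Away from the strip and the resonances, [k] is 1, one time factor is 1 and the other is 0: the
   full profile acts. The shift [pi / 2] turns the resonance condition into a lower bound on
   [|sin (N * fY)|]. *)
have half_sub : forall p, unit_square p -> ~ `|cos (N * fY s p + pi / 2)| < e ->
    (forall M, M \in l -> e <= cos (2 * M * fY s p)) -> ~ (r - eps < p.1 < r + eps) ->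
    pattern r eps N (fY (squeezed (mk N) s)) p.
  move=> p _; rewrite cosDpihalf normrN => /negP; rewrite -leNgt => hsin hcos htime.
  have kp := k1E _ hcos.
  have good phi : sin phi ^+ 2 = sin (N * fY s p) ^+ 2 -> d <= 1 - cos phi.
    move=> sE; have s2 := sin2cos2 phi; have c1 := cos_le1 phi; have c0 := cos_geN1 phi.
    have : e ^+ 2 <= sin phi ^+ 2.
      by rewrite sE -[leRHS]real_normK ?num_real// lerXn2r ?nnegrE// ltW.
    by rewrite s2 /d; nra.
  rewrite /pattern /= /sL /= /osc kp !mul1r addr0.
  have /orP[tl|tr] : (p.1 <= r - eps) || (r + eps <= p.1).
    case: (leP p.1 (r - eps)) => //= h1; case: (leP (r + eps) p.1) => // h2.
    by case: htime; rewrite h1 h2.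
  - left; split => //; rewrite qA1E// qBz ?mul1r ?mul0r ?addr0; last by apply: (le_trans tl); rewrite gerBl ltW.
    have [h1 h2] := profile_squeeze d0 d1 (good (N * fY s p) erefl).
    have -> : 2 * N * (fY s p + N^-1 * profile b (N * fY s p)) = 2 * (N * fY s p + profile b (N * fY s p)).
      by field; rewrite gt_eqF.
    have -> : N * (fY s p + N^-1 * profile b (N * fY s p)) = N * fY s p + profile b (N * fY s p).
      by field; rewrite gt_eqF.
    by split.
  (* After time [r] the profile is applied to [N * fY + pi]. It brings this phase near [pi], hence
     the phase [N * fY] near 0. *)
  - right; split => //; rewrite qB1E// qAz ?mul1r ?mul0r ?add0r; last by apply: le_trans tr; rewrite lerDl ltW.
    have gpi : d <= 1 - cos (N * fY s p + pi) by apply: good; rewrite sinDpi sqrrN.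
    have [h1 h2] := profile_squeeze d0 d1 gpi.
    set psi := N * fY s p + pi + _ in h1 h2.
    have -> : 2 * N * (fY s p + N^-1 * profile b (N * fY s p + pi)) = 2 * (psi - pi).
      by rewrite /psi; field; rewrite gt_eqF.
    have -> : N * (fY s p + N^-1 * profile b (N * fY s p + pi)) = psi - pi.
      by rewrite /psi; field; rewrite gt_eqF.
    split.
      by have := cosDpi (psi - pi); rewrite subrK => h; rewrite -oppr_le0 -h.
    have := cosD2pi (2 * (psi - pi)).
    have -> : 2 * (psi - pi) + pi *+ 2 = 2 * psi by rewrite -mulr_natl; ring.
    by move=> <-.
have [mN hN] := phase_measure (pi / 2) sok N1 e0 e2.
have [mR hR] := resonances_measure sok e0 e2 hl.
set RN := resonant2 _ _ in mN hN; set RR := [set p | _] in mR hR.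
pose strip : set (plane R) := `[r - eps, r + eps]%classic `*` `[0, 1]%classic.
have mstrip : measurable strip by apply: measurableX; exact: measurable_itv.
have [[_ [cY _ _ _] _] _ _ _] := sok.
have [[_ [cY' _ _ _] _] _ _ _] := s'ok.
have mD : measurable (phases l (fY s) `\` pattern r eps N (fY (squeezed (mk N) s)) : set (plane R)).
  by apply: measurableD; [exact: measurable_phases|apply: closed_borel2; exact: closed_pattern].
have sub : phases l (fY s) `\` pattern r eps N (fY (squeezed (mk N) s)) `<=` (strip `|` RR) `|` RN.
  move=> p [[up hp0] np]; apply: contrapT => nh; apply: np; apply: half_sub => //.
  - by move=> h; apply: nh; right.
  - move=> M Ml; rewrite leNgt; apply/negP => hM; apply: nh; left; right; split => //.
    by exists M => //; rewrite ger0_norm ?hp0.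
  - move=> /andP[h1 h2]; apply: nh; left; left; rewrite /strip/=; have [_ u2] := up.
    by rewrite !in_itv/= (ltW h1) (ltW h2).
have hs : (leb2 strip <= (2 * eps)%:E)%E.
  have ree : r - eps <= r + eps by lra.
  rewrite (leb2_box ree ler01) lee_fin subr0 mulr1.
  by rewrite (_ : r + eps - (r - eps) = 2 * eps)//; ring.
have [mU hU] := leb2U (leb2U (conj mstrip hs) (conj mR hR)) (conj mN hN).
apply: (@le_trans _ _ (leb2 ((strip `|` RR) `|` RN))).
  by apply: le_measure; rewrite ?inE.
apply: (le_trans hU); rewrite lee_fin -/K.
have -> : 2 * eps + (size l)%:R * (K * e) + K * e = 2 * eps + S * (K * e) by rewrite /S -natr1; ring.
by rewrite /eps; lra.
Qed.

End squeezing_step.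

(** * The balance law of a flow and convergence of the sequence *)

Section flow_balance.
Context {R : realType}.

Lemma integral_dt_zero (f : R * R -> R) (F : R * R -> R) (B : R) :
  continuous f -> (forall t x, is_derive t (1 : R) (fun s => F (s, x)) (f (t, x))) ->
  (forall p, B < `|p| -> F p = 0 /\ f p = 0) ->
  leb2.-integrable setT (fun p => (f p)%:E) /\ (\int[leb2]_p (f p)%:E = 0)%E.
Proof.
move=> cf dF h0.
have f0 p : B < `|p| -> f p = 0 by move=> /h0[].
have [M M0 hM] := continuous_supp_bounded (@compact_ball2 R B) cf f0.
have nB (t x : R) : B < `|t| \/ B < `|x| -> B < `|((t, x) : R * R)|.
  by move=> h; rewrite prod_normE lt_max; apply/orP.
have i_f : leb2.-integrable setT (fun p => (f p)%:E).
  apply: (@integrable2_bounded _ _ B M); [exact: continuous_borel2|exact: hM|].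
  by move=> [t x] /nB/f0.
split => //; rewrite -(integral21_prod_meas1 i_f).
rewrite (eq_integral (cst 0%E)) ?integral0// => x _; rewrite /fubini_G /=.
apply: (@FTC_supp _ (fun t => F (t, x)) (fun t => f (t, x)) B) => //.
  move=> t; apply: (@continuous_comp _ _ _ (fun t => (t, x)) f); [exact: continuous_pairl|exact: cf].
by move=> t Bt; apply: h0; apply: nB; left.
Qed.

Lemma integral_dx_zero (f : R * R -> R) (F : R * R -> R) (B : R) :
  continuous f -> (forall t x, is_derive x (1 : R) (fun s => F (t, s)) (f (t, x))) ->
  (forall p, B < `|p| -> F p = 0 /\ f p = 0) ->
  leb2.-integrable setT (fun p => (f p)%:E) /\ (\int[leb2]_p (f p)%:E = 0)%E.
Proof.
move=> cf dF h0.
have f0 p : B < `|p| -> f p = 0 by move=> /h0[].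
have [M M0 hM] := continuous_supp_bounded (@compact_ball2 R B) cf f0.
have nB (t x : R) : B < `|t| \/ B < `|x| -> B < `|((t, x) : R * R)|.
  by move=> h; rewrite prod_normE lt_max; apply/orP.
have i_f : leb2.-integrable setT (fun p => (f p)%:E).
  apply: (@integrable2_bounded _ _ B M); [exact: continuous_borel2|exact: hM|].
  by move=> [t x] /nB/f0.
split => //; rewrite -(integral12_prod_meas1 i_f).
rewrite (eq_integral (cst 0%E)) ?integral0// => t _; rewrite /fubini_F /=.
apply: (@FTC_supp _ (fun x => F (t, x)) (fun x => f (t, x)) B) => //.
  move=> x; apply: (@continuous_comp _ _ _ (fun x => (t, x)) f); [exact: continuous_pairr|exact: cf].
by move=> x Bx; apply: h0; apply: nB; right.
Qed.

Lemma continuous_fg (s : @flow R) (C : R) : flow_ok s C -> continuous (fg s).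
Proof.
move=> [[[c1 c2 c3 _] _ _] _ _ _].
have cc : continuous (fun _ : R * R => 2 : R) by move=> ?; exact: cvg_cst.
exact: (continuousDf c2 (continuousMf (continuousMf cc c1) c3)).
Qed.

Lemma flow_balance (s : @flow R) (C : R) : flow_ok s C -> balance_law (fu s) (fg s).
Proof.
move=> [[hu _ _] _ _ _] phi tphi.
have [cu cut cux _] := hu.
have [cphi [c1 d1]] := @test_function_derive R (R * R)%type phi (1, 0) tphi.
have [_ [c2 d2]] := @test_function_derive R (R * R)%type phi (0, 1) tphi.
have [B B0 hB] := test_function_support tphi.
have cc : continuous (fun _ : R * R => 2 : R) by move=> ?; exact: cvg_cst.
have phi0 p : B < `|p| -> [/\ phi p = 0, 'D_(1, 0) phi p = 0 & 'D_(0, 1) phi p = 0].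
  by move=> /hB h; rewrite !near0_derive//; split => //; exact: nbhs_singleton h.
pose f1 p := fu s p * 'D_(1, 0) phi p + phi p * fut s p.
pose f2 p := (fu s p * fu s p) * 'D_(0, 1) phi p + phi p * (2 * fu s p * fux s p).
have cf1 : continuous f1 by exact: (continuousDf (continuousMf cu c1) (continuousMf cphi cut)).
have cf2 : continuous f2.
  exact: (continuousDf (continuousMf (continuousMf cu cu) c2) (continuousMf cphi (continuousMf (continuousMf cc cu) cux))).
have [|p pB|i1 e1] := @integral_dt_zero f1 (fun p => fu s p * phi p) B cf1.
- move=> t x; have k := is_derive_slice1 (d1 (t, x)).
  exact: (is_deriveMf (has_grad_slice1 t x hu) k).
- by have [p0 pt _] := phi0 p pB; rewrite /f1 p0 pt !mulr0 mul0r addr0.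
have [|p pB|i2 e2] := @integral_dx_zero f2 (fun p => (fu s p * fu s p) * phi p) B cf2.
- move=> t x; have k := is_derive_slice2 (d2 (t, x)).
  have ku := has_grad_slice2 t x hu.
  apply: (is_derive_eq (is_deriveMf (is_deriveMf ku ku) k)).
  by rewrite /f2; ring.
- by have [p0 _ px] := phi0 p pB; rewrite /f2 p0 px !mulr0 mul0r addr0.
have e3 : (\int[leb2]_p ((f1 p)%:E + (f2 p)%:E) = 0)%E.
  by rewrite (integralD_EFin measurableT i1 i2) e1 e2 adde0.
rewrite -[RHS]e3; apply: eq_integral => p _; rewrite -EFinD; congr EFin.
by rewrite /f1 /f2 /fg /flux; ring.
Qed.

(* [tail n] is the sum of the [tail k.+1] over [k >= n]; [tail k.+1] bounds the
   [k]-th perturbation. *)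
Definition tail (n : nat) : R := 2^-1 ^+ n.+1.

Lemma tail_gt0 n : 0 < tail n. Proof. by rewrite exprn_gt0. Qed.

Lemma tailS n : tail n = tail n.+1 + tail n.+1.
Proof. by rewrite /tail [in RHS]exprS; field. Qed.

Lemma tail_small (e : R) : 0 < e -> exists n, tail n <= e.
Proof.
move=> e0; have : (fun n => (2^-1 : R) ^+ n) @ \oo --> (0 : R).
  by apply: cvg_expr; rewrite ger0_norm// invf_lt1// ltr1n.
move=> /cvgrPdist_le/(_ e e0)[n _ hn]; exists n.
have := hn n.+1 (leqnSn n); rewrite sub0r normrN; apply: le_trans; exact: ler_norm.
Qed.

(** [a n + tail n] is nonincreasing and bounded below, so convergence follows from monotonicity. *)
Lemma tail_limit (a : nat -> R) : (forall n, `|a n.+1 - a n| <= tail n.+1) ->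
  a @ \oo --> limn a /\ forall n, `|limn a - a n| <= tail n.
Proof.
move=> ha.
have hk n k : `|a (n + k)%N - a n| <= tail n - tail (n + k).
  elim: k => [|k IH]; first by rewrite addn0 !subrr normr0.
  rewrite addnS -[a _ - a n](subrKA (a (n + k)%N)); apply: (le_trans (ler_normD _ _)).
  by have := ha (n + k)%N; have := tailS (n + k); lra.
have cb : cvgn a.
  have -> : a = (fun n => (a n + tail n) - tail n) by apply/funext => n; rewrite addrK.
  apply: is_cvgB; last first.
    have -> : tail = (fun n => 2^-1 * (2^-1 : R) ^+ n) by apply/funext => n; rewrite /tail exprS.
    apply: is_cvgMr; apply/cvg_ex; exists 0; apply: cvg_expr.
    by rewrite ger0_norm// invf_lt1// ltr1n.
  apply: nonincreasing_is_cvgn.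
    apply/nonincreasing_seqP => n; have := ha n; have := tailS n.
    by rewrite ler_norml => ? /andP[? ?]; lra.
  exists (a 0 - tail 0) => _ [n _ <-].
  by have := hk 0 n; have := tail_gt0 n; rewrite add0n ler_norml => ? /andP[? ?]; lra.
split => // n.
have cn : (fun k => `|a k - a n|) @ \oo --> `|limn a - a n|.
  by apply: cvg_norm; apply: cvgB => //; exact: cvg_cst.
rewrite -(cvg_lim _ cn)//; apply: limr_le; first by apply/cvg_ex; eexists; exact: cn.
exists n => //= k nk; rewrite -(subnKC nk); apply: (le_trans (hk _ _)).
by have := tail_gt0 (n + (k - n)); lra.
Qed.

End flow_balance.

(** * The limit *)

Section limit_flow.
Context {R : realType}.

Definition flow0 : @flow R := Flow (fun=> 0) (fun=> 0) (fun=> 0)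
  snd (fun=> 0) (fun=> 1) (fun=> 1) (fun=> 0) (fun=> 0).

Lemma flow0_ok : flow_ok flow0 1.
Proof.
split => /=.
- by split; [exact: has_grad_cst|exact: has_grad_snd|exact: has_grad_cst].
- by move=> p; split => //; ring.
- by move=> p; rewrite normr0.
- by move=> t; rewrite subr0.
Qed.

Lemma flow_sequence : exists (s : nat -> @flow R) (l : nat -> seq R) (N eps : nat -> R),
  [/\ s 0%N = flow0, l 0%N = [::], forall n, l n.+1 = N n :: l n,
    forall n, exists C, flow_ok (s n) C &
    forall n, good_step (l n) (tail n.+1) (s n) (s n.+1) (rat_seq n) (N n) (eps n)].
Proof.
pose inv (x : @flow R * seq R) := (exists C, flow_ok x.1 C) /\ forall M, M \in x.2 -> 1 <= M.
(* The invariant is a premise inside the existential, so that [choice] applies to all states, with a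
   dummy answer for bad ones. The recursion visits only states satisfying it. *)
have h (z : nat * (@flow R * seq R)) : exists y : @flow R * (R * R), inv z.2 ->
    (exists C, flow_ok y.1 C) /\
    good_step z.2.2 (tail z.1.+1) z.2.1 y.1 (rat_seq z.1) y.2.1 y.2.2.
  have [[[C sok] hl]|ninv] := pselect (inv z.2); last by exists (flow0, (0, 0)).
  have [s' [C' [N [eps [sok' st]]]]] := squeezing_step (rat_seq z.1) sok (tail_gt0 z.1.+1) hl.
  by exists (s', (N, eps)) => _; split => //; exists C'.
have [F hF] := choice h.
pose st := fix st n : @flow R * seq R := if n is m.+1 then
  let y := F (m, st m) in (y.1, y.2.1 :: (st m).2) else (flow0, [::]).
have inv_st n : inv (st n).
  elim: n => [|n IH]; first by split; [exists 1; exact: flow0_ok|].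
  have [h1 [[N1 _] _ _ _ _]] := hF (n, st n) IH; have [_ hl] := IH.
  by split => //= M; rewrite in_cons => /predU1P[->//|]; exact: hl.
exists (fun n => (st n).1), (fun n => (st n).2), (fun n => (F (n, st n)).2.1), (fun n => (F (n, st n)).2.2).
split => // n; first by have [] := inv_st n.
by have [_] := hF (n, st n) (inv_st n).
Qed.

End limit_flow.

Section C1_on_limits.
Context {R : realType}.

(** A difference quotient with a limit stays bounded, which gives continuity relative to [I]. The
    filter is general so that the lemma serves for both one-sided limits. *)
Lemma C1_on_cvg (I : set R) (gamma dgamma : R -> R) (t : R) (F : set_system R)
    {FF : Filter F} : C1_on I gamma dgamma -> I t ->
  (forall A, within I t^' A -> F A) -> gamma x @[x --> F] --> gamma t.
Proof.
move=> [dg _] It sub; apply/cvgrPdist_le => e e0; apply: sub.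
have /cvgrPdist_le/(_ 1 ltr01) := dg t It.
pose r := e / (`|dgamma t| + 1).
have d1 : 0 < `|dgamma t| + 1 by rewrite ltr_wpDl.
have r0 : 0 < r by rewrite divr_gt0.
move=> h1; have {}h1 : nbhs t (fun x => x != t -> I x ->
  `|dgamma t - (gamma x - gamma t) / (x - t)| <= 1) by exact: h1.
have h2 : nbhs t (fun x : R => `|t - x| < r) by apply/nbhs_ballP; exists r.
change (nbhs t (fun x => x != t -> I x -> `|gamma t - gamma x| <= e)).
move: h1 h2; apply: filterS2 => x {}h1 h2 xt Ix.
have := h1 xt Ix; set k := _ / _ => hk.
have x0 : x - t != 0 by rewrite subr_eq0.
have kE : gamma x - gamma t = k * (x - t) by rewrite /k mulfVK.
rewrite distrC kE normrM (distrC x).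
have kb : `|k| <= `|dgamma t| + 1.
  have -> : k = dgamma t - (dgamma t - k) by ring.
  by apply: (le_trans (ler_normB _ _)); rewrite lerD2l.
have -> : e = (`|dgamma t| + 1) * r by rewrite /r mulrC divfK// gt_eqF.
by apply: ler_pM => //; exact: ltW.
Qed.

End C1_on_limits.

Section limit.
Context {R : realType}.
Variables (s : nat -> @flow R) (l : nat -> seq R) (N eps : nat -> R).
Hypotheses (s0 : s 0%N = flow0) (l0 : l 0%N = [::]) (lS : forall n, l n.+1 = N n :: l n)
  (sok : forall n, exists C, flow_ok (s n) C)
  (hs : forall n, good_step (l n) (tail n.+1) (s n) (s n.+1) (rat_seq n) (N n) (eps n)).

Definition lim_u (p : R * R) : R := limn (fun n => fu (s n) p).
Definition lim_g (p : R * R) : R := limn (fun n => fg (s n) p).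

Lemma lim_u_near p :
  (fun n => fu (s n) p) @ \oo --> lim_u p /\ forall n, `|lim_u p - fu (s n) p| <= tail n.
Proof. by apply: tail_limit => n; have [_ /(_ p)[]] := hs n. Qed.

Lemma lim_g_near p :
  (fun n => fg (s n) p) @ \oo --> lim_g p /\ forall n, `|lim_g p - fg (s n) p| <= tail n.
Proof. by apply: tail_limit => n; have [_ /(_ p)[]] := hs n. Qed.

Lemma continuous_fu n : continuous (fu (s n)).
Proof. by have [C [[[c _ _ _] _ _] _ _ _]] := sok n. Qed.

Lemma continuous_fY n : continuous (fY (s n)).
Proof. by have [C [[_ [c _ _ _] _] _ _ _]] := sok n. Qed.

Lemma continuous_lim_u : continuous lim_u.
Proof.
move=> p; apply/cvgrPdist_le => e e0.
have e3 : 0 < e / 3 by rewrite divr_gt0.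
have [n hn] := tail_small e3.
have /cvgrPdist_le/(_ _ e3) := @continuous_fu n p.
apply: filterS => q hq.
have [_ /(_ n) h1] := lim_u_near p; have [_ /(_ n) h2] := lim_u_near q.
move: h1 h2 hq; rewrite !ler_norml => /andP[? ?] /andP[? ?] /andP[? ?].
by apply/andP; split; lra.
Qed.

Lemma measurable_lim_g : measurable_fun setT (lim_g : plane R -> R).
Proof.
apply: (@measurable_fun_cvg _ (plane R) R setT (fun n => fg (s n)) lim_g).
  by move=> n; have [C h] := sok n; apply: continuous_borel2; exact: continuous_fg h.
by move=> p _; have [] := lim_g_near p.
Qed.

Lemma tail_le1 n : tail n <= 1 / 2 :> R.
Proof.
rewrite /tail exprS div1r ler_piMr// exprn_ile1//.
by rewrite invf_le1// ler1n.
Qed.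

Lemma fu_bound n p : `|fu (s n) p| <= 1.
Proof.
have h0 := (lim_u_near p).2 0%N; have hn := (lim_u_near p).2 n.
rewrite s0 /= subr0 in h0; have := tail_le1 n; have := tail_le1 0.
move: h0 hn; rewrite !ler_norml => /andP[? ?] /andP[? ?] ? ?.
by apply/andP; split; lra.
Qed.

Lemma fg_bound n p : `|fg (s n) p| <= 1.
Proof.
have h0 := (lim_g_near p).2 0%N; have hn := (lim_g_near p).2 n.
rewrite s0 /fg /= !mulr0 !addr0 subr0 in h0; have := tail_le1 n; have := tail_le1 0.
move: h0 hn; rewrite /fg !ler_norml => /andP[? ?] /andP[? ?] ? ?.
by apply/andP; split; lra.
Qed.

Lemma lim_g_bound p : `|lim_g p| <= 1.
Proof.
have h0 := (lim_g_near p).2 0%N.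
rewrite s0 /fg /= !mulr0 !addr0 subr0 in h0; apply: (le_trans h0).
by apply: (le_trans (tail_le1 0)); lra.
Qed.

Lemma lim_balance : balance_law lim_u lim_g.
Proof.
move=> phi tphi.
have [cphi [c1 d1]] := @test_function_derive R (R * R)%type phi (1, 0) tphi.
have [_ [c2 d2]] := @test_function_derive R (R * R)%type phi (0, 1) tphi.
have [B B0 hB] := test_function_support tphi.
pose dom p := `|'D_(1, 0) phi p| + `|'D_(0, 1) phi p| + `|phi p|.
pose f n p := fu (s n) p * 'D_(1, 0) phi p + flux (fu (s n) p) * 'D_(0, 1) phi p + fg (s n) p * phi p.
pose f' p := lim_u p * 'D_(1, 0) phi p + flux (lim_u p) * 'D_(0, 1) phi p + lim_g p * phi p.
have cnorm (k : R * R -> R) : continuous k -> continuous (fun p => `|k p|).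
  by move=> ck; exact: (continuous_compf ck (fun z : R => @norm_continuous R R^o z)).
have cdom : continuous dom.
  exact: (continuousDf (continuousDf (cnorm _ c1) (cnorm _ c2)) (cnorm _ cphi)).
have dom0 p : B < `|p| -> dom p = 0.
  by move=> /hB h; rewrite /dom !near0_derive// (nbhs_singleton h) normr0 !addr0.
have [M M0 hM] := continuous_supp_bounded (@compact_ball2 R B) cdom dom0.
have idom : leb2.-integrable setT (EFin \o (dom : plane R -> R)).
  apply: (@integrable2_bounded _ _ B M); [exact: continuous_borel2|exact: hM|].
  by move=> p hp; apply: dom0; rewrite prod_normE lt_max; apply/orP.
have m1 n : measurable_fun setT (EFin \o (f n : plane R -> R)).
  have [C h] := sok n; have hi := balance_integrable (continuous_fu (n := n))
    (continuous_borel2 (continuous_fg h)) (fg_bound n) tphi.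
  exact: measurable_int hi.
have m2 : measurable_fun setT (EFin \o (f' : plane R -> R)).
  exact: measurable_int (balance_integrable continuous_lim_u measurable_lim_g lim_g_bound tphi).
have fcvg (p : plane R) : (fun n => f n p) @ \oo --> f' p.
  have [cu _] := lim_u_near p; have [cg _] := lim_g_near p.
  have cf : (fun n => flux (fu (s n) p)) @ \oo --> flux (lim_u p).
    by rewrite /flux; under eq_fun do rewrite expr2; rewrite expr2; exact: cvgM.
  by apply: cvgD; [apply: cvgD|]; apply: cvgMl.
have hb n (p : plane R) : `|f n p| <= dom p.
  have h1 := fu_bound n p; have h2 := fg_bound n p.
  have h3 : `|flux (fu (s n) p)| <= 1 by rewrite /flux normrX exprn_ile1.
  apply: (le_trans (ler_normD _ _)); apply: lerD.
    by apply: (le_trans (ler_normD _ _)); apply: lerD; rewrite normrM ler_piMl.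
  by rewrite normrM ler_piMl.
have ae1 : {ae leb2, forall p : plane R, setT p -> (fun n => (f n p)%:E) @ \oo --> (f' p)%:E}.
  by apply: aeW => p _; apply: cvg_EFin; [exact: nearW|exact: fcvg].
have ae2 : {ae leb2, forall (p : plane R) n, setT p -> (`|(f n p)%:E| <= (EFin \o dom) p)%E}.
  by apply: aeW => p n _; rewrite /= lee_fin.
have [_ _ cI] := @dominated_convergence _ (plane R) R leb2 setT measurableT
  (fun n => EFin \o f n) (EFin \o f') (EFin \o dom) m1 m2 ae1 idom ae2.
have <- := cvg_lim (@ereal_hausdorff R) cI.
rewrite (_ : (fun n => _) = fun=> 0%E) ?lim_cst//.
by apply/funext => n; have [C h] := sok n; exact: (flow_balance h tphi).
Qed.

Definition lim_K : set (R * R) :=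
  unit_square `&` \bigcap_n pattern (rat_seq n) (eps n) (N n) (fY (s n.+1)).

Lemma compact_lim_K : compact lim_K.
Proof.
apply: (subclosed_compact _ (@compact_ball2 R 1)); last first.
  by move=> p [[/andP[? ?] /andP[? ?]] _] /=; rewrite prod_normE ge_max !ger0_norm//; apply/andP.
apply: closedI; last by apply: closed_bigI => n _; apply: closed_pattern; exact: continuous_fY.
rewrite (_ : unit_square = ([set p | 0 <= p.1] `&` [set p | 0 <= 1 - p.1]) `&`
   ([set p | 0 <= p.2] `&` [set p | 0 <= 1 - p.2])); last first.
  apply/seteqP; split=> p; rewrite /unit_square/= !subr_ge0.
    by move=> [/andP[? ?] /andP[? ?]].
  by move=> [[-> ->] [-> ->]].
have c1 : continuous (fun p : R * R => p.1) by move=> ?; exact: cvg_fst.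
have c2 : continuous (fun p : R * R => p.2) by move=> ?; exact: cvg_snd.
have cc : continuous (fun _ : R * R => 1 : R) by move=> ?; exact: cvg_cst.
by apply: closedI; apply: closedI; apply: closed_nonneg => //; exact: continuousBf.
Qed.

Let D n : set (plane R) :=
  phases (l n) (fY (s n)) `\` pattern (rat_seq n) (eps n) (N n) (fY (s n.+1)).

Let mD n : measurable (D n).
Proof.
by apply: measurableD; [apply: measurable_phases|apply: closed_borel2; apply: closed_pattern]; exact: continuous_fY.
Qed.

(** A point that no step loses satisfies every pattern, which supplies the cosine condition for the
    new frequency; the old conditions persist by the fourth clause of [good_step]. *)
Let cover_K : unit_square `<=` lim_K `|` \bigcup_n D n.
Proof.
move=> p up; have [[n Dn]|nD] := pselect (exists n, D n p); first by right; exists n.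
have hp n : phases (l n) (fY (s n)) p.
  elim: n => [|n [_ IH]]; first by rewrite l0; split.
  split => // M; rewrite lS in_cons => /predU1P[->|Ml].
    have [] : pattern (rat_seq n) (eps n) (N n) (fY (s n.+1)) p.
      by apply: contrapT => np; apply: nD; exists n.
    - by move=> [_ []].
    - by move=> [_ []].
  by have [_ _ _ h _] := hs n; exact: h.
by left; split => // n _; apply: contrapT => np; apply: nD; exists n.
Qed.

Let sum_tail n : (\sum_(0 <= k < n) (tail k.+1)%:E <= (1 / 2 : R)%:E)%E.
Proof.
suff -> : (\sum_(0 <= k < n) (tail k.+1)%:E = (1 / 2 - tail n : R)%:E)%E.
  by rewrite lee_fin; have := @tail_gt0 R n; lra.
elim: n => [|n IH].
  by rewrite big_geq//; congr EFin; rewrite /tail expr1; field.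
by rewrite big_nat_recr//= IH -EFinD; congr EFin; rewrite (tailS n); ring.
Qed.

(** The losses sum to at most [1/2], whereas the square has measure 1. *)
Lemma lim_K_gt0 : (0 < leb2 (lim_K : set (plane R)))%E.
Proof.
have mK : measurable (lim_K : set (plane R)) by apply: compact_borel2; exact: compact_lim_K.
have mB : measurable (\bigcup_n D n) by exact: bigcupT_measurable.
have hB : (leb2 (\bigcup_n D n) <= (1 / 2 : R)%:E)%E.
  have h := @measure_sigma_subadditive _ _ (plane R) (@leb2 R) (\bigcup_n D n) D mD mB (fun p h => h).
  apply: (le_trans h); apply: lime_le; first exact: is_cvg_nneseries.
  apply: nearW => n; apply: le_trans (sum_tail n); apply: lee_sum => k _.
  by have [_ _ _ _] := hs k.
have mU := @measurable_unit_square R.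
have U1 : leb2 (unit_square : set (plane R)) = 1%E.
  have := leb2_box (@ler01 R) (@ler01 R); rewrite subr0 mulr1 => <-.
  by congr (leb2 _); apply/seteqP; split=> p; rewrite /unit_square/= !in_itv.
rewrite lt0e measure_ge0 andbT; apply/eqP => K0.
have K00 : (leb2 (lim_K : set (plane R)) <= 0%:E)%E by rewrite K0.
have [mKB h] := leb2U (conj mK K00) (conj mB hB).
have : (leb2 (unit_square : set (plane R)) <= (0 + 1 / 2 : R)%:E)%E.
  apply: le_trans h.
  by apply: le_measure; rewrite ?inE//.
by rewrite U1 add0r lee_fin; lra.
Qed.

(** Once chosen, [N n] belongs to all later lists. The induction carries the equality of phases
    along with that of velocities, because the next step tests the current phase. *)
Lemma frozen n p : cos (2 * N n * fY (s n.+1) p) <= 0 -> lim_u p = fu (s n.+1) p.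
Proof.
move=> c0.
have hm k : N n \in l (n.+1 + k)%N /\ fY (s (n.+1 + k)%N) p = fY (s n.+1) p /\
    fu (s (n.+1 + k)%N) p = fu (s n.+1) p.
  elim: k => [|k [Nl [eY eu]]]; first by rewrite addn0 lS mem_head.
  rewrite addnS lS in_cons Nl orbT; split => //.
  have [_ _ h _ _] := hs (n.+1 + k)%N.
  by have [|-> ->] := h p (N n) Nl; rewrite ?eY.
apply: cvg_lim => //; apply: cvg_near_cst; exists n.+1 => //= k nk.
by rewrite -(subnKC nk); have [_ []] := hm (k - n.+1)%N.
Qed.

(** [cos (2 z) >= 0] means [|cos z| >= 1 / sqrt 2 > 1/2], so [step (cos z + 1/2)] is exactly 0 or 1
    there, with zero derivative. *)
Let cos_large (z : R) : 0 <= cos (2 * z) -> cos z + 1 / 2 <= 0 \/ 1 <= cos z + 1 / 2.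
Proof.
rewrite mulr_natl cos_mulr2n -mulr_natl => h.
by case: (leP 0 (cos z)) => c; [right|left]; move: h; rewrite expr2; nra.
Qed.

(* [step (cos (N n * fY) + 1 / 2)] is locally constant where
   [cos (2 * N n * fY) > 0], and elsewhere [lim_u] is the velocity [fu] that
   transports [fY]. *)
Lemma first_integral n (I : set R) (gamma : R -> R) (t1 t2 : R) :
  characteristic lim_u I gamma -> t1 < t2 -> I t1 -> I t2 ->
  step (cos (N n * fY (s n.+1) (t1, gamma t1)) + 1 / 2) =
  step (cos (N n * fY (s n.+1) (t2, gamma t2)) + 1 / 2).
Proof.
move=> char t12 I1 I2; have [itvI dgam] := char.
pose F p := step (cos (N n * fY (s n.+1) p) + 1 / 2).
have cF : continuous F.
  have cc (c : R) : continuous (fun _ : R * R => c) by move=> ?; exact: cvg_cst.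
  have c1 := continuous_phase (M := N n) (continuous_fY (n := n.+1)).
  exact: (continuous_compf (continuousDf c1 (cc (1 / 2))) (Ck_continuous (@Ck_step R 0))).
have subI t : t1 <= t <= t2 -> I t by exact: itvI.
have nI t : t1 < t < t2 -> nbhs t I.
  move=> /andP[h1 h2]; have := near_in_itvoo (_ : t \in `]t1, t2[); rewrite in_itv/= h1 h2 => /(_ isT).
  by apply: filterS => x; rewrite in_itv/= => /andP[? ?]; apply: subI; rewrite !ltW.
have dF t : t \in `]t1, t2[ -> is_derive t (1 : R) (fun t => F (t, gamma t)) 0.
  rewrite in_itv/= => tI; have dg := characteristic_is_derive char (nI t tI).
  have [C [[_ hY _] rel _ _]] := sok n.+1.
  have [_ _ _ gY] := hY; have [_ _ eY _] := rel (t, gamma t).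
  have k0 := gY _ _ _ _ _ (is_derive_id t (1 : R)) dg.
  have k1 := @is_derive1_comp _ (@cos R) (fun t => N n * fY (s n.+1) (t, gamma t)) t _ _ (is_derive_cos _) (is_deriveMf (is_derive_cstf t 1 (N n)) k0).
  have k2 := is_deriveDf k1 (is_derive_cstf t 1 (1 / 2)).
  have k3 := @is_derive1_comp _ step (fun t => cos (N n * fY (s n.+1) (t, gamma t)) + 1 / 2) t _ _ (is_derive_step _) k2.
  apply: (is_derive_eq k3).
  have [c0|/ltW c0] := leP 0 (cos (2 * N n * fY (s n.+1) (t, gamma t))).
    rewrite -mulrA in c0; have [h|h] := cos_large c0; rewrite /= ?(dstep_le0 h) ?(dstep_ge1 h) ?mul0r//.
  rewrite (frozen c0) /=.
  set A := fYt _ _ in eY *; set B := fYx _ _ in eY *; set U := fu _ _ in eY *.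
  have -> : A * 1 + B * (2 * U) = 0 by rewrite -[RHS]eY; ring.
  by ring.
(* The times [t1] and [t2] may be endpoints of [I], where the characteristic has only a one-sided
   derivative. *)
have ends t (F0 : set_system R) (FF : Filter F0) : I t ->
    (forall A, within I t^' A -> F0 A) -> (forall A, nbhs t A -> F0 A) ->
    F (x, gamma x) @[x --> F0] --> F (t, gamma t).
  move=> It sub1 sub2; have cg := C1_on_cvg dgam It sub1.
  have ct : x @[x --> F0] --> t by move=> A; exact: sub2.
  have cp : (fun x => (x, gamma x)) @ F0 --> ((t, gamma t) : R * R) by exact: (cvg_pair ct (cg FF)).
  exact: (@cvg_comp _ _ _ (fun x => (x, gamma x)) F F0 _ _ cp (cF (t, gamma t))).
have cont : {within `[t1, t2], continuous (fun t => F (t, gamma t))}.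
  apply/(continuous_within_itvP _ t12); split.
  - by move=> t tI; have [d _] := dF t tI; apply: differentiable_continuous; apply/derivable1_diffP.
  - apply: ends => // A; last by move=> nA; apply: filterS nA => x Ax _.
    move=> hA; have {}hA : nbhs t1 (fun x => x != t1 -> I x -> A x) by exact: hA.
    have h2 : nbhs t1 (fun x : R => `|t1 - x| < t2 - t1).
      by apply/nbhs_ballP; exists (t2 - t1) => //=; rewrite subr_gt0.
    change (nbhs t1 (fun x => t1 < x -> A x)).
    move: hA h2; apply: filterS2 => x hA xt xt1; apply: hA; first by rewrite gt_eqF.
    by apply: subI; rewrite ltW//=; move: xt; rewrite ltr_norml => /andP[? ?]; lra.
  - apply: ends => // A; last by move=> nA; apply: filterS nA => x Ax _.
    move=> hA; have {}hA : nbhs t2 (fun x => x != t2 -> I x -> A x) by exact: hA.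
    have h2 : nbhs t2 (fun x : R => `|t2 - x| < t2 - t1).
      by apply/nbhs_ballP; exists (t2 - t1) => //=; rewrite subr_gt0.
    change (nbhs t2 (fun x => x < t2 -> A x)).
    move: hA h2; apply: filterS2 => x hA xt xt1; apply: hA; first by rewrite lt_eqF.
    by apply: subI; rewrite (ltW xt1) andbT; move: xt; rewrite ltr_norml => /andP[? ?]; lra.
have [c _] := MVT t12 (df := fun=> 0) dF cont.
by rewrite mul0r => /eqP; rewrite subr_eq0 => /eqP.
Qed.

Lemma characteristic_meets_once (I : set R) (gamma : R -> R) p q :
  characteristic lim_u I gamma -> (lim_K `&` curve I gamma) p ->
  (lim_K `&` curve I gamma) q -> p = q.
Proof.
move=> char; wlog pq : p q / p.1 <= q.1.
  move=> h hp hq; have [pq|/ltW qp] := leP p.1 q.1; first exact: h.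
  by apply/esym; exact: h.
move=> [Kp [t1 I1 pE]] [Kq [t2 I2 qE]].
move: pq; rewrite le_eqVlt => /predU1P[e|lt].
  by move: e; rewrite -pE -qE /= => ->.
exfalso; have [n /andP[n1 n2]] := rat_seq_dense lt.
have [[_ e0] _ _ _ _] := hs n.
have t12 : t1 < t2 by move: lt; rewrite -pE -qE.
have := first_integral n char t12 I1 I2; rewrite pE qE.
have sub (z : R) : cos z <= 0 -> 0 <= cos (2 * z) -> cos z + 1 / 2 <= 0.
  by move=> h /cos_large[//|]; lra.
have sup (z : R) : 0 <= cos z -> 0 <= cos (2 * z) -> 1 <= cos z + 1 / 2.
  by move=> h /cos_large[|//]; lra.
(* As [rat_seq n] lies strictly between the two times and [eps n > 0], the earlier point satisfies
   the first alternative of the pattern and the later one the second: the first integral would be 0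
   at one and 1 at the other. *)
have [_ /(_ n Logic.I)[[_ [c1 c2]]|[h _]]] := Kp; last by lra.
have [_ /(_ n Logic.I)[[h _]|[_ [c3 c4]]]] := Kq; first by lra.
rewrite -mulrA in c2; rewrite -mulrA in c4.
rewrite (step_le0 (sub _ c1 c2)) (step_ge1 (sup _ c3 c4)) => /eqP.
by rewrite eq_sym oner_eq0.
Qed.

Lemma lim_counterexample : counterexample lim_u lim_g lim_K.
Proof.
split.
- exact: continuous_lim_u.
- by split; [exact: measurable_lim_g|exact: lim_g_bound].
- exact: lim_balance.
- by split; [exact: compact_lim_K|exact: lim_K_gt0].
- move=> I gamma char; apply: hausdorff1_single => p q.
  exact: characteristic_meets_once.
Qed.

End limit.

Theorem counterexample_exists (R : realType) :
  exists (u g : R * R -> R) (K : set (R * R)), counterexample u g K.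
Proof.
have [s [l [N [eps [s0 l0 lS sok hs]]]]] := @flow_sequence R.
by do 3 eexists; exact: (lim_counterexample s0 l0 lS sok hs).
Qed.

Theorem mainTheorem2 (R : realType) :
  (exists (u g : R * R -> R) (K : set (R * R)), counterexample u g K) /\
  (forall (u g : R * R -> R) (K : set (R * R)), counterexample u g K ->
    [/\ forall chi, lagrangian_parameterization u chi ->
          ~ abs_continuous_param chi,
        forall chi, lagrangian_parameterization u chi ->
          exists mu muc : {measure set (plane R) -> \bar R},
            [/\ is_dy chi mu, is_cantor_part mu muc &
                exists A, borel2 A /\ muc A <> 0%E] &
        forall chi, lagrangian_parameterization u chi ->
          exists h, lagrangian_source u chi h /\ ~ eulerian_source u h]).
Proof.
split; first exact: counterexample_exists.
move=> u g K uK; split=> chi chiL.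
- exact: (not_abs_continuous uK chiL).
- exact: (cantor_part_nonzero uK chiL).
- exact: (lagrangian_source_not_eulerian uK chiL).
Qed.
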